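(* Assume that the batch size is geometric with parameter $q\in[0,1[$ and that $0<\varrho<1-q$. For given $s>0$, let $$\Phi(s,u,v)=P(s,u)\,(1-v)\,F^*(s,u,uv),\qquad 0<|u|<1,\ |v|<1,$$ where $P(s,u)=u^2-(s+1+\varrho+q)u+sq+\varrho+q$. Then $\Phi$ satisfies the inhomogeneous linear partial differential equation $$ \frac{\partial\Phi}{\partial u}(s,u,v)-\left[\frac{u-q}{P(s,u)}\right]v(1-v)\,\frac{\partial\Phi}{\partial v}(s,u,v)+\ell(s,u,v)=0 $$ for all $0<|u|<1$, $|v|<1$ with $P(s,u)\neq0$, where $$\ell(s,u,v)=(1-v)\,\frac{L(s,u,uv)}{u}$$ and $$ L(s,u,v)=\frac{v(1-uv)}{(1-u)^2(1-v)^2}+(u+v)\,E^*(s,q,v)+v\,(v-s-1-\varrho)\,\frac{\partial E^*}{\partial v}(s,q,v). $$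
   Context: Queue: $M^{[X]}/M/1$ Processor-Sharing queue. Batches of jobs arrive according to a Poisson process of rate $\varrho$; batch sizes are i.i.d. with the law of $B$, $\mathbb{P}(B=b)=(1-q)q^{b-1}$, $b\ge1$; the service requirements of all jobs are i.i.d. exponential with parameter $1$; arrivals, batch sizes and service requirements are independent. A single server of unit capacity serves all jobs present according to Processor Sharing: when $k\ge1$ jobs are present, each is served at rate $1/k$. $\Omega_{n,b}$ denotes the sojourn time of a (tagged) batch given that it contains $b\ge1$ jobs and that $n\ge0$ other jobs are already present at its arrival instant, i.e. the time from its arrival until all of its $b$ jobs are completed. $E_{n,b}(x)=\mathbb{P}(\Omega_{n,b}>x)$ for $x\in\mathbb{R}^+$. With $\mathbb{D}=\{u\in\mathbb{C}:|u|<1\}$, for $(u,v)\in\mathbb{D}^2$ and $s>0$: $$E(x,u,v)=\sum_{b\ge1}\sum_{n\ge0}E_{n,b}(x)u^nv^b,\qquad E^*(s,u,v)=\int_0^{+\infty}E(x,u,v)e^{-sx}\,\mathrm{d}x,$$ $$F^*(s,u,v)=\frac{E^*(s,u,v)-E^*(s,q,v)}{u-q}\ \text{ if }u\neq q,\qquad F^*(s,q,v)=\frac{\partial E^*}{\partial u}(s,q,v).$$ The function $\partial E^*/\partial v(s,q,v)$ is the partial derivative with respect to the last variable at the point $(s,q,v)$. *)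

(* Defs.v *)
From HB Require Import structures.
From mathcomp Require Import all_boot all_order all_algebra.
From mathcomp Require Import all_classical all_reals all_analysis.
From mathcomp Require Import measurable_realfun.
From mathcomp Require Import complex.

Set Implicit Arguments.
Unset Strict Implicit.
Unset Printing Implicit Defensive.

Import Order.TTheory GRing.Theory Num.Theory.
Import numFieldNormedType.Exports.

Local Open Scope classical_set_scope.
Local Open Scope ring_scope.
Local Open Scope complex_scope.

Definition mutually_independent d (T : measurableType d) (R : realType)
    (P : probability T R) (I : Type) (F : I -> set (set T)) : Prop :=
  forall (m : nat) (i : 'I_m -> I) (A : 'I_m -> set T),
    injective i -> (forall j, F (i j) (A j)) ->
    P (\bigcap_j A j) = (\prod_j P (A j))%E.

(* Random inputs of the queue as seen from the arrival of the tagged batch,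
   which is taken as the time origin.  [other_work i] is the (remaining) service
   requirement of the i-th job found in the system, [tagged_work j] that of the
   j-th job of the tagged batch.  The later batches k = 0, 1, ... are separated
   by the interarrival times [gap k], have [batch_size k] jobs, and
   [later_work k j] is the service requirement of the j-th job of batch k (only
   j < batch_size k is used). *)
Record batch_input d (T : measurableType d) (R : realType)
    (P : probability T R) := BatchInput {
  other_work : nat -> {RV P >-> R};
  tagged_work : nat -> {RV P >-> R};
  gap : nat -> {RV P >-> R};
  batch_size : nat -> {RV P >-> nat};
  later_work : nat -> nat -> {RV P >-> R} }.

Inductive source :=
  | OtherWork of nat
  | TaggedWork of nat
  | Gap of nat
  | Size of nat
  | LaterWork of nat & nat.

Section queue.
Context d (T : measurableType d) (R : realType) (P : probability T R).
Variable Q : batch_input P.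

Definition source_events (i : source) : set (set T) :=
  match i with
  | OtherWork i => preimage_set_system setT (other_work Q i) measurable
  | TaggedWork j => preimage_set_system setT (tagged_work Q j) measurable
  | Gap k => preimage_set_system setT (gap Q k) measurable
  | Size k => preimage_set_system setT (batch_size Q k) measurable
  | LaterWork k j => preimage_set_system setT (later_work Q k j) measurable
  end.

Definition exponential_law (r : R) (X : {RV P >-> R}) : Prop :=
  forall V : set R, measurable V -> distribution P X V = exponential_prob r V.

Definition geometric_law (q : R) (B : {RV P >-> nat}) : Prop :=
  forall b : nat, (1 <= b)%N ->
    distribution P B [set b] = ((1 - q) * q ^+ b.-1)%:E.

(* Inputs of the M^[X]/M/1 queue: batches arrive at the epochs of a Poisson
   process of rate rho, i.e. with i.i.d. exponential interarrival times. *)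
Definition MXM1_input (rho q : R) : Prop :=
  [/\ (forall i, exponential_law 1 (other_work Q i)) /\
      (forall j, exponential_law 1 (tagged_work Q j)),
      forall k, exponential_law rho (gap Q k),
      forall k, geometric_law q (batch_size Q k),
      forall k j, exponential_law 1 (later_work Q k j) &
      mutually_independent P source_events].

Definition arrival_time (k : nat) (w : T) : R := \sum_(i < k.+1) gap Q i w.

(* In the next three definitions, A t is the amount of service that a job
   staying in the system during [0, t] has received at time t.  Since all jobs
   present are served at the same rate, a job arrived at time a has received
   A t - A a at time t, and it is present as long as this is less than its
   requirement. *)
Definition jobs_present (n b : nat) (w : T) (A : R -> R) (t : R) : \bar R :=
  ((\sum_(i < n) (A t < other_work Q i w)%R%:R)%:E
   + (\sum_(j < b) (A t < tagged_work Q j w)%R%:R)%:E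
   + \sum_(k <oo) (\sum_(j < batch_size Q k w)
       ((arrival_time k w <= t) &&
        (A t - A (arrival_time k w) < later_work Q k j w))%R%:R)%:E)%E.

(* An idle server contributes 0^-1 = 0, so that A is constant on idle
   periods. *)
Definition processor_sharing (n b : nat) (w : T) (A : R -> R) : Prop :=
  forall t : R, 0 <= t ->
    A t = \int[lebesgue_measure]_(x in `[0, t]) (fine (jobs_present n b w A x))^-1.

Definition completion_time (b : nat) (w : T) (A : R -> R) : \bar R :=
  ereal_inf [set t%:E | t in
    [set t : R | 0 <= t /\ forall j, (j < b)%N -> tagged_work Q j w <= A t]].

Definition batch_sojourn (n b : nat) (Omega : T -> \bar R) : Prop :=
  {ae P, forall w, exists2 A : R -> R,
    processor_sharing n b w A & Omega w = completion_time b w A}.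

(* The survival functions E_{n,b}(x) of the family of sojourn times Omega *)
Definition survival (Omega : nat -> nat -> {RV P >-> \bar R})
    (n b : nat) (x : R) : R :=
  fine (P [set w | (x%:E < Omega n b w)%E]).

End queue.

(* Complex numbers, typed so that the topological and normed structures attached
   to every numFieldType apply. *)
Definition cplx (R : realType) : numFieldType := R[i].

Section transforms.
Context (R : realType).

Local Notation "x %:K" := ((x%:C)%C : cplx R) (at level 1, left associativity,
  only parsing).

Definition Cintegral (D : set R) (f : R -> cplx R) : cplx R :=
  (\int[lebesgue_measure]_(x in D) complex.Re (f x)) +i*
  (\int[lebesgue_measure]_(x in D) complex.Im (f x)).

(* Enb n b x stands for E_{n,b}(x) *)
Variable Enb : nat -> nat -> R -> R.

Definition Egf (x : R) (u v : cplx R) : cplx R :=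
  \big[+%R/0]_(1 <= b <oo) \big[+%R/0]_(0 <= n <oo)
    ((Enb n b x)%:K * u ^+ n * v ^+ b).

Definition Estar (s : R) (u v : cplx R) : cplx R :=
  Cintegral `[0, +oo[ (fun x => Egf x u v * (expR (- s * x))%:K).

Variables rho q : R.

Definition Fstar (s : R) (u v : cplx R) : cplx R :=
  if u == q%:K then derive1 (fun z : cplx R => Estar s z v) q%:K
  else (Estar s u v - Estar s q%:K v) / (u - q%:K).

Definition Ppoly (s : R) (u : cplx R) : cplx R :=
  u ^+ 2 - (s + 1 + rho + q)%:K * u + (s * q + rho + q)%:K.

Definition Phi (s : R) (u v : cplx R) : cplx R :=
  Ppoly s u * (1 - v) * Fstar s u (u * v).

Definition Lterm (s : R) (u v : cplx R) : cplx R :=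
  v * (1 - u * v) / ((1 - u) ^+ 2 * (1 - v) ^+ 2)
  + (u + v) * Estar s q%:K v
  + v * (v - (s + 1 + rho)%:K) * derive1 (fun z : cplx R => Estar s q%:K z) v.

Definition ell (s : R) (u v : cplx R) : cplx R := (1 - v) * (Lterm s u (u * v) / u).

End transforms.

(* Main.v *)
Require Import Defs.
From HB Require Import structures.
From mathcomp Require Import all_boot all_order all_algebra.
From mathcomp Require Import all_classical all_reals all_analysis.
From mathcomp Require Import measurable_realfun complex.
From mathcomp Require Import ring lra.

Set Implicit Arguments.
Unset Strict Implicit.
Unset Printing Implicit Defensive.

Import Order.TTheory GRing.Theory Num.Theory.
Import numFieldNormedType.Exports.

Local Open Scope classical_set_scope.
Local Open Scope ring_scope.

(** Let e_{n,b} be the Laplace transform at s of E_{n,b}.  With n other jobs and b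
    tagged ones present, the next event occurs at rate 1 + rho: it is the
    completion of one of the n + b jobs, all equally likely, with probability
    1 / (1 + rho), and the arrival of a batch otherwise.  Hence
      (s + 1 + rho) (n + b) e_{n,b} = n + b + n e_{n-1,b} + b e_{n,b-1}
                                      + rho (1 - q) (n + b) f_{n,b},
    where f_{n,b} is the sum over m of q^m e_{n+m+1,b}.  Pathwise, the attained
    service of a job grows linearly up to the next event, at which the residual
    requirements and the next interarrival time are again independent
    exponential variables; cutting the path after N events encloses E e^{-s Omega}
    between two numbers with a gap of at most ((1 + rho) / (1 + rho + s))^N.
    Since e_{n+1,b} = f_{n,b} - q f_{n+1,b}, the generating function of f is F*.
    Multiplying the recurrence by u^n v^b and summing then gives a first-order
    linear equation for F*, which is the equation for Phi at (u, u v). *)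

(** * Attained service *)

(** No conditional law or Markov property is invoked. The state after an event is described by a
    weight [psi] under the original probability: [psi] carries the indicators of past events and the
    discount accumulated so far, and [fresh] says that under [psi] the residual clocks have product
    exponential tails. A completion, an arrival and the value of a batch size each turn such a
    weight into another of explicit mass. The paths raise a second obstacle: the service [A] is
    known only through an integral equation, so even its linear growth between events has to be
    derived.

    On the analytic side, the coefficients f absorb the division by u - q, so that u = q needs no
    separate equation. Let N and B be the series of F* with weights n and b, and w = u v. In the
    summed recurrence, with all terms on the left, N has coefficient -P(s,u), which is the origin of
    P, and B has coefficient -P(s,u) + u (1 - v) (u - q), whose excess yields the v-derivative. The
    substitution w = u v makes N + B a single derivative: u d/du of F*(s, u, u v) brings down n + b,
    while v d/dv brings down b. *)

Section service.
Context {R : realType}.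
Implicit Types (A r : R -> R).
Local Notation mu := (@lebesgue_measure R).

(** The integral of a nonnegative function is a supremum over simple functions below it, so
    comparison holds without measurability. This breaks a circle: the rate [r] is shown measurable
    from the monotonicity of [A], which itself comes from comparing integrals of [r]. *)
Lemma ge0_le_integral_nonmeasurable (D1 D2 : set R) (f g : R -> \bar R) :
  D1 `<=` D2 -> (forall x, D2 x -> (0 <= g x)%E) ->
  (forall x, D1 x -> (0 <= f x <= g x)%E) ->
  (\int[mu]_(x in D1) f x <= \int[mu]_(x in D2) g x)%E.
Proof.
move=> D12 g0 fg; rewrite !ge0_integralE//; last first.
  by move=> x /fg/andP[].
apply: le_ereal_sup => _ [h /= hf <-]; exists h => //= x.
apply: (le_trans (hf x)); rewrite !patchE; case: ifPn => xD1.
  by rewrite mem_set//; [case/andP: (fg x (set_mem xD1))|exact/D12/set_mem].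
by case: ifPn => // xD2; exact: g0 (set_mem xD2).
Qed.

Variables (A r : R -> R).
Hypothesis r01 : forall y, 0 <= r y <= 1.
Hypothesis Ar : forall t, 0 <= t -> A t = \int[mu]_(x in `[0, t]) r x.

Lemma service_nondecreasing x y : 0 <= x -> x <= y -> A x <= A y.
Proof.
move=> x0 xy; have y0 := le_trans x0 xy.
have fin z : 0 <= z -> ((\int[mu]_(x in `[0%R, z]) (r x)%:E)%E \is a fin_num).
  move=> z0; rewrite ge0_fin_numE; last first.
    by apply: integral_ge0 => u _; rewrite lee_fin; case/andP: (r01 u).
  apply: (@le_lt_trans _ _ (\int[mu]_(x in `[0%R, z]) (cst 1%E) x)%E).
    apply: ge0_le_integral_nonmeasurable => // u _ /=.
    by rewrite !lee_fin r01.
  by rewrite integral_cst//= mul1e lebesgue_measure_itv/=; case: ifP; rewrite ?ltry// -EFinB ltry.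
rewrite !Ar// /Rintegral fine_le ?fin//; apply: ge0_le_integral_nonmeasurable.
- by apply: subset_itvl; rewrite bnd_simp.
- by move=> u _; rewrite lee_fin; case/andP: (r01 u).
- by move=> u _; rewrite !lee_fin lexx; case/andP: (r01 u) => ->.
Qed.

Hypothesis mr : measurable_fun (`[0, +oo[ : set R) r.

Lemma rate_integrable x y : 0 <= x -> mu.-integrable `[x, y] (EFin \o r).
Proof.
move=> x0; have mxy : measurable_fun (`[x, y] : set R) r.
  by apply: measurable_funS mr => //; apply: subset_itv; rewrite bnd_simp.
apply: (@le_integrable _ _ _ mu _ _ _ (EFin \o cst 1)) => //.
- exact/measurable_EFinP.
- move=> u _ /=; rewrite lee_fin normr1 ger0_norm; by case/andP: (r01 u).
- apply/integrableP; split; first exact/measurable_EFinP.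
  under eq_integral do rewrite /= normr1.
  rewrite integral_cst//= mul1e lebesgue_measure_itv/=; case: ifP; rewrite ?ltry// -EFinB ltry//.
Qed.

Lemma service_increment x y : 0 <= x -> x <= y ->
  A y - A x = \int[mu]_(u in `[x, y]) r u.
Proof.
move=> x0 xy; rewrite !Ar//; last exact: le_trans xy.
have ixy := rate_integrable y x0.
rewrite (@Rintegral_itvB _ r (BLeft 0) (BRight y) x) ?bnd_simp//.
- by rewrite Rintegral_itv_obnd_cbnd//; apply: integrableS ixy => //; apply: subset_itvr; rewrite bnd_simp.
- exact: rate_integrable.
Qed.

Lemma le_service_increment x y : 0 <= x -> x <= y -> A y - A x <= y - x.
Proof.
move=> x0 xy; rewrite service_increment//.
have -> : y - x = \int[mu]_(u in `[x, y]) 1.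
  rewrite Rintegral_cst//= mul1r lebesgue_measure_itv/= lte_fin.
  by case: ltP => [_|yx]//=; apply/eqP; rewrite subr_eq0; apply/eqP/le_anti; rewrite xy yx.
apply: le_Rintegral => //; first exact: rate_integrable.
  apply/integrableP; split; first exact/measurable_EFinP.
  under eq_integral do rewrite /= normr1.
  rewrite integral_cst//= mul1e lebesgue_measure_itv/=; case: ifP; rewrite ?ltry// -EFinB ltry//.
by move=> u _; case/andP: (r01 u).
Qed.

Lemma service_increment_cst x y a : 0 <= x -> x <= y ->
  (forall u, x <= u < y -> r u = a) -> A y - A x = a * (y - x).
Proof.
move=> x0 xy ra; rewrite service_increment//.
rewrite -(Rintegral_itv_bndo_bndc (a := BLeft x)); last first.
  by apply: integrableS (rate_integrable y x0) => //; apply: subset_itvl; rewrite bnd_simp.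
rewrite (@eq_Rintegral _ _ _ _ _ (cst a)); last first.
  by move=> u; rewrite inE/= in_itv/= => /ra.
rewrite Rintegral_cst//= lebesgue_measure_itv/= lte_fin.
by case: ltP => [_|yx]//=; rewrite (_ : y = x) ?subrr ?mulr0//; apply/le_anti; rewrite xy yx.
Qed.

(** [A] is nondecreasing and 1-Lipschitz on the nonnegative half-line. Continuity feeds the
    intermediate value theorem in [service_before_event]. *)
Lemma service_continuous x y : 0 <= x -> {within `[x, y], continuous A}.
Proof.
move=> x0; apply/subspace_continuousP => z; rewrite /= in_itv/= => /andP[xz zy].
apply/cvgrPdist_le => e e0.
rewrite near_withinE; near=> w => /=; rewrite in_itv/= => /andP[xw _].
have zwe : `|z - w| <= e by near: w; exact: (@cvgr_dist_le _ _ _ _ _ id z).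
change (`|A z - A w| <= e); have [zw|wz] := leP z w.
- have h1 := le_service_increment (le_trans x0 xz) zw.
  have h2 := service_nondecreasing (le_trans x0 xz) zw.
  move: zwe; rewrite distrC ger0_norm ?subr_ge0// => zwe.
  by rewrite distrC ger0_norm ?subr_ge0// (le_trans h1).
- have h1 := le_service_increment (le_trans x0 xw) (ltW wz).
  have h2 := service_nondecreasing (le_trans x0 xw) (ltW wz).
  move: zwe; rewrite ger0_norm ?subr_ge0 ?(ltW wz)// => zwe.
  by rewrite ger0_norm ?subr_ge0// (le_trans h1).
Unshelve. all: by end_near.
Qed.

End service.

(** * Paths of the queue, restarted at each event *)

Section dynamics.
Context {R : realType}.
Local Notation mu := (@lebesgue_measure R).
Implicit Types (A : R -> R) (x : nat * nat -> R) (g : nat -> R) (be : nat -> nat).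
Implicit Types (S o t : seq (nat * nat)).

(* Jobs are labelled by pairs: (0, i) is the i-th job found in the system, (1, i)
   the i-th tagged job, and (k.+2, i) the i-th job of the later batch k. *)
Definition batch (j m : nat) : seq (nat * nat) := [seq (j.+2, l) | l <- iota 0 m].

(** The delay is counted from the current origin, and [g j] is what remains of the current
    interarrival time; moving the origin before the next arrival therefore changes [g j] alone. *)
Definition arrival g (j k : nat) : R := \sum_(i < k.+1) g (j + i)%N.

Definition unfinished S x (a : R) : R := \sum_(l <- S) (a < x l)%R%:R.

Definition newcomers A x g be (j : nat) (T0 y : R) : \bar R :=
  (\sum_(k <oo) (\sum_(l < be (j + k)%N)
     ((T0 + arrival g j k <= y) &&
      (A y - A (T0 + arrival g j k) < x ((j + k).+2, val l)))%R%:R)%:E)%E.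

(* The number of jobs present at time y, when the jobs S with residual
   requirements x are present at time T0 and the batches from the j-th on are
   still to come, the j-th one after a delay g j. *)
Definition load A x g be S j (T0 y : R) : \bar R :=
  ((unfinished S x (A y - A T0))%:E + newcomers A x g be j T0 y)%E.

Lemma nat_sum_eq0_ge1 (I : Type) (s : seq I) (P : pred I) :
  let u : R := \sum_(i <- s) (P i)%:R in u = 0 \/ 1 <= u.
Proof.
move=> u; rewrite /u -natr_sum; case: (\sum_(i <- s) P i)%N => [|m]; first by left.
by right; rewrite -natr1 lerDr.
Qed.

Lemma newcomers_ge0 A x g be j T0 y : (0 <= newcomers A x g be j T0 y)%E.
Proof.
by apply: nneseries_ge0 => k _ _; rewrite lee_fin; apply: sumr_ge0.
Qed.

Lemma nneseries_eq0_ge1 (u : nat -> \bar R) :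
  (forall k, u k = 0 \/ (1 <= u k)%E) ->
  (\sum_(k <oo) u k = 0)%E \/ (1 <= \sum_(k <oo) u k)%E.
Proof.
move=> u01; have u0 k : (0 <= u k)%E by have [->|/(le_trans _)->] := u01 k.
have [[k uk]|/forallNP u1] := pselect (exists k, (1 <= u k)%E).
  right; apply: le_trans uk _.
  apply: le_trans (nneseries_lim_ge k.+1 _); last by move=> *; exact: u0.
  by rewrite big_nat_recr//= leeDr// sume_ge0.
by left; apply: eseries0 => k _ _; have [|/u1] := u01 k.
Qed.

Lemma newcomers_eq0_ge1 A x g be j T0 y :
  newcomers A x g be j T0 y = 0%E \/ (1 <= newcomers A x g be j T0 y)%E.
Proof.
apply: nneseries_eq0_ge1 => k.
have [|] := nat_sum_eq0_ge1 (index_enum 'I_(be (j + k)%N)) (fun l =>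
  (T0 + arrival g j k <= y) && (A y - A (T0 + arrival g j k) < x ((j + k).+2, val l))).
  by move=> ->; left.
by right; rewrite lee_fin.
Qed.

(** The load is a count: zero, at least one, or infinite. The conventions [fine +oo = 0] and
    [0^-1 = 0] put the rate in [0, 1] in the two extreme cases as well. *)
Lemma rate01 A x g be S j T0 y : 0 <= (fine (load A x g be S j T0 y))^-1 <= 1.
Proof.
rewrite /load; set c := unfinished _ _ _.
have c0 : 0 <= c by apply: sumr_ge0.
have [v vge0 v01] : exists2 v : \bar R, (0 <= v)%E &
    (newcomers A x g be j T0 y = v) /\ (v = 0%E \/ (1 <= v)%E).
  by exists (newcomers A x g be j T0 y); [exact: newcomers_ge0|split=> //; exact: newcomers_eq0_ge1].
have inv1 (w : R) : 1 <= w -> 0 <= w^-1 <= 1.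
  by move=> w1; rewrite invr_ge0 invf_le1 ?w1 ?(le_trans _ w1)// (lt_le_trans _ w1).
case: v01 vge0 => -> v01.
case: v v01 => [v| |]//= v01; last by rewrite invr0 lexx ler01.
rewrite lee_fin => v0.
have [c00|c1] : c = 0 \/ 1 <= c by exact: nat_sum_eq0_ge1.
  rewrite c00 add0r; case: v01 => [[->]|]; first by rewrite invr0 lexx ler01.
  by rewrite lee_fin; exact: inv1.
by apply: inv1; rewrite ler_wpDr.
Qed.

(** [A] is monotone on [0, +oo[ only, so it is first extended to a monotone function [B] of the
    whole line; nonnegative arrival delays keep every evaluation point where the two agree. The
    inverse is then written as the power -1, known to be measurable. *)
Lemma measurable_rate A x g be S j : (forall k, 0 <= arrival g j k) ->
  (forall y z, 0 <= y -> y <= z -> A y <= A z) ->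
  measurable_fun (`[0, +oo[ : set R) (fun y => (fine (load A x g be S j 0 y))^-1).
Proof.
move=> a0 ndA.
pose B y := A (Num.max 0 y).
have mB : measurable_fun setT B.
  apply: nondecreasing_measurable => //= y z yz.
  apply: ndA; first by rewrite le_max lexx.
  by rewrite ge_max !le_max lexx yz orbT.
have AB y : 0 <= y -> A y = B y by move=> y0; rewrite /B max_r.
apply: (eq_measurable_fun (fun y => fine (load B x g be S j 0 y) `^ (- 1))).
  move=> y; rewrite inE/= in_itv/= andbT => y0; rewrite powR_inv1; last first.
    by apply: fine_ge0; rewrite adde_ge0 ?newcomers_ge0// lee_fin; apply: sumr_ge0.
  congr (fine _)^-1; rewrite /load /newcomers -!AB//; congr (_ + _)%E.
  apply: eq_eseriesr => k _; congr EFin; apply: eq_bigr => l _.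
  by rewrite add0r !AB.
apply: (measurable_funS measurableT (@subsetT _ _)).
apply: (measurableT_comp (measurable_powR _)).
apply: (measurableT_comp (fine_measurable measurableT)).
apply: emeasurable_funD.
  apply/measurable_EFinP; apply: measurable_sum => l.
  apply: (@measurableT_comp _ _ _ _ _ _ (fun b : bool => b%:R : R)) => //.
  apply: measurable_fun_ltr => //; apply: measurable_funB => //.
apply: ge0_emeasurable_sum => [k y _ _|k _].
  by rewrite lee_fin; apply: sumr_ge0.
apply/measurable_EFinP; apply: measurable_sum => l.
apply: (@measurableT_comp _ _ _ _ _ _ (fun b : bool => b%:R : R)) => //.
apply: measurable_and; first exact: measurable_fun_ler.
by apply: measurable_fun_ltr => //; apply: measurable_funB.
Qed.

Lemma newcomers_before A x g be j T0 y : (forall i, 0 <= g (j + i)%N) ->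
  y < T0 + g j -> newcomers A x g be j T0 y = 0%E.
Proof.
move=> g0 yg; apply: eseries0 => k _ _.
rewrite big1// => l _; rewrite (_ : _ <= y = false)//.
apply/negbTE; rewrite -ltNge (lt_le_trans yg)// lerD2l /arrival big_ord_recl/= addn0.
by rewrite lerDl sumr_ge0.
Qed.

Lemma unfinished_all S x a : {in S, forall l, a < x l} ->
  unfinished S x a = (size S)%:R.
Proof.
move=> ax; rewrite /unfinished (eq_big_seq (fun=> 1%:R)); last by move=> l /ax ->.
by rewrite big_const_seq count_predT -Monoid.iteropE.
Qed.

Lemma unfinished_perm S S' x a : perm_eq S S' -> unfinished S x a = unfinished S' x a.
Proof. exact: perm_big. Qed.

(** [lower] and [lowg] restart the path at an event: all jobs present have received the same
    service, and part of the current interarrival delay has elapsed. The new state has the same form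
    as the old one, which allows an induction on events. *)
Definition lower x S (a : R) := fun l => if l \in S then x l - a else x l.
Definition lowg g (j : nat) (tau : R) := fun i : nat => if i == j then g i - tau else g i.

Lemma arrival_lowg g j tau k : arrival (lowg g j tau) j k = arrival g j k - tau.
Proof.
rewrite /arrival !big_ord_recl/= /lowg addn0 eqxx addrAC; congr (_ + _ - _).
apply: eq_bigr => i _; rewrite /bump/= add1n.
by rewrite -[X in _ == X]addn0 eqn_add2l.
Qed.

Lemma arrivalS g j k : arrival g j k.+1 = g j + arrival g j.+1 k.
Proof.
rewrite /arrival big_ord_recl/= addn0; congr (_ + _).
by apply: eq_bigr => i _; rewrite /bump/= add1n addnS.
Qed.

(** * The path up to its first event *)

Section first_event.
Variables (A : R -> R) (N : R -> \bar R).
Let r y := (fine (N y))^-1.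
Hypothesis r01 : forall y, 0 <= r y <= 1.
Hypothesis mr : measurable_fun (`[0, +oo[ : set R) r.
Hypothesis Ar : forall y, 0 <= y -> A y = \int[mu]_(x in `[0, y]) r x.

Variables (S : seq (nat * nat)) (x : nat * nat -> R) (g : nat -> R).
Variables (be : nat -> nat) (j : nat) (T0 : R).
Hypothesis T00 : 0 <= T0.
Hypothesis NE : forall y, T0 <= y -> N y = load A x g be S j T0 y.
Hypothesis g0 : forall i, 0 < g (j + i)%N.
Hypothesis idS : {in S, forall l, (l.1 < j.+2)%N}.

(** Up to [tau] there is no arrival and, provided that no job completes, each of the [size S] jobs
    is served at rate [1 / size S]. The proviso is the real content: it concerns [A], whose growth
    is precisely what is sought. *)
Lemma service_before_event tau y : (0 < size S)%N -> tau <= g j ->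
  {in S, forall l, tau <= (size S)%:R * x l} ->
  T0 <= y <= T0 + tau -> A y - A T0 = (y - T0) / (size S)%:R.
Proof.
move=> S0 tg tx /andP[T0y yT].
have k0 : 0 < (size S)%:R :> R by rewrite ltr0n.
have g0' i : 0 <= g (j + i)%N by exact/ltW.
have rk u : T0 <= u < T0 + tau -> {in S, forall l, A u - A T0 < x l} ->
    r u = (size S)%:R^-1.
  move=> /andP[T0u uT] ux; rewrite /r NE// /load newcomers_before//.
    by rewrite adde0 unfinished_all.
  by rewrite (lt_le_trans uT)// lerD2l.
have early u l : T0 <= u < T0 + tau -> l \in S -> A u - A T0 < x l.
  move=> /andP[T0u uT] lS; rewrite ltNge; apply/negP => xl.
  (* If [A] reached a requirement at [u], too early, it would reach the lower level [m] at some
     [z <= u]. No job completes before [z], so the growth is linear there and [m = (z - T0) / size S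
     <= (u - T0) / size S < m]. *)
  have [m /andP[um mtau]] : exists m, (u - T0) / (size S)%:R < m < tau / (size S)%:R.
    exists (((u - T0) / (size S)%:R + tau / (size S)%:R) / 2).
    by rewrite !midf_lt// ltr_pM2r ?invr_gt0// ltrBlDl.
  have mx i : i \in S -> m < x i.
    by move=> iS; rewrite (lt_le_trans mtau)// ler_pdivrMr// mulrC tx.
  have m0 : 0 <= m by rewrite (le_trans _ (ltW um))// divr_ge0 ?subr_ge0// ltW.
  have mid : Num.min (A T0) (A u) <= A T0 + m <= Num.max (A T0) (A u).
    apply/andP; split; first by rewrite ge_min lerDl m0.
    by rewrite le_max; apply/orP; right; rewrite -lerBrDl (le_trans _ xl)// ltW// mx.
  have [z] := IVT T0u (service_continuous r01 Ar mr (y := u) T00) mid.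
  rewrite in_itv/= => /andP[T0z zu] Az.
  have mz := @service_increment_cst R A r r01 Ar mr T0 z (size S)%:R^-1 T00 T0z.
  rewrite Az addrAC subrr add0r in mz.
  have : m < m.
    rewrite {1}mz; last first.
      move=> w /andP[T0w wz]; apply: rk; first by rewrite T0w (lt_trans wz)// (le_lt_trans zu).
      move=> i iS; rewrite (le_lt_trans _ (mx i iS))// lerBlDl.
      by rewrite -Az (service_nondecreasing r01 Ar)// ?(le_trans T00)// ltW.
    by rewrite mulrC (le_lt_trans _ um)// ler_pM2r ?invr_gt0// lerD2r.
  by rewrite ltxx.
rewrite mulrC.
apply: (@service_increment_cst R A r r01 Ar mr T0 y _ T00 T0y) => u /andP[T0u uy].
have uT : T0 <= u < T0 + tau by rewrite T0u (lt_le_trans uy).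
by apply: rk => // l lS; exact: early.
Qed.

Lemma service_at_event tau : (0 < size S)%N -> 0 <= tau <= g j ->
  {in S, forall l, tau <= (size S)%:R * x l} ->
  A (T0 + tau) - A T0 = tau / (size S)%:R.
Proof.
move=> S0 /andP[tau0 tg] tx.
by rewrite (service_before_event S0 tg tx) ?lexx ?lerDl ?tau0// [_ + tau]addrC addrK.
Qed.

(** The completed job never counts again because [A] is nondecreasing. By [idS] no label of a future
    batch lies in [S], hence [lower] leaves the requirements of later batches intact. *)
Lemma load_after_completion i y : i \in S -> 0 <= x i ->
  (size S)%:R * x i <= g j -> {in S, forall l, x i <= x l} ->
  T0 + (size S)%:R * x i <= y ->
  N y = load A (lower x S (x i)) (lowg g j ((size S)%:R * x i)) be (rem i S) j
          (T0 + (size S)%:R * x i) y.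
Proof.
move=> iS xi0 xg xmin Ty; set k := (size S)%:R in xg Ty *.
have S0 : (0 < size S)%N by case: S iS.
have k0 : 0 < k by rewrite ltr0n.
have kx0 : 0 <= k * x i by rewrite mulr_ge0// ltW.
have AT1 : A (T0 + k * x i) - A T0 = x i.
  rewrite service_at_event// ?kx0// -/k; first by rewrite mulrAC divff ?mul1r// gt_eqF.
  by move=> l lS; rewrite ler_pM2l// xmin.
have T0y : T0 <= y by rewrite (le_trans _ Ty)// lerDl.
have xiy : x i <= A y - A T0.
  by rewrite -[leLHS]AT1 lerD2r (service_nondecreasing r01 Ar)// addr_ge0.
have dA z : A z - A (T0 + k * x i) = A z - A T0 - x i.
  by rewrite -[X in _ = _ - X]AT1 opprB addrA subrK.
rewrite NE// /load; congr (_ + _)%E.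
  congr EFin; rewrite /unfinished (perm_big _ (perm_to_rem iS)) big_cons.
  rewrite ltNge xiy /= add0r; apply: eq_big_seq => l /mem_rem lS.
  by rewrite /lower lS dA ltrD2r.
apply: eq_eseriesr => n _; congr EFin; apply: eq_bigr => l _.
rewrite arrival_lowg addrA addrAC addrK /lower ifF//.
by apply/negbTE/negP => /idS /=; rewrite ltnNge !ltnS leq_addr.
Qed.

(** The first term of the series of newcomers becomes the unfinished part of [batch j (be j)]; the
    other terms, reindexed by one, are the newcomers from batch [j.+1] on. *)
Lemma load_after_arrival y : (0 < size S)%N ->
  {in S, forall l, g j <= (size S)%:R * x l} -> T0 + g j <= y ->
  N y = load A (lower x S (g j / (size S)%:R)) g be (S ++ batch j (be j)) j.+1
          (T0 + g j) y.
Proof.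
move=> S0 xg Ty; set k := (size S)%:R in xg *.
have g0j : 0 < g j by rewrite -[j]addn0.
have AT1 : A (T0 + g j) - A T0 = g j / k.
  by rewrite service_at_event// lexx ltW.
have T0y : T0 <= y by rewrite (le_trans _ Ty)// lerDl ltW.
have dA z : A z - A (T0 + g j) = A z - A T0 - g j / k.
  by rewrite -AT1 opprB addrA subrK.
have lowerE m l : (m >= j)%N -> lower x S (g j / k) (m.+2, l) = x (m.+2, l).
  by move=> jm; rewrite /lower ifF//; apply/negbTE/negP => /idS /=; rewrite ltnNge !ltnS jm.
rewrite NE// /load /newcomers nneseries_recl//; last first.
  by move=> n _; rewrite lee_fin; apply: sumr_ge0.
rewrite addeA -EFinD; congr (_ + _)%E.
  congr EFin; rewrite /unfinished big_cat/=; congr (_ + _).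
    by apply: eq_big_seq => l lS; rewrite /lower lS dA ltrD2r.
  rewrite addn0 /batch big_map /arrival big_ord1 addn0.
  rewrite -[X in iota 0 X]subn0 -/(index_iota 0 (be j)) big_mkord; apply: eq_bigr => l _.
  by rewrite Ty lowerE.
rewrite -(nneseries_addn 1); last by move=> n; rewrite lee_fin; apply: sumr_ge0.
apply: eq_eseriesr => n _; congr EFin.
rewrite addn1 addnS addSn; apply: eq_bigr => l _.
by rewrite arrivalS addrA lowerE// leqW// leq_addr.
Qed.

End first_event.

(** Strict comparisons, here and in [arrives_first], make the first events mutually exclusive on a
    duplicate-free [S]; ties are left to the last term of [discount]. *)
Definition completes_first S x g (j : nat) (i : nat * nat) : bool :=
  ((size S)%:R * x i < g j) && all (fun l => (l == i) || (x i < x l)) S.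

Definition arrives_first S x g (j : nat) : bool :=
  all (fun l => g j < (size S)%:R * x l) S.

Variable s : R.

(* The discount factor exp(- s Omega) of a path, followed through its first n
   events and then replaced with c, when the jobs present are the other jobs o
   and the tagged jobs t.  Simultaneous events, which have probability 0, also
   give c, so that c = 0 and c = 1 yield bounds on every path. *)
Fixpoint discount (c : R) (n : nat) o t (j : nat) x g be : R :=
  if nilp t then 1 else
  if n is n'.+1 then
    let S := o ++ t in let k := (size S)%:R in
    \sum_(i <- S) (completes_first S x g j i)%:R *
      (expR (- (s * (k * x i))) *
       discount c n' (rem i o) (rem i t) j (lower x S (x i)) (lowg g j (k * x i)) be)
    + (arrives_first S x g j)%:R *
      (expR (- (s * g j)) *
       discount c n' (o ++ batch j (be j)) t j.+1 (lower x S (g j / k)) g be)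
    + (~~ (has (completes_first S x g j) S || arrives_first S x g j))%:R * c
  else c.

(** An infinite sojourn is given the limit value 0. *)
Definition exp_sojourn (W : \bar R) : R := if W is y%:E then expR (- (s * y)) else 0.

Definition end_time A T0 x t : \bar R := ereal_inf [set y%:E | y in
  [set y : R | T0 <= y /\ {in t, forall l, x l <= A y - A T0}]].

Hypothesis s0 : 0 < s.

Lemma end_time_ge A T0 x t : (T0%:E <= end_time A T0 x t)%E.
Proof. by apply: le_ereal_inf_tmp => _ [y [T0y _] <-]; rewrite lee_fin. Qed.

(** The factor [expR (s * T0)] converts the end epoch into the time remaining after [T0], so the
    product is a discount factor over a nonnegative duration. *)
Lemma exp_sojourn_itv A T0 x t :
  0 <= expR (s * T0) * exp_sojourn (end_time A T0 x t) <= 1.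
Proof.
have := end_time_ge A T0 x t; case: end_time => [y| |]//=; last first.
  by rewrite mulr0 lexx ler01.
rewrite lee_fin => T0y; rewrite -expRD expR_ge0/= -[leRHS]expR0 ler_expR.
by rewrite -mulrBr pmulr_rle0// subr_le0.
Qed.

Lemma exp_sojourn_nil A T0 x :
  expR (s * T0) * exp_sojourn (end_time A T0 x [::]) = 1.
Proof.
rewrite (_ : end_time _ _ _ _ = T0%:E) /=; first by rewrite -expRD subrr expR0.
apply/le_anti/andP; split; last exact: end_time_ge.
by apply: ereal_inf_lbound; exists T0.
Qed.

(** The tagged jobs cannot all be finished before [T0 + tau], and from then on being finished means
    the same for the old and the restarted state. Both infima thus range over the same set of
    times. *)
Lemma exp_sojourn_step A T0 tau x x' t t' : 0 <= tau ->
  (forall y, T0 <= y < T0 + tau -> exists2 l, l \in t & A y - A T0 < x l) ->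
  (forall y, T0 + tau <= y -> {in t, forall l, x l <= A y - A T0} <->
     {in t', forall l, x' l <= A y - A (T0 + tau)}) ->
  expR (s * T0) * exp_sojourn (end_time A T0 x t) =
  expR (- (s * tau)) *
    (expR (s * (T0 + tau)) * exp_sojourn (end_time A (T0 + tau) x' t')).
Proof.
move=> tau0 early late; rewrite mulrA -expRD (_ : _ + _ = s * T0); last by ring.
congr (_ * exp_sojourn (ereal_inf _)); apply/seteqP; split=> _ [y [T0y yt] <-].
  have Ty : T0 + tau <= y.
    rewrite leNgt; apply/negP => yT.
    have [|l lt] := early y; first by rewrite T0y.
    by rewrite ltNge (yt _ lt).
  by exists y => //; split=> //; exact/late.
exists y => //; split; first by rewrite (le_trans _ T0y)// lerDl.
exact/late.
Qed.

Lemma load_perm A x g be S S' j T0 y : perm_eq S S' ->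
  load A x g be S j T0 y = load A x g be S' j T0 y.
Proof. by move=> SS'; rewrite /load (unfinished_perm _ _ SS'). Qed.

Lemma rem_cat (T : eqType) (a : T) (s1 s2 : seq T) :
  rem a (s1 ++ s2) = if a \in s1 then rem a s1 ++ s2 else s1 ++ rem a s2.
Proof.
elim: s1 => //= b s1 IH; rewrite inE [a == b]eq_sym.
by case: eqP => //= _; rewrite IH; case: ifP.
Qed.

Lemma rem_cat_uniq (T : eqType) (a : T) (s1 s2 : seq T) : uniq (s1 ++ s2) ->
  rem a s1 ++ rem a s2 = rem a (s1 ++ s2).
Proof.
move=> us; rewrite rem_cat; case: ifPn => as1; last by rewrite [rem a s1]rem_id.
congr (_ ++ _); apply: rem_id; apply/negP => as2.
by move: us; rewrite cat_uniq => /and3P[_ /hasPn/(_ a as2)]; rewrite as1.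
Qed.

(** * Pathwise bounds on the discount factor *)

Section sandwich.
Variables (A : R -> R) (N : R -> \bar R) (be : nat -> nat).
Let r y := (fine (N y))^-1.
Hypothesis r01 : forall y, 0 <= r y <= 1.
Hypothesis mr : measurable_fun (`[0, +oo[ : set R) r.
Hypothesis Ar : forall y, 0 <= y -> A y = \int[mu]_(x in `[0, y]) r x.

Lemma completes_firstP S x g j i : i \in S -> completes_first S x g j i ->
  (size S)%:R * x i <= g j /\ {in S, forall l, l != i -> x i < x l}.
Proof.
move=> iS /andP[/ltW -> /allP xi]; split=> // l lS li.
by have := xi l lS; rewrite (negbTE li).
Qed.

Lemma sum_completes_first S x g j i : uniq S -> i \in S ->
  completes_first S x g j i ->
  {in S, forall l, completes_first S x g j l = (l == i)}.
Proof.
move=> uS iS ci l lS; have [->//|li] := eqVneq l i.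
apply/negbTE/negP => cl.
have [_ /(_ l lS li) h1] := completes_firstP iS ci.
have [_ /(_ i iS)] := completes_firstP lS cl.
by rewrite eq_sym li => /(_ isT) /(lt_trans h1); rewrite ltxx.
Qed.

(** Induction on the number of events. The first event is an arrival, the completion of one job or a
    tie; in the first two cases [exp_sojourn_step] factors out the same exponential as [discount]
    does, and the restarted state meets all the hypotheses again. *)
Lemma discount_sandwich n o t j x g T0 : 0 <= T0 ->
  uniq (o ++ t) -> {in o ++ t, forall l, (l.1 < j.+2)%N} ->
  {in o ++ t, forall l, 0 < x l} -> (forall l, (j.+2 <= l.1)%N -> 0 < x l) ->
  (forall i, 0 < g (j + i)%N) ->
  (forall y, T0 <= y -> N y = load A x g be (o ++ t) j T0 y) ->
  discount 0 n o t j x g be <= expR (s * T0) * exp_sojourn (end_time A T0 x t)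
    <= discount 1 n o t j x g be.
Proof.
elim: n o t j x g T0 => [|n IH] o t j x g T0 T00 uS idS xS xfut g0 NE /=.
  case: ifPn => [/nilP ->|_]; last exact: exp_sojourn_itv.
  by rewrite exp_sojourn_nil lexx.
case: ifPn => [/nilP ->|tn]; first by rewrite exp_sojourn_nil lexx.
set S := o ++ t in uS idS xS NE *; set k := (size S)%:R.
have [l0 l0t] : exists l, l \in t by case: (t) tn => // l ? _; exists l; rewrite mem_head.
have tS l : l \in t -> l \in S by rewrite mem_cat => ->; rewrite orbT.
have S0 : (0 < size S)%N by have := tS _ l0t; case: (S).
have k0 : 0 < k by rewrite ltr0n.
have g0j : 0 < g j by rewrite -[j]addn0.
have early tau y : tau <= g j -> {in S, forall l, tau <= k * x l} ->
    T0 <= y < T0 + tau -> exists2 l, l \in t & A y - A T0 < x l.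
  move=> tg tx /andP[T0y yT]; exists l0 => //.
  rewrite (service_before_event r01 mr Ar T00 NE g0 S0 tg tx) ?T0y ?ltW//.
  rewrite ltr_pdivrMr// mulrC (lt_le_trans _ (tx _ (tS _ l0t)))//.
  by rewrite ltrBlDl.
have [|] := boolP (arrives_first S x g j).
  move=> /allP af.
  have nc l : l \in S -> completes_first S x g j l = false.
    move=> lS; apply/negbTE/negP => /andP[+ _].
    by rewrite ltNge (ltW (af l lS)).
  have sum0 (f : nat * nat -> R) : \sum_(l <- S) (completes_first S x g j l)%:R * f l = 0.
    by rewrite big_seq big1// => l /nc ->; rewrite mul0r.
  rewrite !sum0 orbT !add0r /= !mul0r !addr0 !mul1r.
  have gx : {in S, forall l, g j <= k * x l} by move=> l /af/ltW.
  have dA y : A y - A (T0 + g j) = A y - A T0 - g j / k.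
    rewrite -(service_at_event r01 mr Ar T00 NE g0 S0 _ gx) ?lexx ?ltW//.
    by rewrite opprB addrA subrK.
  rewrite (@exp_sojourn_step A T0 (g j) x (lower x S (g j / k)) t t (ltW g0j)); last 2 first.
  - by move=> y; exact: early.
  - move=> y _; split => xy l lt; have := xy l lt; by rewrite /lower tS// dA lerD2r.
  rewrite !ler_pM2l ?expR_gt0//.
  (* [discount] lists the new batch with the other jobs, before the tagged ones, whereas the load
     lemma appends it at the end; the load depends on the list only up to permutation. *)
  have perm : perm_eq ((o ++ batch j (be j)) ++ t) (S ++ batch j (be j)).
    by rewrite /S -!catA perm_cat2l perm_catC.
  have memS l : (l \in (o ++ batch j (be j)) ++ t) = (l \in S) || (l \in batch j (be j)).
    by rewrite (perm_mem perm) mem_cat.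
  have batchP l : l \in batch j (be j) -> l.1 = j.+2 by case/mapP => m _ ->.
  have notS l : (j.+2 <= l.1)%N -> (l \in S) = false.
    by move=> jl; apply/negbTE/negP => /idS; rewrite ltnNge jl.
  apply: IH.
  - by rewrite addr_ge0// ltW.
  - rewrite (perm_uniq perm) cat_uniq uS/=; apply/andP; split.
      by apply/hasPn => l /batchP lj; rewrite notS// lj.
    by rewrite map_inj_uniq ?iota_uniq// => a b [].
  - by move=> l; rewrite memS => /orP[/idS/ltnW//|/batchP ->].
  - move=> l; rewrite memS /lower => /orP[lS|/batchP lj].
      by rewrite lS subr_gt0 ltr_pdivrMr// mulrC af.
    by rewrite notS ?lj// xfut// lj.
  - by move=> l jl; rewrite /lower notS ?xfut// ltnW.
  - by move=> i; rewrite addSnnS.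
  - move=> y Ty; rewrite (load_perm _ _ _ _ _ _ _ perm).
    exact: (load_after_arrival r01 mr Ar T00 NE g0 idS).
move=> naf.
have [/hasP[i iS ci]|/hasPn nc] := boolP (has (completes_first S x g j) S).
  have [xg xmin] := completes_firstP iS ci.
  have cE := sum_completes_first uS iS ci.
  have sum1 (f : nat * nat -> R) : \sum_(l <- S) (completes_first S x g j l)%:R * f l = f i.
    rewrite (bigD1_seq i)//= ci mul1r big_seq_cond big1 ?addr0// => l /andP[lS /negbTE li].
    by rewrite cE// li mul0r.
  rewrite !sum1.
  rewrite /= !mul0r !addr0.
  have xi0 := xS _ iS.
  have kx : {in S, forall l, k * x i <= k * x l}.
    by move=> l lS; rewrite ler_pM2l//; have [->//|li] := eqVneq l i; rewrite ltW// xmin.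
  have kx0 : 0 <= k * x i by rewrite mulr_ge0 ?ltW.
  have dA y : A y - A (T0 + k * x i) = A y - A T0 - x i.
    have := service_at_event r01 mr Ar T00 NE g0 S0 (tau := k * x i) _ kx.
    rewrite kx0 xg => /(_ isT); rewrite mulrAC divff ?mul1r ?gt_eqF// => AT1.
    by rewrite -[X in _ = _ - X]AT1 opprB addrA subrK.
  have remS : rem i o ++ rem i t = rem i S by exact: rem_cat_uniq.
  rewrite (@exp_sojourn_step A T0 (k * x i) x (lower x S (x i)) t (rem i t) kx0); last 2 first.
  - by move=> y; exact: early.
  - move=> y Ty; split => xy l lt.
      by rewrite /lower (tS _ (mem_rem lt)) dA lerD2r; apply: xy; exact: mem_rem lt.
    have [->|li] := eqVneq l i; last first.
      have lr : l \in rem i t.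
        by rewrite mem_rem_uniq ?inE ?li//; move: uS; rewrite cat_uniq => /and3P[].
      by have := xy l lr; rewrite /lower (tS _ lt) dA lerD2r.
    (* The completed job is tagged and no longer in the restarted list: its requirement is attained
       exactly at the event, and [A] does not decrease afterwards. *)
    rewrite -subr_ge0 -dA subr_ge0.
    by rewrite (service_nondecreasing r01 Ar)// addr_ge0.
  rewrite !ler_pM2l ?expR_gt0//.
  have subS l : l \in rem i S -> l \in S by exact: mem_rem.
  have notS l : (j.+2 <= l.1)%N -> (l \in S) = false.
    by move=> jl; apply/negbTE/negP => /idS; rewrite ltnNge jl.
  apply: IH; rewrite ?remS.
  - by rewrite addr_ge0.
  - exact: rem_uniq.
  - by move=> l /subS/idS.
  - move=> l; rewrite mem_rem_uniq// inE => /andP[li lS].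
    by rewrite /lower lS subr_gt0 xmin.
  - by move=> l jl; rewrite /lower notS// xfut.
  - move=> m; rewrite /lowg; case: ifPn => [/eqP ->|//].
    by rewrite subr_gt0; case/andP: ci.
  - move=> y Ty; apply: (load_after_completion r01 mr Ar T00 NE g0 idS) => //.
      exact: ltW.
    by move=> l lS; have [->//|li] := eqVneq l i; rewrite ltW// xmin.
(* In a tie only the constants 0 and 1 remain, and they bound any discount factor. *)
have sum0 (f : nat * nat -> R) : \sum_(l <- S) (completes_first S x g j l)%:R * f l = 0.
  by rewrite big_seq big1// => l /nc/negbTE ->; rewrite mul0r.
rewrite !sum0.
by rewrite /= !mul0r !add0r mulr0 mulr1 exp_sojourn_itv.
Qed.
End sandwich.
End dynamics.

(** * Regeneration of exponential clocks *)

Section race.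
Context d (T : measurableType d) (R : realType) (P : probability T R).

Lemma nneseries_geometric (a z : R) : 0 <= a -> 0 <= z < 1 ->
  (\sum_(k <oo) (a * z ^+ k)%:E = (a / (1 - z))%:E)%E.
Proof.
move=> a0 /andP[z0 z1]; apply/cvg_lim => //.
rewrite (_ : (fun n => _) = EFin \o [series a * z ^+ k]_k); last first.
  by apply/funext => n; rewrite /= /series /= sumEFin.
apply: cvg_EFin; first exact: nearW.
by apply: cvg_geometric_series; rewrite ger0_norm.
Qed.

Lemma nneseries_single (f : nat -> \bar R) (n : nat) : (forall k, (0 <= f k)%E) ->
  (forall k, k != n -> f k = 0%E) -> (\sum_(k <oo) f k = f n)%E.
Proof.
move=> f0 fn; rewrite (nneseriesD1 (n := n))// eseries0 ?adde0// => k _ /= kn.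
exact: fn.
Qed.

Lemma measurable_funR_bool (D : set T) (b : T -> bool) :
  measurable_fun D b -> measurable_fun D (fun w => (b w)%:R : R).
Proof.
by move=> mb; apply: (@measurableT_comp _ _ _ _ _ _ (fun b : bool => b%:R : R)).
Qed.

Lemma measurable_exp_neg (c : R) (h : T -> R) : measurable_fun setT h ->
  measurable_fun setT (fun w => expR (- (c * h w))).
Proof.
move=> mh; apply: (@measurableT_comp _ _ _ _ _ _ expR); first exact: measurable_expR.
by under eq_fun do rewrite -mulNr; apply: measurable_funM.
Qed.

(* Y is an exponential clock of rate l under the weight psi and C y the event that
   its competitors survive y; the tail formula is integrated against Y by cutting
   its range into cells of length dl, which tends to 0. *)
Variables (psi Y : T -> R) (C : R -> T -> bool) (K l th sg : R).
Hypotheses (mpsi : measurable_fun setT psi) (mY : measurable_fun setT Y).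
Hypotheses (psi0 : forall w, 0 <= psi w) (psiY : forall w, psi w != 0 -> 0 < Y w).
Hypotheses (mC : forall y, measurable_fun setT (C y)).
Hypothesis mCY : measurable_fun setT (fun w => C (Y w) w).
Hypothesis leC : forall y z w, y <= z -> C z w -> C y w.
Hypotheses (K0 : 0 <= K) (l0 : 0 < l) (th0 : 0 <= th) (sg0 : 0 <= sg).
Hypothesis tailC : forall y z, 0 <= y -> 0 <= z ->
  (\int[P]_w (psi w * (y < Y w)%R%:R * (C z w)%:R)%:E =
   (K * expR (- (l * y)) * expR (- (th * z)))%:E)%E.

Let L := l + sg + th.
Let L0 : 0 < L. Proof. by rewrite /L -addrA ltr_pwDl// addr_ge0. Qed.

Let cell (dl : R) (k : nat) w := (k%:R * dl < Y w) && (Y w <= k.+1%:R * dl).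

Let mcell dl k : measurable_fun setT (cell dl k).
Proof. by apply: measurable_and; [exact: measurable_fun_ltr|exact: measurable_fun_ler]. Qed.

(** The mass of a cell is the difference of the tails at its two ends. It is obtained from an
    additive identity, the integrals being extended reals, and finiteness allows the
    cancellation. *)
Let integral_cell dl (k : nat) z : 0 < dl -> 0 <= z ->
  (\int[P]_w (psi w * (cell dl k w)%:R * (C z w)%:R)%:E =
   (K * (1 - expR (- (l * dl))) * expR (- (l * dl)) ^+ k * expR (- (th * z)))%:E)%E.
Proof.
move=> dl0 z0.
have k0 (m : nat) : 0 <= m%:R * dl by rewrite mulr_ge0// ltW.
have := tailC (k0 k) z0.
have -> : (\int[P]_w (psi w * (k%:R * dl < Y w)%R%:R * (C z w)%:R)%:E =
  \int[P]_w ((psi w * (cell dl k w)%:R * (C z w)%:R)%:E +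
             (psi w * (k.+1%:R * dl < Y w)%R%:R * (C z w)%:R)%:E))%E.
  apply: eq_integral => w _; rewrite -EFinD; congr EFin.
  rewrite -mulrDl -mulrDr; congr (_ * _ * _).
  rewrite /cell; have [kY|] := ltP (k%:R * dl) (Y w).
    by rewrite leNgt; case: ltP => /=; rewrite ?addr0 ?add0r.
  move=> Yk; rewrite /= ltNge (le_trans Yk) ?add0r//.
  by rewrite ler_pM2r// ler_nat.
rewrite ge0_integralD//=; last 4 first.
- by move=> w _; rewrite lee_fin !mulr_ge0.
- apply/measurable_EFinP; apply: measurable_funM; last exact: measurable_funR_bool.
  by apply: measurable_funM => //; exact: measurable_funR_bool.
- by move=> w _; rewrite lee_fin !mulr_ge0.
- apply/measurable_EFinP; apply: measurable_funM; last exact: measurable_funR_bool.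
  by apply: measurable_funM => //; apply: measurable_funR_bool; exact: measurable_fun_ltr.
rewrite tailC//.
set I := (X in _ -> X = _) => IE.
have {IE} : (I + (K * expR (- (l * (k.+1%:R * dl))) * expR (- (th * z)))%:E)%E =
  (K * expR (- (l * (k%:R * dl))) * expR (- (th * z)))%:E := IE.
case: I => [I| |]//; rewrite -EFinD => -[IE].
congr EFin; have -> : I = K * expR (- (l * (k%:R * dl))) * expR (- (th * z))
   - K * expR (- (l * (k.+1%:R * dl))) * expR (- (th * z)) by rewrite -IE addrK.
rewrite -mulrBl; congr (_ * _); rewrite -mulrBr -mulrA; congr (_ * _).
rewrite -[k.+1]add1n natrD mulrDl mulrDr opprD expRD mul1r mulrBl mul1r.
by rewrite -expRM_natl mulrN mulrCA.
Qed.

Let cellP dl w : 0 < dl -> 0 < Y w -> exists n, forall k, cell dl k w = (k == n).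
Proof.
move=> dl0 Y0.
have ex : exists n : nat, Y w <= n.+1%:R * dl.
  exists (Num.truncn (Y w / dl)); rewrite -ler_pdivrMr//.
  by rewrite ltW// truncnS_gt.
case: (ex_minnP ex) => n nY minn; exists n => k; rewrite /cell.
apply/andP/eqP => [[kY Yk]|->].
  apply/eqP; rewrite eqn_leq minn// andbT leqNgt; apply/negP => nk.
  move: kY; rewrite ltNge (le_trans nY)//.
  by rewrite ler_pM2r// ler_nat.
split=> //; case: n nY minn => [|n] nY minn; first by rewrite mul0r.
by rewrite ltNge; apply/negP => /minn; rewrite ltnn.
Qed.

Let integral_cells dl (a z : nat -> R) : 0 < dl -> (forall k, 0 <= a k) ->
  (forall k, 0 <= z k) ->
  (\int[P]_w (\sum_(k <oo) (a k * (psi w * (cell dl k w)%:R * (C (z k) w)%:R))%:E) =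
   \sum_(k <oo) (a k * (K * (1 - expR (- (l * dl))) * expR (- (l * dl)) ^+ k *
                 expR (- (th * z k))))%:E)%E.
Proof.
move=> dl0 a0 z0; have mf k : measurable_fun setT
    (fun w => (psi w * (cell dl k w)%:R * (C (z k) w)%:R)%:E).
  apply/measurable_EFinP; apply: measurable_funM; last exact: measurable_funR_bool.
  by apply: measurable_funM => //; exact: measurable_funR_bool.
rewrite integral_nneseries//; last 2 first.
- by move=> k; under eq_fun do rewrite EFinM; exact: measurable_funeM.
- by move=> k w _; rewrite lee_fin !mulr_ge0.
apply: eq_eseriesr => k _; rewrite EFinM -integral_cell//.
under eq_integral do rewrite EFinM; rewrite ge0_integralZl_EFin//.
by move=> w _; rewrite lee_fin !mulr_ge0.
Qed.

Let f w := psi w * expR (- (sg * Y w)) * (C (Y w) w)%:R.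

Let mf : measurable_fun setT f.
Proof.
apply: measurable_funM; last exact: measurable_funR_bool.
by apply: measurable_funM => //; exact: measurable_exp_neg.
Qed.

Let f0 w : 0 <= f w. Proof. by rewrite !mulr_ge0 ?expR_ge0. Qed.

Let cells_eq dl (a z : nat -> R) w : (forall k, 0 <= a k) -> 0 < dl -> psi w != 0 ->
  exists2 n, cell dl n w &
  (\sum_(k <oo) (a k * (psi w * (cell dl k w)%:R * (C (z k) w)%:R))%:E =
   (a n * (psi w * (C (z n) w)%:R))%:E)%E.
Proof.
move=> a0 dl0 /psiY Y0; have [n nP] := cellP dl0 Y0.
exists n; first by rewrite nP.
rewrite (nneseries_single (n := n)).
- by rewrite nP eqxx mulr1.
- by move=> k; rewrite lee_fin !mulr_ge0.
- by move=> k /negbTE kn; rewrite nP kn mulr0 mul0r mulr0.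
Qed.

Let cells_eq0 dl (a z : nat -> R) w : psi w = 0 ->
  (\sum_(k <oo) (a k * (psi w * (cell dl k w)%:R * (C (z k) w)%:R))%:E = 0)%E.
Proof. by move=> p0; apply: eseries0 => k _ _; rewrite p0 !mul0r mulr0. Qed.

Let z dl := expR (- (L * dl)).

Let z01 dl : 0 < dl -> 0 <= z dl < 1.
Proof. by move=> dl0; rewrite expR_ge0 expR_lt1 oppr_lt0 mulr_gt0. Qed.

(** In each cell [Y] is replaced with the left end, where the discount and, by [leC], the event [C]
    are both larger. The cells then sum to a geometric series of ratio [z dl]. *)
Let upper_bound dl : 0 < dl ->
  (\int[P]_w (f w)%:E <= (K * (1 - expR (- (l * dl))) / (1 - z dl))%:E)%E.
Proof.
move=> dl0; pose y (k : nat) := k%:R * dl.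
have y0 k : 0 <= y k by rewrite mulr_ge0// ltW.
pose a k := expR (- (sg * y k)).
have a0 k : 0 <= a k by exact: expR_ge0.
rewrite -nneseries_geometric ?z01//; last first.
  by rewrite mulr_ge0// subr_ge0 ltW// expR_lt1 oppr_lt0 mulr_gt0.
rewrite (eq_eseriesr (g := fun k => (a k * (K * (1 - expR (- (l * dl))) * expR (- (l * dl)) ^+ k *
                 expR (- (th * y k))))%:E)); last first.
  move=> k _; congr EFin; rewrite mulrCA -!mulrA; congr (_ * _).
  congr (_ * _); rewrite /a /z -!expRM_natl -!expRD; congr expR.
  by rewrite /L /y; ring.
rewrite -integral_cells//; apply: ge0_le_integral => //.
- by move=> w _; rewrite lee_fin.
- exact/measurable_EFinP.
- apply: ge0_emeasurable_sum => [k w _ _|k _].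
    by rewrite lee_fin !mulr_ge0.
  apply/measurable_EFinP; apply: measurable_funM => //.
  apply: measurable_funM; last exact: measurable_funR_bool.
  by apply: measurable_funM => //; exact: measurable_funR_bool.
move=> w _; have [p0|p0] := eqVneq (psi w) 0.
  by rewrite cells_eq0// /f p0 !mul0r.
have [n /andP[nY Yn] ->] := cells_eq y a0 dl0 p0.
rewrite lee_fin /f mulrAC [leRHS]mulrC ler_pM ?mulr_ge0 ?expR_ge0//.
  rewrite ler_wpM2l// ler_nat; case: (boolP (C (Y w) w)) => //.
  by move/(leC (ltW nY)) => ->.
by rewrite /a ler_expR lerN2 ler_wpM2l// ltW.
Qed.

(** Same comparison with the right ends of the cells; the extra factor is the discount and the
    survival of the competitors over one cell. *)
Let lower_bound dl : 0 < dl ->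
  ((K * (1 - expR (- (l * dl))) * expR (- ((sg + th) * dl)) / (1 - z dl))%:E
   <= \int[P]_w (f w)%:E)%E.
Proof.
move=> dl0; pose y (k : nat) := k.+1%:R * dl.
have y0 k : 0 <= y k by rewrite mulr_ge0// ltW.
pose a k := expR (- (sg * y k)).
have a0 k : 0 <= a k by exact: expR_ge0.
rewrite -nneseries_geometric ?z01//; last first.
  by rewrite !mulr_ge0 ?expR_ge0// subr_ge0 ltW// expR_lt1 oppr_lt0 mulr_gt0.
rewrite (eq_eseriesr (g := fun k => (a k * (K * (1 - expR (- (l * dl))) * expR (- (l * dl)) ^+ k *
                 expR (- (th * y k))))%:E)); last first.
  move=> k _; congr EFin; rewrite [RHS]mulrCA -!mulrA; congr (_ * _).
  congr (_ * _); rewrite /a /z -!expRM_natl -!expRD; congr expR.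
  by rewrite /L /y -natr1; ring.
rewrite -integral_cells//; apply: ge0_le_integral => //.
- by move=> w _; apply: nneseries_ge0 => k _ _; rewrite lee_fin !mulr_ge0.
- apply: ge0_emeasurable_sum => [k w _ _|k _].
    by rewrite lee_fin !mulr_ge0.
  apply/measurable_EFinP; apply: measurable_funM => //.
  apply: measurable_funM; last exact: measurable_funR_bool.
  by apply: measurable_funM => //; exact: measurable_funR_bool.
- exact/measurable_EFinP.
move=> w _; have [p0|p0] := eqVneq (psi w) 0.
  by rewrite cells_eq0// /f p0 !mul0r.
have [n /andP[nY Yn] ->] := cells_eq y a0 dl0 p0.
rewrite lee_fin /f mulrAC [leLHS]mulrC ler_pM ?mulr_ge0 ?expR_ge0//.
  rewrite ler_wpM2l// ler_nat; case: (boolP (C (y n) w)) => //.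
  by move/(leC Yn) => ->.
by rewrite /a ler_expR lerN2 ler_wpM2l.
Qed.

(** This is the integral over y > 0 of K l exp(- l y) exp(- sg y) exp(- th y): the density of [Y],
    the discount, the survival of the competitors. The inequality 1 + x <= exp x turns the two cell
    bounds into relative errors of at most [L * dl]. *)
Lemma race_integral :
  (\int[P]_w (psi w * expR (- (sg * Y w)) * (C (Y w) w)%:R)%:E =
   (K * l / (l + sg + th))%:E)%E.
Proof.
rewrite -/L -/(f _).
have up dl : 0 < dl -> (\int[P]_w (f w)%:E <= (K * l / L * (1 + L * dl))%:E)%E.
  move=> dl0; apply: (le_trans (upper_bound dl0)); rewrite lee_fin.
  have Ld0 : 0 < L * dl by rewrite mulr_gt0.
  rewrite -!mulrA ler_wpM2l//.
  have h1 : 1 - expR (- (l * dl)) <= l * dl.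
    by rewrite lerBlDr -lerBlDl expR_ge1Dx.
  have h2 : (1 - z dl)^-1 <= (1 + L * dl) / (L * dl).
    have p1 : 0 < 1 - z dl by rewrite subr_gt0; case/andP: (z01 dl0).
    have p2 : 0 < L * dl / (1 + L * dl) by rewrite divr_gt0// addr_gt0.
    rewrite -[leRHS]invf_div lef_pV2 ?posrE//.
    rewrite lerBrDr -lerBrDl.
    rewrite (_ : 1 - _ = (1 + L * dl)^-1); last first.
      by rewrite -[X in X - _](divff (lt0r_neq0 (addr_gt0 ltr01 Ld0))) -mulrBl addrK mul1r.
    rewrite /z expRN lef_pV2 ?posrE ?expR_gt0 ?addr_gt0//; exact: expR_ge1Dx.
  apply: le_trans (ler_pM _ _ h1 h2) _.
  - by rewrite subr_ge0 ltW// expR_lt1 oppr_lt0 mulr_gt0.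
  - by rewrite invr_ge0 subr_ge0 ltW//; case/andP: (z01 dl0).
  rewrite le_eqVlt; apply/orP; left; apply/eqP; field.
  by rewrite !lt0r_neq0.
have lo dl : 0 < dl -> ((K * l / L * (1 - L * dl))%:E <= \int[P]_w (f w)%:E)%E.
  move=> dl0; apply: (le_trans _ (lower_bound dl0)); rewrite lee_fin.
  have Ld0 : 0 < L * dl by rewrite mulr_gt0.
  rewrite -!mulrA ler_wpM2l//.
  have zE : z dl = expR (- (l * dl)) * expR (- ((sg + th) * dl)).
    by rewrite /z -expRD; congr expR; rewrite /L; ring.
  have h0 : 0 < 1 - z dl by rewrite subr_gt0; case/andP: (z01 dl0).
  rewrite [leRHS]mulrA ler_pdivlMr//.
  have h1 : l * dl * expR (- (L * dl)) <= (1 - expR (- (l * dl))) * expR (- ((sg + th) * dl)).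
    rewrite (_ : expR (- (L * dl)) = expR (- (l * dl)) * expR (- ((sg + th) * dl)))//.
    rewrite mulrA ler_wpM2r ?expR_ge0// -ler_pdivlMr ?expR_gt0//.
    rewrite mulrBl divff ?gt_eqF ?expR_gt0// mul1r -expRN opprK.
    by rewrite lerBrDl expR_ge1Dx.
  apply: le_trans h1.
  have h2 : 1 - z dl <= L * dl by rewrite lerBlDr -lerBlDl /z expR_ge1Dx.
  have h3 : 1 - L * dl <= expR (- (L * dl)) by exact: expR_ge1Dx.
  have [neg|pos] := leP (1 - L * dl) 0.
    apply: (@le_trans _ _ 0); last by rewrite !mulr_ge0 ?expR_ge0// ltW.
    by rewrite mulr_le0_ge0 ?(ltW h0)// (mulr_ge0_le0 (ltW l0))// mulr_ge0_le0// invr_ge0 ltW.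
  have e1 : l * (L^-1 * (1 - L * dl)) * (1 - z dl) <= l * (L^-1 * expR (- (L * dl))) * (L * dl).
    rewrite ler_pM ?(ltW h0)//; first by rewrite !mulr_ge0 ?invr_ge0// ltW.
    by rewrite !ler_pM2l ?invr_gt0.
  apply: le_trans e1 _; rewrite le_eqVlt; apply/orP; left; apply/eqP; field.
  by rewrite lt0r_neq0.
have KL0 : 0 <= K * l / L by rewrite !mulr_ge0 ?invr_ge0// ltW.
apply/le_anti/andP; split.
  apply/lee_addgt0Pr => e e0.
  (* Chosen so that the error [K * l / L * (L * dl)] is at most [e]; the summand 1 avoids a division
     by zero when [K = 0]. *)
  pose dl := e / (K * l / L + 1) / L.
  have dl0 : 0 < dl by rewrite !divr_gt0// ltr_wpDl.
  apply: (le_trans (up dl dl0)); rewrite lee_fin mulrDr mulr1 lerD2l.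
  rewrite /dl [L * _]mulrC divfK ?lt0r_neq0// mulrCA ger_pMr// ler_pdivrMr ?ltr_wpDl// mul1r.
  by rewrite lerDl.
apply/lee_addgt0Pr => e e0.
pose dl := e / (K * l / L + 1) / L.
have dl0 : 0 < dl by rewrite !divr_gt0// ltr_wpDl.
apply: le_trans (leeD2r _ (lo dl dl0)); rewrite lee_fin mulrBr mulr1.
rewrite -addrA lerDl addrC subr_ge0.
rewrite /dl [L * _]mulrC divfK ?lt0r_neq0// mulrCA ger_pMr// ler_pdivrMr ?ltr_wpDl// mul1r.
by rewrite lerDl.
Qed.

End race.

(** * Expected discount over the first n events *)

Section expectation.
Context d (T : measurableType d) (R : realType) (P : probability T R).
Variables (rho q s : R).
Hypotheses (rho0 : 0 < rho) (q0 : 0 <= q) (q1 : q < 1).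

Local Notation clock := ((nat * nat) + nat)%type.
Implicit Types (psi : T -> R) (Z : clock -> T -> R) (B : nat -> T -> nat).

Definition rate (p : clock) : R := if p is inl _ then 1 else rho.

Lemma rate_gt0 p : 0 < rate p. Proof. by case: p => //=; exact: ltr01. Qed.

Definition size_law (m : nat) : R := if m is m'.+1 then (1 - q) * q ^+ m' else 0.

Lemma size_law_ge0 m : 0 <= size_law m.
Proof. by case: m => [|m] //=; rewrite mulr_ge0 ?subr_ge0 ?exprn_ge0// ltW. Qed.

(* Under the weight psi the live clocks are independent exponential variables,
   and the batch sizes from the j-th on are independent with law size_law. *)
Record fresh psi (live : pred clock) Z B (j : nat) (c : R) : Prop := Fresh {
  fresh_measurable : measurable_fun setT psi;
  fresh_ge0 : forall w, 0 <= psi w;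
  fresh_clock : forall p, measurable_fun setT (Z p);
  fresh_size : forall k, measurable_fun setT (B k);
  fresh_gt0 : forall w p, psi w != 0 -> live p -> 0 < Z p w;
  fresh_mass : 0 <= c;
  fresh_tails : forall (F : seq clock) (a : clock -> R) (r : nat) (m : nat -> nat),
    uniq F -> all live F -> (forall p, 0 <= a p) ->
    (\int[P]_w (psi w * (all (fun p => a p < Z p w) F)%:R *
                (all (fun k => B (j + k)%N w == m k) (iota 0 r))%:R)%:E =
     (c * expR (- \sum_(p <- F) rate p * a p) * \prod_(k < r) size_law (m k))%:E)%E }.

Lemma measurable_all (I : Type) (F : seq I) (b : I -> T -> bool) :
  (forall p, measurable_fun setT (b p)) ->
  measurable_fun setT (fun w => all (b^~ w) F).
Proof.
move=> mb; elim: F => [|p F IH] //=; exact: measurable_and.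
Qed.

Lemma fresh_sub psi (live live' : pred clock) Z B j c :
  (forall p, live' p -> live p) -> fresh psi live Z B j c ->
  fresh psi live' Z B j c.
Proof.
move=> ll [h1 h2 h3 h4 h5 h6 h7]; split => //.
  by move=> w p /h5 hw /ll /hw.
move=> F a r m uF /allP lF a0; apply: h7 => //; apply/allP => p /lF; exact: ll.
Qed.

Lemma fresh_size_eq psi live Z B j c m0 : fresh psi live Z B j c ->
  fresh (fun w => psi w * (B j w == m0)%:R) live Z B j.+1 (c * size_law m0).
Proof.
move=> [h1 h2 h3 h4 h5 h6 h7]; split => //.
- apply: measurable_funM => //; apply: measurable_funR_bool.
  exact: measurable_fun_eqn.
- by move=> w; rewrite mulr_ge0.
- by move=> w p; rewrite mulf_eq0 negb_or => /andP[psiw _]; exact: h5.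
- by rewrite mulr_ge0// size_law_ge0.
move=> F a r m uF lF a0.
have := h7 F a r.+1 (fun k => if k is k'.+1 then m k' else m0) uF lF a0.
rewrite big_ord_recl/= mulrA => h.
transitivity (c * expR (- (\sum_(p <- F) rate p * a p)) * size_law m0 *
     \prod_(i < r) size_law (m i))%:E; last by congr EFin; ring.
rewrite -h; apply: eq_integral => w _; congr EFin.
rewrite addn0 -mulnb natrM.
rewrite (_ : all _ (iota 1 r) = all (fun k => B (j.+1 + k)%N w == m k) (iota 0 r)); first by ring.
by rewrite -[1%N]/(1 + 0)%N iotaDl all_map; apply: eq_all => k /=; rewrite add1n addSnnS.
Qed.

(** Memorylessness. Clock [p0] rings before each competitor in [Q], and clock [p] has then lost
    [ka p] times the reading of [p0]. The new mass is c times the integral of the density of [p0],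
    the discount and the survival of the competitors, whose effective rates are [rate p * ka p]; the
    tails of the residual clocks factor out unchanged. *)
Lemma fresh_race psi live Z B j c (p0 : clock) (ka : clock -> R) (Q : seq clock)
    (sg : R) Z' :
  fresh psi live Z B j c -> live p0 -> (forall p, 0 <= ka p) ->
  uniq Q -> all live Q -> p0 \notin Q ->
  (forall p, live p -> p != p0 -> p \notin Q -> ka p = 0) -> 0 <= sg ->
  (forall p w, Z' p w = Z p w - ka p * Z p0 w) ->
  fresh (fun w => psi w * expR (- (sg * Z p0 w)) *
                  (all (fun p => ka p * Z p0 w < Z p w) Q)%:R)
    (fun p => live p && (p != p0)) Z' B j
    (c * rate p0 / (rate p0 + sg + \sum_(p <- Q) rate p * ka p)).
Proof.
move=> [h1 h2 h3 h4 h5 h6 h7] lp0 ka0 uQ lQ p0Q kaQ sg0 Z'E.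
have mkZ p : measurable_fun setT (fun w => ka p * Z p0 w) by exact: measurable_funM.
have S0 : 0 <= \sum_(p <- Q) rate p * ka p.
  by apply: sumr_ge0 => p _; rewrite mulr_ge0// ltW// rate_gt0.
split => //.
- apply: measurable_funM.
    by apply: measurable_funM => //; exact: measurable_exp_neg.
  apply: measurable_funR_bool; apply: (@measurable_all _ Q (fun p w => ka p * Z p0 w < Z p w)) => p.
  exact: measurable_fun_ltr.
- by move=> w; rewrite !mulr_ge0 ?expR_ge0.
- move=> p; rewrite (_ : Z' p = fun w => Z p w - ka p * Z p0 w).
    exact: measurable_funB.
  by apply/funext => w; rewrite Z'E.
- move=> w p; rewrite mulf_eq0 negb_or mulf_eq0 negb_or => /andP[/andP[psiw _]].
  case: allP => [kZ _|]; last by rewrite eqxx.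
  move=> /andP[lp pp0]; rewrite Z'E; have [/kZ|pQ] := boolP (p \in Q).
    by rewrite subr_gt0.
  by rewrite kaQ// mul0r subr0 h5.
- by rewrite divr_ge0 ?mulr_ge0 ?addr_ge0//; exact/ltW/rate_gt0.
move=> F a r m uF lF a0.
(* Levels are extended by 0 to the competitors outside [F]. Winning the race and exceeding the
   prescribed residual levels then form a single event [C (Z p0 w) w], to which [race_integral]
   applies. *)
pose a' p := if p \in F then a p else 0.
pose F' := F ++ [seq p <- Q | p \notin F].
pose C y w := all (fun p => ka p * y + a' p < Z p w) F' &&
  all (fun k => B (j + k)%N w == m k) (iota 0 r).
have a'0 p : 0 <= a' p by rewrite /a'; case: ifP.
have sumF' : \sum_(p <- F') rate p * a' p = \sum_(p <- F) rate p * a p.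
  rewrite big_cat/= [X in _ + X]big1_seq ?addr0; last first.
    by move=> p /=; rewrite mem_filter /a' => /andP[/negbTE ->]; rewrite mulr0.
  by apply: eq_big_seq => p pF; rewrite /a' pF.
have live' p : p \in F -> live p /\ p != p0 by move=> /(allP lF) /andP[].
have sumk : \sum_(p <- F') rate p * ka p = \sum_(p <- Q) rate p * ka p.
  rewrite big_cat/= big_filter [RHS](bigID (mem F))/=; congr (_ + _).
  rewrite (bigID (mem Q))/= [X in _ + X]big1_seq ?addr0; last first.
    by move=> p /andP[pQ /live'[lp pp0]]; rewrite kaQ// mulr0.
  rewrite -big_filter -[RHS]big_filter; apply: perm_big; apply: uniq_perm; rewrite ?filter_uniq//.
  by move=> p; rewrite !mem_filter andbC.
have p0F' : p0 \notin F'.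
  rewrite mem_cat mem_filter (negbTE p0Q) andbF orbF.
  by apply/negP => /live'[_]; rewrite eqxx.
have uF' : uniq F'.
  rewrite cat_uniq uF filter_uniq// andbT; apply/hasPn => p.
  by rewrite mem_filter => /andP[].
have lF' : all live F'.
  apply/allP => p; rewrite mem_cat mem_filter => /orP[/live'[]//|/andP[_]].
  exact: (allP lQ).
transitivity (\int[P]_w (psi w * expR (- (sg * Z p0 w)) * (C (Z p0 w) w)%:R)%:E)%E.
  apply: eq_integral => w _; congr EFin; rewrite -!mulrA; congr (_ * (_ * _)).
  rewrite -!natrM !mulnb /C andbA; congr ((_ && _)%:R); apply/andP/allP.
    move=> [/allP kQ /allP aF] p; rewrite mem_cat mem_filter /a' => /orP[pF|/andP[/negbTE -> pQ]].
      by rewrite pF; have := aF _ pF; rewrite Z'E ltrBrDl.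
    by rewrite addr0 kQ.
  move=> h; split; apply/allP => p pI.
    have [pF|pF] := boolP (p \in F).
      have := h p; rewrite /F' mem_cat pF => /(_ isT); rewrite /a' pF.
      by apply: le_lt_trans; rewrite lerDl.
    have := h p; rewrite /F' mem_cat mem_filter pF pI orbT => /(_ isT).
    by rewrite /a' (negbTE pF) addr0.
  have := h p; rewrite /F' mem_cat pI => /(_ isT); rewrite /a' pI.
  by rewrite Z'E ltrBrDl.
have mC y : measurable_fun setT (C y).
  apply: measurable_and.
    apply: (@measurable_all _ F' (fun p w => ka p * y + a' p < Z p w)) => p.
    exact: measurable_fun_ltr.
  apply: (@measurable_all _ (iota 0 r) (fun k w => B (j + k)%N w == m k)) => k.
  exact: measurable_fun_eqn.
have mCY : measurable_fun setT (fun w => C (Z p0 w) w).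
  apply: measurable_and.
    apply: (@measurable_all _ F' (fun p w => ka p * Z p0 w + a' p < Z p w)) => p.
    by apply: measurable_fun_ltr => //; apply: measurable_funD.
  apply: (@measurable_all _ (iota 0 r) (fun k w => B (j + k)%N w == m k)) => k.
  exact: measurable_fun_eqn.
rewrite (@race_integral _ _ _ P psi (Z p0) C
  (c * expR (- \sum_(p <- F) rate p * a p) * \prod_(k < r) size_law (m k))
  (rate p0) (\sum_(p <- Q) rate p * ka p) sg) => //.
- by congr EFin; ring.
- by move=> w psiw; exact: h5.
- move=> y z w yz /andP[/allP Cz Bw]; apply/andP; split=> //; apply/allP => p /Cz.
  by apply: le_lt_trans; rewrite lerD2r ler_wpM2l.
- by rewrite !mulr_ge0 ?expR_ge0 ?prodr_ge0// => k _; exact: size_law_ge0.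
- exact: rate_gt0.
move=> y z y0 z0.
pose b p := if p == p0 then y else ka p * z + a' p.
have b0 p : 0 <= b p by rewrite /b; case: ifP => // _; rewrite addr_ge0// mulr_ge0.
have := h7 (p0 :: F') b r m; rewrite /= p0F' uF' lp0 lF' => /(_ isT isT b0).
have bp0 : b p0 = y by rewrite /b eqxx.
rewrite big_cons bp0.
have -> : \sum_(p <- F') rate p * b p =
    z * \sum_(p <- Q) rate p * ka p + \sum_(p <- F) rate p * a p.
  rewrite -sumk -sumF' mulr_sumr -big_split/=; apply: eq_big_seq => p pF'.
  rewrite /b ifF; first by ring.
  by apply/negbTE/negP => /eqP pp0; rewrite -pp0 pF' in p0F'.
move=> h; transitivity (c * expR (- (rate p0 * y + (z * \sum_(p <- Q) rate p * ka p +
   \sum_(p <- F) rate p * a p))) * \prod_(k < r) size_law (m k))%:E.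
  rewrite -h; apply: eq_integral => w _; congr EFin; rewrite /C.
  rewrite -mulnb natrM mulrA -mulnb natrM mulrA; congr (_ * _ * _ * _).
  congr (_%:R); apply: congr1; apply: eq_in_all => p pF'.
  by rewrite /b ifF//; apply/negbTE/negP => /eqP pp0; rewrite -pp0 pF' in p0F'.
congr EFin; rewrite !opprD !expRD [z * _]mulrC; ring.
Qed.

Lemma measurable_nat_case (D : nat -> T -> R) (N : T -> nat) :
  (forall m, measurable_fun setT (D m)) -> measurable_fun setT N ->
  measurable_fun setT (fun w => D (N w) w).
Proof.
move=> mD mN _ Y mY; rewrite setTI.
rewrite (_ : _ @^-1` Y = \bigcup_m ((N @^-1` [set m]) `&` (D m @^-1` Y))).
  apply: bigcupT_measurable => m; apply: measurableI.
    by rewrite -[X in measurable X]setTI; exact: mN.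
  by rewrite -[X in measurable X]setTI; exact: mD.
by apply/seteqP; split => [w Yw|w [m _ [/= <-]]//]; exists (N w).
Qed.

Variable cc : R.
Hypotheses (cc0 : 0 <= cc).

Section measurable_first.
Variables (X : nat * nat -> T -> R) (G : nat -> T -> R).
Hypotheses (mX : forall l, measurable_fun setT (X l)) (mG : forall i, measurable_fun setT (G i)).

Lemma measurable_completes_first S j i :
  measurable_fun setT (fun w => completes_first S (X^~ w) (G^~ w) j i).
Proof.
apply: measurable_and; first by apply: measurable_fun_ltr => //; exact: measurable_funM.
apply: (@measurable_all _ S (fun l w => (l == i) || (X i w < X l w))) => l.
by apply: measurable_or => //; exact: measurable_fun_ltr.
Qed.

Lemma measurable_arrives_first S j :
  measurable_fun setT (fun w => arrives_first S (X^~ w) (G^~ w) j).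
Proof.
apply: (@measurable_all _ S (fun l w => G j w < (size S)%:R * X l w)) => l.
by apply: measurable_fun_ltr => //; exact: measurable_funM.
Qed.

Lemma measurable_tie S j : measurable_fun setT
  (fun w => ~~ (has (completes_first S (X^~ w) (G^~ w) j) S ||
                arrives_first S (X^~ w) (G^~ w) j)).
Proof.
apply: measurable_neg; apply: measurable_or; last exact: measurable_arrives_first.
rewrite (_ : (fun w => has _ _) = fun w => ~~ all (fun i => ~~ completes_first S (X^~ w) (G^~ w) j i) S).
  apply: measurable_neg.
  apply: (@measurable_all _ S (fun i w => ~~ completes_first S (X^~ w) (G^~ w) j i)) => i.
  by apply: measurable_neg; exact: measurable_completes_first.
by apply/funext => w; rewrite -[has _ _]negbK -all_predC.
Qed.

End measurable_first.

Lemma measurable_discount n o t j (X : nat * nat -> T -> R) (G : nat -> T -> R) B :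
  (forall l, measurable_fun setT (X l)) -> (forall i, measurable_fun setT (G i)) ->
  (forall k, measurable_fun setT (B k)) ->
  measurable_fun setT
    (fun w => discount s cc n o t j (X^~ w) (G^~ w) (B^~ w)).
Proof.
elim: n o t j X G => [|n IH] o t j X G mX mG mB /=; first by case: (nilp t).
have [//|_] := boolP (nilp t); set S := o ++ t.
have mcf i := measurable_completes_first mX mG S j i.
have maf := measurable_arrives_first mX mG S j.
have mlow (a : T -> R) l : measurable_fun setT a ->
    measurable_fun setT (fun w => lower (X^~ w) S (a w) l).
  by move=> ma; rewrite /lower; case: (l \in S) => //; exact: measurable_funB.
apply: measurable_funD; first apply: measurable_funD.
- apply: measurable_sum => i; apply: measurable_funM; first exact: measurable_funR_bool.
  apply: measurable_funM.
    under eq_fun do rewrite mulrA; exact: measurable_exp_neg.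
  apply: IH => //= l; first exact: mlow.
  by rewrite /lowg; case: (l == j) => //; apply: measurable_funB => //; exact: measurable_funM.
- apply: measurable_funM; first exact: measurable_funR_bool.
  apply: measurable_funM; first exact: measurable_exp_neg.
  apply: (@measurable_nat_case (fun m w => discount s cc n (o ++ batch j m) t j.+1
     (lower (X^~ w) S (G j w / (size S)%:R)) (G^~ w) (B^~ w))) => // m.
  by apply: IH => //= l; apply: mlow; exact: measurable_funM.
- apply: measurable_funM => //; apply: measurable_funR_bool.
  exact: measurable_tie.
Qed.

Lemma discount_ge0 n o t j x g be : 0 <= discount s cc n o t j x g be.
Proof.
elim: n o t j x g => [|n IH] o t j x g /=; first by case: ifP.
case: ifP => // _; rewrite !addr_ge0 ?mulr_ge0 ?expR_ge0//.
by apply: sumr_ge0 => i _; rewrite !mulr_ge0 ?expR_ge0.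
Qed.

(* The expectation of discount for a other jobs and b tagged ones. *)
Fixpoint hit (n a b : nat) : \bar R :=
  if b == 0%N then 1%E else
  if n is n'.+1 then
    (((1 + rho + s)^-1)%:E *
     ((a%:R / (a + b)%:R)%:E * hit n' a.-1 b + (b%:R / (a + b)%:R)%:E * hit n' a b.-1
      + rho%:E * \sum_(m <oo) (size_law m)%:E * hit n' (a + m)%N b))%E
  else cc%:E.

Lemma first_event_cases S (x : nat * nat -> R) (g : nat -> R) j : uniq S ->
  \sum_(i <- S) (completes_first S x g j i)%:R + (arrives_first S x g j)%:R +
  (~~ (has (completes_first S x g j) S || arrives_first S x g j))%:R = 1 :> R.
Proof.
move=> uS; have [/hasP[i iS ci]|/hasPn nc] := boolP (has _ S).
  have -> : arrives_first S x g j = false.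
    apply/negbTE/negP => /allP/(_ i iS); case/andP: ci => /ltW.
    by rewrite leNgt => /negbTE ->.
  rewrite (bigD1_seq i)//= ci big_seq_cond big1 ?addr0// => l /andP[lS /negbTE li].
  by rewrite (sum_completes_first uS iS ci)// li.
rewrite big_seq big1 ?add0r => [|l /nc /negbTE ->//].
by case: arrives_first; rewrite /= ?addr0 ?add0r.
Qed.

(** Finished jobs and elapsed interarrival times are dead. All labels of batches still to come are
    live, whatever the batch sizes turn out to be. *)
Definition live_clock (S : seq (nat * nat)) (j : nat) (p : clock) : bool :=
  match p with inl l => (l \in S) || (j.+2 <= l.1)%N | inr i => (j <= i)%N end.

Hypothesis s0 : 0 <= s.

Lemma hit_ge0 n a b : (0 <= hit n a b)%E.
Proof.
elim: n a b => [|n IH] a b /=; case: (b == 0%N) => //.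
have rs0 : 0 <= 1 + rho + s by rewrite !addr_ge0// ltW.
apply: mule_ge0; first by rewrite lee_fin invr_ge0.
apply: adde_ge0; first by apply: adde_ge0; apply: mule_ge0 => //; rewrite lee_fin divr_ge0.
apply: mule_ge0; first by rewrite lee_fin ltW.
by apply: nneseries_ge0 => m _ _; apply: mule_ge0 => //; rewrite lee_fin size_law_ge0.
Qed.

Section step.
Variables (psi : T -> R) (Z : clock -> T -> R) (B : nat -> T -> nat) (c : R).
Variables (S : seq (nat * nat)) (j : nat).
Hypothesis fr : fresh psi (live_clock S j) Z B j c.
Hypotheses (uS : uniq S) (S0 : (0 < size S)%N).
Hypothesis idS : {in S, forall l, (l.1 < j.+2)%N}.
Let X w := fun l => Z (inl l) w.
Let G w := fun i => Z (inr i) w.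
Let k : R := (size S)%:R.
Let k0 : 0 < k. Proof. by rewrite ltr0n. Qed.

Let after_completion i (p : clock) w :=
  match p with
  | inl l => lower (X w) S (X w i) l
  | inr m => lowg (G w) j (k * X w i) m
  end.

Let after_arrival (p : clock) w :=
  match p with inl l => lower (X w) S (G w j / k) l | inr m => G w m end.

(** By the time job [i] has received its requirement, every other job present has received as much
    and the interarrival clock has lost [k] times as much. The rates add up to 1 + (k - 1) + rho k +
    sg k = k (1 + rho + sg). *)
Lemma fresh_completion i sg : i \in S -> 0 <= sg ->
  fresh (fun w => psi w * expR (- (sg * (k * X w i))) *
                  (completes_first S (X w) (G w) j i)%:R)
    (live_clock (rem i S) j) (after_completion i) B j
    (c / (k * (1 + rho + sg))).
Proof.
move=> iS sg0.
pose ka (p : clock) := match p with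
  | inl l => (l \in S)%:R | inr m => if m == j then k else 0 end.
pose Q : seq clock := inr j :: [seq inl l | l <- rem i S].
have inlI : injective (inl : nat * nat -> clock) by move=> ? ? [].
have memQ l : (inl l \in Q) = (l \in rem i S).
  by rewrite inE/= mem_map.
have remE l : (l \in rem i S) = (l != i) && (l \in S) by rewrite mem_rem_uniq// inE.
have := @fresh_race psi _ Z B j c (inl i) ka Q (sg * k) (after_completion i) fr _ _ _ _ _ _ _ _.
rewrite {1}/live_clock iS => /(_ isT).
have ka0 p : 0 <= ka p by case: p => [l|m]/=; rewrite ?ler0n//; case: ifP => // _; exact: ltW.
move=> /(_ ka0).
have uQ : uniq Q.
  rewrite /= map_inj_uniq ?rem_uniq// andbT; apply/negP => /mapP[].
  by [].
move=> /(_ uQ).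
have lQ : all (live_clock S j) Q.
  by rewrite /= leqnn/= all_map; apply/allP => l /mem_rem /= ->.
move=> /(_ lQ); rewrite memQ remE eqxx => /(_ isT).
have kaQ p : live_clock S j p -> p != inl i -> p \notin Q -> ka p = 0.
  case: p => [l|m] /=.
    rewrite memQ remE => + li; rewrite (_ : (l != i)); last by apply: contra li => /eqP ->.
    by move=> _ /negbTE /= ->.
  by move=> _ _; rewrite inE negb_or => /andP[mj _]; rewrite ifF//; apply: contraNF mj => /eqP ->.
move=> /(_ kaQ); rewrite mulr_ge0 ?(ltW k0)// => /(_ isT).
have afE p w : after_completion i p w = Z p w - ka p * Z (inl i) w.
  case: p => [l|m]/=; first by rewrite /lower; case: (l \in S); rewrite ?mul1r ?mul0r ?subr0.
  by rewrite /lowg; case: (m == j); rewrite ?mul0r ?subr0.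
move=> /(_ afE) h.
have Sk : k = 1 + (size (rem i S))%:R.
  rewrite /k (perm_size (perm_to_rem iS))/= -natr1 addrC//.
have rs : \sum_(p <- Q) rate p * ka p = rho * k + (k - 1).
  rewrite big_cons /= eqxx big_map; congr (_ + _).
  rewrite Sk [1 + _]addrC addrK (eq_big_seq (fun=> 1%R)); last first.
    by move=> l /mem_rem /= ->; rewrite mul1r.
  by rewrite big_const_seq count_predT -Monoid.iteropE.
rewrite rs /= in h.
rewrite (_ : c / _ = c * 1 / (1 + sg * k + (rho * k + (k - 1)))); last first.
  rewrite mulr1 (_ : 1 + sg * k + (rho * k + (k - 1)) = k * (1 + rho + sg))//; ring.
rewrite (_ : (fun w => _) = fun w => psi w * expR (- (sg * k * Z (inl i) w)) *
    (all (fun p => ka p * Z (inl i) w < Z p w) Q)%:R); last first.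
  apply/funext => w; rewrite mulrA; congr (_ * _%:R); rewrite /= eqxx all_map.
  congr (nat_of_bool (_ && _)); apply/allP/allP => hl l lI.
    move: (lI); rewrite remE => /andP[/negbTE li lS] /=.
    by have := hl l lS; rewrite li lS mul1r.
  have [//|li] := eqVneq l i.
  by have := hl l; rewrite remE li lI /= lI mul1r => /(_ isT).
apply: fresh_sub h => -[l|m] /=; last by rewrite andbT.
rewrite remE => /orP[/andP[li ->]|jl]; last first.
  rewrite jl orbT/=; apply: contraTneq jl => -[->].
  by rewrite -leqNgt -ltnS idS.
by rewrite /=; apply: contra li => /eqP[->].
Qed.

(** Each of the [k] jobs loses one k-th of the interarrival time, so the competing jobs have total
    effective rate 1. *)
Lemma fresh_arrival sg : 0 <= sg ->
  fresh (fun w => psi w * expR (- (sg * G w j)) *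
                  (arrives_first S (X w) (G w) j)%:R)
    (fun p => live_clock S j p && (p != inr j)) after_arrival B j
    (c * rho / (1 + rho + sg)).
Proof.
move=> sg0.
pose ka (p : clock) := match p with inl l => if l \in S then k^-1 else 0 | inr m => 0 end.
pose Q : seq clock := [seq inl l | l <- S].
have inlI : injective (inl : nat * nat -> clock) by move=> ? ? [].
have := @fresh_race psi _ Z B j c (inr j) ka Q sg after_arrival fr _ _ _ _ _ _ _ _.
rewrite {1}/live_clock leqnn => /(_ isT).
have ka0 p : 0 <= ka p by case: p => [l|m]//=; case: ifP => // _; rewrite invr_ge0 ltW.
move=> /(_ ka0); rewrite map_inj_uniq// uS => /(_ isT).
have lQ : all (live_clock S j) Q by rewrite all_map; apply/allP => l /= ->.
move=> /(_ lQ).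
have pQ : inr j \notin Q by apply/negP => /mapP[].
move=> /(_ pQ).
have kaQ p : live_clock S j p -> p != inr j -> p \notin Q -> ka p = 0.
  by case: p => [l|m] //= _ _; rewrite mem_map// => /negbTE ->.
move=> /(_ kaQ sg0).
have afE p w : after_arrival p w = Z p w - ka p * Z (inr j) w.
  case: p => [l|m]/=; last by rewrite mul0r subr0.
  by rewrite /lower; case: (l \in S); rewrite ?mul0r ?subr0// mulrC.
move=> /(_ afE) h.
have rs : \sum_(p <- Q) rate p * ka p = 1.
  rewrite big_map (eq_big_seq (fun=> k^-1)); last by move=> l /= ->; rewrite mul1r.
  by rewrite big_const_seq count_predT iter_addr_0 -mulr_natr mulVf// gt_eqF.
rewrite rs /= in h.
rewrite (_ : 1 + rho + sg = rho + sg + 1); last by ring.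
rewrite (_ : (fun w => _) = fun w => psi w * expR (- (sg * Z (inr j) w)) *
    (all (fun p => ka p * Z (inr j) w < Z p w) Q)%:R); last first.
  apply/funext => w; congr (_ * _%:R); rewrite /arrives_first all_map; congr nat_of_bool.
  by apply: eq_in_all => l lS /=; rewrite lS [k^-1 * _]mulrC ltr_pdivrMr// [_ * k]mulrC.
exact: h.
Qed.

Lemma fresh_integral c' psi' live Z' j' : fresh psi' live Z' B j' c' ->
  (\int[P]_w (psi' w)%:E = c'%:E)%E.
Proof.
move=> fr'; have := fresh_tails fr' (F := [::]) (a := fun=> 0) 0 (fun=> 0%N) isT isT (fun=> lexx _).
rewrite big_nil big_ord0 oppr0 expR0 !mulr1 => <-.
by apply: eq_integral => w _; rewrite /= !mulr1.
Qed.

(** A mass count: without discount the [k] completions have total mass c / (1 + rho) and the arrival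
    c rho / (1 + rho). This exhausts the mass [c], and nothing is left for ties. *)
Lemma tie_null :
  (\int[P]_w (psi w * (~~ (has (completes_first S (X w) (G w) j) S ||
     arrives_first S (X w) (G w) j))%:R)%:E = 0)%E.
Proof.
have mX l : measurable_fun setT (fun w => X w l) by exact: (fresh_clock fr).
have mG i : measurable_fun setT (fun w => G w i) by exact: (fresh_clock fr).
have psi0 := fresh_ge0 fr.
pose fi i w := psi w * (completes_first S (X w) (G w) j i)%:R.
pose fa w := psi w * (arrives_first S (X w) (G w) j)%:R.
pose ft w := psi w * (~~ (has (completes_first S (X w) (G w) j) S ||
     arrives_first S (X w) (G w) j))%:R.
have fi0 i w : 0 <= fi i w by rewrite mulr_ge0.
have fa0 w : 0 <= fa w by rewrite mulr_ge0.
have ft0 w : 0 <= ft w by rewrite mulr_ge0.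
have sumf w : \sum_(i <- S) fi i w + fa w + ft w = psi w.
  by rewrite /fi /fa /ft -mulr_sumr -!mulrDr first_event_cases// mulr1.
have fiE i : i \in S -> fresh (fi i) (live_clock (rem i S) j) (after_completion i) B j
    (c / (k * (1 + rho))).
  move=> /fresh_completion-/(_ 0 (lexx _)); rewrite addr0; congr fresh.
  by apply/funext => w; rewrite mul0r oppr0 expR0 mulr1.
have faE : fresh fa (fun p => live_clock S j p && (p != inr j)) after_arrival B j
    (c * rho / (1 + rho)).
  move: (fresh_arrival (lexx 0)); rewrite addr0; congr fresh.
  by apply/funext => w; rewrite mul0r oppr0 expR0 mulr1.
have mpsi := fresh_measurable fr.
have mfi i : measurable_fun setT (fi i).
  apply: measurable_funM => //; apply: measurable_funR_bool.
  exact: (@measurable_completes_first (fun l => Z (inl l)) (fun m => Z (inr m))).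
have mfs : measurable_fun setT (fun w => \sum_(i <- S) fi i w) by exact: measurable_sum.
have mfa := fresh_measurable faE.
have mft : measurable_fun setT ft.
  apply: measurable_funM => //; apply: measurable_funR_bool.
  exact: (@measurable_tie (fun l => Z (inl l)) (fun m => Z (inr m))).
have sum_int : (\int[P]_w (\sum_(i <- S) fi i w)%:E = (c / (1 + rho))%:E)%E.
  under eq_integral do rewrite -sumEFin.
  rewrite ge0_integral_sum//; last 2 first.
  - by move=> i; exact/measurable_EFinP.
  - by move=> i w _; rewrite lee_fin.
  rewrite (eq_big_seq (fun=> (c / (k * (1 + rho)))%:E)); last first.
    by move=> i iS; exact: (fresh_integral (fiE i iS)).
  rewrite sumEFin big_const_seq count_predT iter_addr_0 -mulr_natr; congr EFin.
  rewrite -/k; field; rewrite ?gt_eqF//; last by rewrite addr_gt0.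
have : (\int[P]_w ((\sum_(i <- S) fi i w)%:E + (fa w)%:E + (ft w)%:E) = c%:E)%E.
  rewrite -(fresh_integral fr); apply: eq_integral => w _.
  by rewrite -!EFinD sumf.
rewrite ge0_integralD//=; last 4 first.
- by move=> w _; rewrite -EFinD lee_fin addr_ge0// sumr_ge0.
- by apply: emeasurable_funD; exact/measurable_EFinP.
- by move=> w _; rewrite lee_fin.
- exact/measurable_EFinP.
rewrite ge0_integralD//=; last 4 first.
- by move=> w _; rewrite lee_fin sumr_ge0.
- exact/measurable_EFinP.
- by move=> w _; rewrite lee_fin.
- exact/measurable_EFinP.
rewrite sum_int (fresh_integral faE) -EFinD.
have -> : c / (1 + rho) + c * rho / (1 + rho) = c.
  by field; rewrite gt_eqF// addr_gt0.
rewrite -/(ft _); set I := (X in _ -> X = _) => h.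
have {h} : (c%:E + I = c%:E)%E := h.
case: I => [I| |]//; rewrite -EFinD => -[h].
by congr EFin; move: h; rewrite -[RHS]addr0 => /addrI.
Qed.

End step.

Lemma sume_const (I : Type) (F : seq I) (x : \bar R) : (0 <= x)%E ->
  (\sum_(i <- F) x = (size F)%:R%:E * x)%E.
Proof.
move=> x0; elim: F => [|i F IH]; first by rewrite big_nil mul0e.
by rewrite big_cons IH /= -natr1 EFinD ge0_muleDl ?lee_fin// mul1e addeC.
Qed.

(** Induction on [n], generalized over the weight. Of the equally likely completions, [size o]
    remove another job and [size t] a tagged one, hence the two fractions in [hit]; ties contribute
    nothing by [tie_null]. *)
Lemma integral_discount n o t j psi Z B c :
  fresh psi (live_clock (o ++ t) j) Z B j c ->
  uniq (o ++ t) -> {in o ++ t, forall l, (l.1 < j.+2)%N} ->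
  (\int[P]_w (psi w * discount s cc n o t j (fun l => Z (inl l) w)
      (fun i => Z (inr i) w) (B^~ w))%:E = c%:E * hit n (size o) (size t))%E.
Proof.
elim: n o t j psi Z B c => [|n IH] o t j psi Z B c fr uS idS.
  rewrite /= -/(nilp t); case: ifPn => _.
    by under eq_integral do rewrite mulr1; rewrite mule1; exact: (fresh_integral fr).
  under eq_integral do rewrite mulrC EFinM.
  rewrite ge0_integralZl_EFin//.
  - by rewrite (fresh_integral fr) muleC.
  - by move=> w _; rewrite lee_fin (fresh_ge0 fr).
  - by apply/measurable_EFinP; exact: (fresh_measurable fr).
rewrite /= -/(nilp t); case: ifPn => tn.
  by under eq_integral do rewrite mulr1; rewrite mule1; exact: (fresh_integral fr).
have [l0 l0t] : exists l, l \in t by case: (t) tn => // l ? _; exists l; rewrite mem_head.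
set S := o ++ t in fr uS idS *.
have S0 : (0 < size S)%N.
  have : l0 \in S by rewrite mem_cat l0t orbT.
  by case: (S).
pose k : R := (size S)%:R.
have k0 : 0 < k by rewrite ltr0n.
pose X l w := Z (inl l) w; pose G i w := Z (inr i) w.
have mX l : measurable_fun setT (X l) by exact: (fresh_clock fr).
have mG i : measurable_fun setT (G i) by exact: (fresh_clock fr).
have mB := fresh_size fr.
have psi0 := fresh_ge0 fr.
have mpsi := fresh_measurable fr.
pose ci i w : R := (completes_first S (X^~ w) (G^~ w) j i)%:R.
pose ca w : R := (arrives_first S (X^~ w) (G^~ w) j)%:R.
pose Di i w := discount s cc n (rem i o) (rem i t) j (lower (X^~ w) S (X i w))
  (lowg (G^~ w) j (k * X i w)) (B^~ w).
pose Da m w := discount s cc n (o ++ batch j m) t j.+1 (lower (X^~ w) S (G j w / k))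
  (G^~ w) (B^~ w).
pose fi i w := psi w * expR (- (s * (k * X i w))) * ci i w * Di i w.
pose fa w := psi w * expR (- (s * G j w)) * ca w * Da (B j w) w.
pose ft w := psi w * (~~ (has (completes_first S (X^~ w) (G^~ w) j) S ||
     arrives_first S (X^~ w) (G^~ w) j))%:R * cc.
have mlow (a : T -> R) l : measurable_fun setT a ->
    measurable_fun setT (fun w => lower (X^~ w) S (a w) l).
  by move=> ma; rewrite /lower; case: (l \in S) => //; exact: measurable_funB.
have mDi i : measurable_fun setT (Di i).
  apply: measurable_discount => // l; first exact: mlow.
  by rewrite /lowg; case: (l == j) => //; apply: measurable_funB => //; exact: measurable_funM.
have mDa m : measurable_fun setT (Da m).
  by apply: measurable_discount => // l; apply: mlow; exact: measurable_funM.
have mfi i : measurable_fun setT (fi i).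
  apply: measurable_funM => //; apply: measurable_funM; last first.
    by apply: measurable_funR_bool; exact: measurable_completes_first.
  apply: measurable_funM => //; under eq_fun do rewrite mulrA; exact: measurable_exp_neg.
have mpa : measurable_fun setT (fun w => psi w * expR (- (s * G j w)) * ca w).
  apply: measurable_funM; last first.
    by apply: measurable_funR_bool; exact: measurable_arrives_first.
  by apply: measurable_funM => //; exact: measurable_exp_neg.
have mfa : measurable_fun setT fa.
  by apply: measurable_funM => //; exact: (@measurable_nat_case Da).
have mft : measurable_fun setT ft.
  apply: measurable_funM => //; apply: measurable_funM => //.
  by apply: measurable_funR_bool; exact: measurable_tie.
have fi0 i w : 0 <= fi i w by rewrite !mulr_ge0 ?expR_ge0 ?discount_ge0.
have fa0 w : 0 <= fa w by rewrite !mulr_ge0 ?expR_ge0 ?discount_ge0.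
have ft0 w : 0 <= ft w by rewrite !mulr_ge0.
pose H1 := hit n (size o).-1 (size t); pose H2 := hit n (size o) (size t).-1.
pose c1 := c / (k * (1 + rho + s)).
have c0 := fresh_mass fr.
have c10 : 0 <= c1 by rewrite divr_ge0// mulr_ge0 ?(ltW k0)// !addr_ge0// ltW.
have int_fi i : i \in S ->
    (\int[P]_w (fi i w)%:E = c1%:E * hit n (size (rem i o)) (size (rem i t)))%E.
  move=> iS; have h := fresh_completion fr uS S0 idS iS s0.
  rewrite -(rem_cat_uniq i uS) in h.
  rewrite -(IH _ _ _ _ _ _ _ h)//.
    by rewrite rem_cat_uniq// rem_uniq.
  by move=> l; rewrite rem_cat_uniq// => /mem_rem/idS.
have int_fa : (\int[P]_w (fa w)%:E = (c * rho / (1 + rho + s))%:E *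
    \sum_(m <oo) (size_law m)%:E * hit n (size o + m) (size t))%E.
  (* The induction hypothesis requires a fixed list of jobs, while the arriving batch has random
     size: the weight is split over the values of [B j], each piece being fresh by
     [fresh_size_eq]. *)
  transitivity (\int[P]_w \sum_(m <oo)
      (psi w * expR (- (s * G j w)) * ca w * (B j w == m)%:R * Da m w)%:E)%E.
    apply: eq_integral => w _; rewrite (nneseries_single (n := B j w)).
    - by rewrite eqxx mulr1.
    - by move=> m; rewrite lee_fin !mulr_ge0 ?expR_ge0 ?discount_ge0.
    - by move=> m; rewrite eq_sym => /negbTE ->; rewrite mulr0 mul0r.
  rewrite integral_nneseries//; last 2 first.
  - move=> m; apply/measurable_EFinP; apply: measurable_funM => //.
    apply: measurable_funM => //; apply: measurable_funR_bool.
    exact: measurable_fun_eqn.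
  - by move=> m w _; rewrite lee_fin !mulr_ge0 ?expR_ge0 ?discount_ge0.
  rewrite -nneseriesZl; last first.
    by move=> m _; rewrite mule_ge0 ?hit_ge0// lee_fin size_law_ge0.
  apply: eq_eseriesr => m _.
  have perm : perm_eq ((o ++ batch j m) ++ t) (S ++ batch j m).
    by rewrite /S -!catA perm_cat2l perm_catC.
  have memS l : (l \in (o ++ batch j m) ++ t) = (l \in S) || (l \in batch j m).
    by rewrite (perm_mem perm) mem_cat.
  have batchP l : l \in batch j m -> l.1 = j.+2 by case/mapP => ? _ ->.
  have h := fresh_size_eq m (fresh_arrival fr uS S0 s0).
  have {}h := fresh_sub (live' := live_clock ((o ++ batch j m) ++ t) j.+1) _ h.
  have {}h := IH _ _ _ _ _ _ _ (h _).
  rewrite h.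
  - by rewrite size_cat size_map size_iota EFinM muleA.
  - case=> [l|i] /=.
      rewrite memS => lI; rewrite andbT; case/orP: lI => [/orP[->//|/batchP ->]|/ltnW ->].
        by rewrite leqnn orbT.
      by rewrite orbT.
    by move=> ji; rewrite (ltnW ji)/=; apply: contraTneq ji => -[->]; rewrite ltnn.
  - rewrite (perm_uniq perm) cat_uniq uS/=; apply/andP; split.
      apply/hasPn => l /batchP lj; apply/negP => /idS; by rewrite lj ltnn.
    by rewrite map_inj_uniq ?iota_uniq// => a b [].
  - by move=> l; rewrite memS => /orP[/idS/ltnW//|/batchP ->].
have int_ft : (\int[P]_w (ft w)%:E = 0)%E.
  under eq_integral do rewrite /ft mulrC EFinM.
  rewrite ge0_integralZl_EFin//.
  - by rewrite (tie_null fr uS S0 idS) mule0.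
  - by move=> w _; rewrite lee_fin mulr_ge0.
  - apply/measurable_EFinP; apply: measurable_funM => //.
    by apply: measurable_funR_bool; exact: measurable_tie.
transitivity (\int[P]_w ((\sum_(i <- S) (fi i w)%:E) + (fa w)%:E + (ft w)%:E))%E.
  apply: eq_integral => w _; rewrite sumEFin -!EFinD; congr EFin.
  rewrite !mulrDr mulr_sumr; congr (_ + _ + _); first last.
  - by rewrite /ft mulrA.
  - by rewrite /fa -/(ca w) -/(Da _ w) !mulrA; congr (_ * _); rewrite mulrAC.
  apply: eq_bigr => i _; rewrite /fi -/(ci i w) -/(Di i w) !mulrA; congr (_ * _).
  exact: mulrAC.
have msum : measurable_fun setT (fun w => (\sum_(i <- S) (fi i w)%:E)%E).
  by apply: emeasurable_sum => i; exact/measurable_EFinP.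
rewrite ge0_integralD//=; last 4 first.
- by move=> w _; rewrite adde_ge0 ?lee_fin// sume_ge0// => i _; rewrite lee_fin.
- by apply: emeasurable_funD => //; exact/measurable_EFinP.
- by move=> w _; rewrite lee_fin.
- exact/measurable_EFinP.
rewrite ge0_integralD//=; last 3 first.
- by move=> w _; rewrite sume_ge0// => i _; rewrite lee_fin.
- by move=> w _; rewrite lee_fin.
- exact/measurable_EFinP.
rewrite int_fa int_ft adde0 ge0_integral_sum//; last 2 first.
- by move=> i; exact/measurable_EFinP.
- by move=> i w _; rewrite lee_fin.
have H10 : (0 <= H1)%E by exact: hit_ge0.
have H20 : (0 <= H2)%E by exact: hit_ge0.
have notboth i : i \in o -> i \notin t.
  by move=> io; move: uS; rewrite cat_uniq => /and3P[_ /hasPn h _]; apply/negP => /h; rewrite io.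
rewrite {1}/S big_cat/=.
rewrite (eq_big_seq (fun=> c1%:E * H1)%E); last first.
  move=> i io /=; rewrite int_fi ?mem_cat ?io//.
  by rewrite size_rem// [rem i t]rem_id// notboth.
rewrite [X in (_ + X + _)%E](eq_big_seq (fun=> c1%:E * H2)%E); last first.
  move=> i it /=; rewrite int_fi ?mem_cat ?it ?orbT//.
  by rewrite [size (rem i t)]size_rem// [rem i o]rem_id//; apply: contraL it; exact: notboth.
have c1H1 : (0 <= c1%:E * H1)%E by rewrite mule_ge0// lee_fin.
have c1H2 : (0 <= c1%:E * H2)%E by rewrite mule_ge0// lee_fin.
rewrite !sume_const//; set Sg := (\sum_(m <oo) _)%E.
have Sg0 : (0 <= Sg)%E.
  by apply: nneseries_ge0 => m _ _; rewrite mule_ge0 ?hit_ge0// lee_fin size_law_ge0.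
rewrite muleA -EFinM.
have rs0 : 0 < 1 + rho + s by rewrite ltr_wpDr// addr_gt0.
rewrite -/H1 -/H2.
have kE : ((size o + size t)%N)%:R = k :> R by rewrite /k size_cat.
rewrite kE !ge0_muleDr ?adde_ge0 ?mule_ge0 ?lee_fin ?divr_ge0 ?(ltW k0) ?(ltW rho0) ?invr_ge0 ?(ltW rs0)//.
rewrite !muleA -!EFinM; congr (_%:E * _ + _%:E * _ + _%:E * _)%E; rewrite /c1; field; by rewrite !gt_eqF.
Qed.
End expectation.

(** * The recurrence for the transforms *)

Section fixed_point.
Context (R : realType).
Variables (rho q s : R).
Hypotheses (rho0 : 0 < rho) (q0 : 0 <= q) (q1 : q < 1) (s0 : 0 < s).
Implicit Types f g : nat -> nat -> \bar R.

Let rs0 : 0 < 1 + rho + s. Proof. by rewrite !addr_gt0. Qed.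

Definition event_step f (a b : nat) : \bar R :=
  (((1 + rho + s)^-1)%:E *
     ((a%:R / (a + b)%:R)%:E * f a.-1 b + (b%:R / (a + b)%:R)%:E * f a b.-1
      + rho%:E * \sum_(m <oo) (size_law q m)%:E * f (a + m)%N b))%E.

Lemma size_lawE m : (0 <= (size_law q m)%:E)%E.
Proof. by rewrite lee_fin size_law_ge0. Qed.

Lemma sum_size_law : (\sum_(m <oo) (size_law q m)%:E = 1)%E.
Proof.
rewrite nneseries_recl//; last by move=> *; exact: size_lawE.
rewrite add0e -(nneseries_addn 1); last by move=> ?; exact: size_lawE.
under eq_eseriesr do rewrite addn1 /=.
rewrite nneseries_geometric ?subr_ge0 ?(ltW q1) ?q0//.
by rewrite divff// subr_eq0 gt_eqF.
Qed.

Lemma le_event_step f g a b : (forall m n, (0 <= f m n)%E) ->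
  (forall m n, (f m n <= g m n)%E) -> (event_step f a b <= event_step g a b)%E.
Proof.
move=> f0 fg.
apply: lee_wpmul2l; first by rewrite lee_fin invr_ge0 ltW.
apply: leeD; first apply: leeD.
- by apply: lee_wpmul2l => //; rewrite lee_fin divr_ge0.
- by apply: lee_wpmul2l => //; rewrite lee_fin divr_ge0.
- apply: lee_wpmul2l; first by rewrite lee_fin ltW.
  apply: lee_nneseries => m _; first by move=> _; rewrite mule_ge0 ?size_lawE.
  by apply: lee_wpmul2l => //; exact: size_lawE.
Qed.

(** The two completion weights sum to 1 and the batch sizes have total mass 1, so a constant is
    multiplied by (1 + rho) / (1 + rho + s): the contraction factor. *)
Lemma event_stepD f (e : R) a b : (forall m n, (0 <= f m n)%E) -> 0 <= e -> (0 < b)%N ->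
  (event_step (fun m n => f m n + e%:E) a b =
   event_step f a b + ((1 + rho) / (1 + rho + s) * e)%:E)%E.
Proof.
move=> f0 e0 b0; rewrite /event_step.
have ab0 : 0 < (a + b)%:R :> R by rewrite ltr0n addn_gt0 b0 orbT.
have al0 : 0 <= a%:R / (a + b)%:R :> R by rewrite divr_ge0.
have be0 : 0 <= b%:R / (a + b)%:R :> R by rewrite divr_ge0.
have Sg0 : (0 <= \sum_(m <oo) (size_law q m)%:E * f (a + m)%N b)%E.
  by apply: nneseries_ge0 => m _ _; rewrite mule_ge0 ?size_lawE.
have -> : (\sum_(m <oo) (size_law q m)%:E * (f (a + m)%N b + e%:E) =
    \sum_(m <oo) (size_law q m)%:E * f (a + m)%N b + e%:E)%E.
  under eq_eseriesr do rewrite ge0_muleDr ?lee_fin// [X in (_ + X)%E]muleC.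
  rewrite nneseriesD; last 2 first.
  - by move=> m _ _; rewrite mule_ge0 ?size_lawE.
  - by move=> m _ _; rewrite mule_ge0 ?size_lawE// lee_fin.
  by rewrite nneseriesZl ?sum_size_law ?mule1// => m _; exact: size_lawE.
rewrite [((a%:R / _)%:E * _)%E]ge0_muleDr ?lee_fin//.
rewrite [((b%:R / _)%:E * _)%E]ge0_muleDr ?lee_fin//.
rewrite [(rho%:E * _)%E]ge0_muleDr ?lee_fin//.
set A := (_ * f _ _)%E; set B := (_ * f _ _)%E; set C := (rho%:E * \sum_(_ <oo) _)%E.
have A0 : (0 <= A)%E by rewrite mule_ge0// lee_fin.
have B0 : (0 <= B)%E by rewrite mule_ge0// lee_fin.
have C0 : (0 <= C)%E by rewrite mule_ge0// lee_fin ltW.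
have -> : (A + (a%:R / (a + b)%:R)%:E * e%:E + (B + (b%:R / (a + b)%:R)%:E * e%:E)
     + (C + rho%:E * e%:E) = A + B + C + ((1 + rho) * e)%:E)%E.
  rewrite [(A + _ + (B + _))%E]addeACA -!EFinM -EFinD addeACA -EFinD; congr (_ + _%:E)%E.
  rewrite -!mulrDl; congr (_ * _); rewrite -natrD.
  by rewrite divff ?gt_eqF.
rewrite ge0_muleDr ?adde_ge0 ?lee_fin ?mulr_ge0 ?addr_ge0 ?(ltW rho0)//.
by rewrite -EFinM; congr (_ + _%:E)%E; rewrite mulrA [_^-1 * _]mulrC.
Qed.

Let r := (1 + rho) / (1 + rho + s).
Let r0 : 0 <= r. Proof. by rewrite divr_ge0 ?addr_ge0 ?(ltW rho0) ?(ltW s0). Qed.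
Let r1 : r < 1. Proof. by rewrite ltr_pdivrMr// mul1r ltrDl. Qed.

Lemma hitS cc n a b : (0 < b)%N ->
  hit rho q s cc n.+1 a b = event_step (hit rho q s cc n) a b.
Proof. by case: b. Qed.

(* r is the mean of exp(- s Y) for the time Y to the next event, of rate 1 + rho. *)
Lemma hit_gap n a b :
  (hit rho q s 1 n a b <= hit rho q s 0 n a b + (r ^+ n)%:E)%E.
Proof.
have h0 := fun m => @hit_ge0 R rho q s rho0 q0 q1 0 (lexx 0) (ltW s0) m.
elim: n a b => [|n IH] a b; first by rewrite expr0 /=; case: (b == 0)%N; rewrite ?add0e// leeDl.
case: b => [|b]; first by rewrite /= leeDl// lee_fin exprn_ge0.
rewrite !hitS// exprS -event_stepD// ?exprn_ge0//.
apply: le_event_step => // m k; apply: hit_ge0 => //; exact: ltW.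
Qed.

(** By monotonicity of [event_step], both [f] and its image lie between the two iterates of rank
    [n.+1], whose gap tends to 0. *)
Lemma hit_fixed_point f : (forall a b, (0 <= f a b)%E) ->
  (forall n a b, (hit rho q s 0 n a b <= f a b <= hit rho q s 1 n a b)%E) ->
  forall a b, (0 < b)%N -> f a b = event_step f a b.
Proof.
move=> f0 hf a b b0.
have h0 := fun m => @hit_ge0 R rho q s rho0 q0 q1 0 (lexx 0) (ltW s0) m.
have bd n : (hit rho q s 0 n.+1 a b <= event_step f a b <= hit rho q s 1 n.+1 a b)%E.
  by rewrite !hitS//; apply/andP; split; apply: le_event_step => // m k; case/andP: (hf n m k).
have small e : 0 < e -> exists n, r ^+ n.+1 <= e.
  move=> e0; have := @cvg_geometric R 1 r; rewrite ger0_norm// => /(_ r1).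
  move=> /cvgrPdist_le/(_ e e0)[N _ HN]; exists N.
  by have := HN N.+1 (leqnSn _); rewrite /= sub0r normrN mul1r ger0_norm// exprn_ge0.
apply/le_anti/andP; split; apply/lee_addgt0Pr => e /small[n rn].
  have /andP[_ h] := hf n.+1 a b; apply: (le_trans h).
  apply: (le_trans (hit_gap _ _ _)); apply: leeD; last by rewrite lee_fin.
  by case/andP: (bd n).
have /andP[_ h] := bd n; apply: (le_trans h).
apply: (le_trans (hit_gap _ _ _)); apply: leeD; last by rewrite lee_fin.
by case/andP: (hf n.+1 a b).
Qed.

End fixed_point.

(** * Exponential tails and Laplace transforms of survival functions *)

Section exponential_tails.
Context (R : realType).
Variable r : R.
Hypothesis r0 : 0 < r.
Local Notation mu := (@lebesgue_measure R).

Let mpdf (D : set R) : measurable_fun D (EFin \o exponential_pdf r).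
Proof.
apply/measurable_EFinP/measurable_funTS; exact: measurable_exponential_pdf.
Qed.

Let pdf0 x : (0 <= (EFin \o exponential_pdf r) x)%E.
Proof. by rewrite lee_fin exponential_pdf_ge0// ltW. Qed.

Lemma exponential_prob_below (a : R) : 0 <= a ->
  exponential_prob r `]-oo, a[ = (1 - expR (- (r * a)))%:E.
Proof.
move=> a0; rewrite /exponential_prob.
rewrite (@itv_bndbnd_setU _ _ -oo%O (BLeft 0) (BLeft a))//.
rewrite ge0_integral_setU//=; last 3 first.
- exact: (@mpdf _).
- by move=> x _; exact: pdf0.
- apply/disj_setPS => y [/=]; rewrite !in_itv/= => y0 /andP[].
  by rewrite leNgt y0.
rewrite integral0_eq ?add0e; last first.
  by move=> y; rewrite /= in_itv/= => y0; rewrite lt0_exponential_pdf.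
rewrite integral_itv_bndo_bndc//.
move: a0; rewrite le_eqVlt => /predU1P[<-|a0].
  by rewrite set_itv1 integral_set1 mulr0 oppr0 expR0 subrr.
by have := exponential_prob_itv0c r a0; rewrite /exponential_prob mulNr => ->.
Qed.

Lemma exponential_prob_above (a : R) : 0 <= a ->
  exponential_prob r `]a, +oo[ = (expR (- (r * a)))%:E.
Proof.
move=> a0; have := integral_exponential_pdf r0.
rewrite -set_itvNyy (@itv_bndbnd_setU _ _ -oo%O (BRight a) +oo%O)//.
rewrite ge0_integral_setU//=; last 3 first.
- exact: (@mpdf _).
- by move=> x _; exact: pdf0.
- by apply/disj_setPS => y [/=]; rewrite !in_itv/= andbT leNgt => /negP.
rewrite -integral_itv_bndo_bndc//.
have := exponential_prob_below a0; rewrite /exponential_prob => ->.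
set I := (X in (_ + X)%E = _ -> _) => h; rewrite -/I; move: h.
case: I => [I| |]//; rewrite -EFinD => -[h]; congr EFin; lra.
Qed.

End exponential_tails.

Section laplace.
Context d (T : measurableType d) (R : realType) (P : probability T R).
Variables (s : R) (Om : T -> \bar R).
Hypotheses (s0 : 0 < s) (measurable_Om : measurable_fun setT Om).
Hypothesis Om0 : forall w, (0 <= Om w)%E.
Local Notation mu := (@lebesgue_measure R).

Lemma exp_sojourn_ge0 W : 0 <= exp_sojourn s W.
Proof. by case: W => //= y; exact: expR_ge0. Qed.

Lemma measurable_exp_sojourn : measurable_fun setT (fun w => exp_sojourn s (Om w)).
Proof.
rewrite (_ : (fun w => _) = fun w =>
    expR (- (s * fine (Om w))) * (Om w \is a fin_num)%:R); last first.
  by apply/funext => w; case: (Om w) => [y| |]/=; rewrite ?mulr1 ?mulr0.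
apply: measurable_funM.
  apply: measurable_exp_neg; apply: (@measurableT_comp _ _ _ _ _ _ fine) => //.
by apply: measurable_funR_bool; apply: (measurable_fun_bool true); exact: emeasurable_fin_num.
Qed.

Lemma integral_bool (b : T -> bool) : measurable_fun setT b ->
  (\int[P]_w ((b w)%:R : R)%:E = P [set w | b w])%E.
Proof.
move=> mb; have mb' : measurable [set w | b w].
  by rewrite -[X in measurable X]setTI; exact: (mb measurableT [set true]).
rewrite -[X in _ = P X]setIT -integral_indic//; apply: eq_integral => w _.
by rewrite indicE; congr (_%:R%:E); case: (boolP (b w)) => bw; [rewrite mem_set|rewrite memNset//; apply/negP].
Qed.

(** The factor [s^-1 * exponential_pdf s x] is exp(- s x) on the half-line and 0 elsewhere, which
    makes known facts on exponential laws applicable. *)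
Let F x w := (s^-1 * exponential_pdf s x * (x%:E < Om w)%E%:R)%:E.

Let pdf_ge0 x : 0 <= exponential_pdf s x.
Proof. by rewrite exponential_pdf_ge0// ltW. Qed.

Let inner (W : \bar R) : (0 <= W)%E ->
  (\int[mu]_x (s^-1 * exponential_pdf s x * (x%:E < W)%E%:R)%:E =
   (s^-1 * (1 - exp_sojourn s W))%:E)%E.
Proof.
move=> W0.
under eq_integral do rewrite -mulrA EFinM.
rewrite ge0_integralZl_EFin//; last 3 first.
- by move=> x _; rewrite lee_fin mulr_ge0.
- apply/measurable_EFinP; apply: measurable_funM; first exact: measurable_exponential_pdf.
  by apply: measurable_funR_bool; exact: measurable_fun_lte.
- by rewrite invr_ge0 ltW.
rewrite EFinM; congr (_ * _)%E; case: W W0 => [y| |]//= y0.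
  rewrite -exponential_prob_below// /exponential_prob [RHS]integral_mkcond.
  apply: eq_integral => x _; rewrite patchE /=.
  rewrite lte_fin mem_setE in_itv/=; case: (x < y)%R; first by rewrite mulr1.
  by rewrite mulr0.
rewrite subr0 -(integral_exponential_pdf s0); apply: eq_integral => x _.
by rewrite ltry mulr1.
Qed.

(** Tonelli: integrating exp(- s x) over x < Om gives (1 - exp(- s Om)) / s. The identity is stated
    as a sum to keep subtraction out of the extended reals. *)
Lemma laplace_survival :
  (\int[mu]_(x in `[0%R, +oo[) (fine (P [set w | (x%:E < Om w)%E]) * expR (- s * x))%:E
   + (s^-1)%:E * \int[P]_w (exp_sojourn s (Om w))%:E = (s^-1)%:E)%E.
Proof.
have mOm x : measurable_fun setT (fun w => (x%:E < Om w)%E).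
  exact: measurable_fun_lte.
have si0 : 0 <= s^-1 by rewrite invr_ge0 ltW.
have mF : measurable_fun setT (fun z : R * T => F z.1 z.2).
  apply/measurable_EFinP; apply: measurable_funM.
    apply: measurable_funM => //; apply: (measurableT_comp (@measurable_exponential_pdf R s)).
    exact: measurable_fst.
  apply: measurable_funR_bool; apply: measurable_fun_lte.
    by apply/measurable_EFinP; exact: measurable_fst.
  exact: (measurableT_comp (f := Om)).
have F0 z : (0 <= F z.1 z.2)%E by rewrite lee_fin !mulr_ge0.
have := @fubini_tonelli _ _ _ _ R mu P (fun z => F z.1 z.2) mF F0.
have -> : (\int[mu]_x \int[P]_y F (x, y).1 (x, y).2 =
    \int[mu]_(x in `[0%R, +oo[) (fine (P [set w | (x%:E < Om w)%E]) * expR (- s * x))%:E)%E.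
  rewrite [RHS]integral_mkcond; apply: eq_integral => x _ /=.
  under eq_integral do rewrite /F EFinM.
  rewrite ge0_integralZl_EFin//; last 2 first.
  - exact/measurable_EFinP/measurable_funR_bool.
  - by rewrite mulr_ge0.
  rewrite integral_bool// patchE; case: ifPn => [|/negP x0].
    rewrite inE/= in_itv/= andbT => x0.
    rewrite exponential_pdfE// mulrA mulVf ?gt_eqF// mul1r EFinM fineK ?fin_num_measure//; last first.
      by rewrite -[X in measurable X]setTI; exact: (mOm x measurableT [set true]).
    by rewrite muleC.
  rewrite lt0_exponential_pdf ?mulr0 ?mul0e// ltNge; apply/negP => xx.
  by apply: x0; rewrite inE/= in_itv/= andbT.
move=> ->.
have -> : (\int[P]_y \int[mu]_x F (x, y).1 (x, y).2 =
    \int[P]_w (s^-1 * (1 - exp_sojourn s (Om w)))%:E)%E.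
  by apply: eq_integral => w _; exact: (inner (Om0 w)).
have le1 w : exp_sojourn s (Om w) <= 1.
  have := Om0 w; case: (Om w) => [y| |]//=; rewrite lee_fin => y0.
  by rewrite -[leRHS]expR0 ler_expR oppr_le0 mulr_ge0// ltW.
rewrite -ge0_integralZl_EFin//; last 2 first.
- by move=> w _; rewrite lee_fin exp_sojourn_ge0.
- by apply/measurable_EFinP; exact: measurable_exp_sojourn.
rewrite -ge0_integralD//; last 4 first.
- by move=> w _; rewrite lee_fin mulr_ge0// subr_ge0.
- apply/measurable_EFinP; apply: measurable_funM => //; apply: measurable_funB => //.
  exact: measurable_exp_sojourn.
- by move=> w _; rewrite mule_ge0// lee_fin exp_sojourn_ge0.
- apply: measurable_funeM; apply/measurable_EFinP; exact: measurable_exp_sojourn.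
under eq_integral do rewrite -EFinM -EFinD -mulrDr subrK mulr1.
by rewrite integral_cst//= probability_setT mule1.
Qed.

End laplace.

(** * The queue at the arrival of the tagged batch *)

Section initial_state.
Context d (T : measurableType d) (R : realType) (P : probability T R).
Variables (Q : batch_input P) (rho q : R).
Hypotheses (rho0 : 0 < rho) (q0 : 0 <= q) (q1 : q < 1).
Hypothesis hQ : MXM1_input Q rho q.

Local Notation clock := ((nat * nat) + nat)%type.

Definition clock_time (p : clock) : {RV P >-> R} :=
  match p with
  | inl (0%N, i) => other_work Q i
  | inl (1%N, j) => tagged_work Q j
  | inl (k.+2, l) => later_work Q k l
  | inr i => gap Q i
  end.

Definition clock_source (c : clock + nat) : source :=
  match c with
  | inl (inl (0%N, i)) => OtherWork i
  | inl (inl (1%N, j)) => TaggedWork j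
  | inl (inl (k.+2, l)) => LaterWork k l
  | inl (inr i) => Gap i
  | inr k => Size k
  end.

Lemma clock_source_inj : injective clock_source.
Proof.
case=> [[[[|[|k]] l]|i]|m] [[[[|[|k']] l']|i']|m'] //=.
- by move=> [->].
- by move=> [->].
- by move=> [-> ->].
- by move=> [->].
- by move=> [->].
Qed.

Lemma clock_time_law p : exponential_law (rate rho p) (clock_time p).
Proof.
by case: hQ => -[h1 h2] h3 _ h4 _; case: p => [[[|[|k]] l]|i]//=.
Qed.

Lemma clock_time_tail p a : 0 <= a ->
  P [set w | a < clock_time p w] = (expR (- (rate rho p * a)))%:E.
Proof.
move=> a0; rewrite -(exponential_prob_above (rate_gt0 rho0 p) a0).
rewrite -(clock_time_law p)//; congr (P _); apply/seteqP; split => w /=;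
  by rewrite in_itv/= andbT.
Qed.

(** [geometric_law] prescribes the masses at b >= 1 only. They already sum to 1, so the mass at 0
    vanishes. *)
Lemma batch_size_law k m : P [set w | batch_size Q k w = m] = (size_law q m)%:E.
Proof.
have [_ _ /(_ k) h _ _] := hQ.
have mB (n : nat) : measurable [set w | batch_size Q k w = n].
  by rewrite -[X in measurable X]setTI; exact: (@measurable_funPT _ _ _ _ (batch_size Q k) measurableT [set n]).
case: m => [|m]; last exact: h.
have : P (\bigcup_n [set w | batch_size Q k w = n]) = 1%E.
  rewrite -(@probability_setT _ _ _ P); congr (P _); apply/seteqP; split => // w _.
  by exists (batch_size Q k w).
rewrite measure_bigcup//; last first.
  by apply/trivIsetP => i j _ _ ij; apply/seteqP; split => // w [/= -> /eqP]; rewrite (negbTE ij).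
under eq_eseriesl do rewrite in_setT.
rewrite nneseries_recl//.
rewrite -(nneseries_addn 1)//.
rewrite (eq_eseriesr (g := fun m => ((1 - q) * q ^+ m)%:E)); last first.
  by move=> m _; rewrite addn1; exact: h.
rewrite nneseries_geometric ?subr_ge0 ?(ltW q1) ?q0//.
rewrite divff ?subr_eq0 ?gt_eqF//.
set V := (X in _ -> X = _) => h1.
have {h1} : (V + 1%:E = 1%:E)%E := h1.
by case: V => [v| |]//; rewrite -EFinD => -[v1]; congr EFin; rewrite /=; lra.
Qed.

(** [fresh_gt0] asks for positivity at every outcome of nonzero weight, whereas exponential laws
    give it almost surely; the indicator of this event is therefore the initial weight. Countability
    of the clocks makes the event measurable. *)
Definition all_positive w : bool := `[< forall p, 0 < clock_time p w >].

Lemma measurable_all_positive : measurable_fun setT all_positive.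
Proof.
apply: (measurable_fun_bool true); rewrite setTI.
rewrite (_ : _ @^-1` _ = \bigcap_n [set w | if unpickle n is Some p then 0 < clock_time p w else true]).
  apply: bigcapT_measurable => n; case: (unpickle n) => [p|].
    by rewrite -[X in measurable X]setTI; apply: (@measurable_fun_ltr _ _ _ setT (cst 0) (clock_time p) _ _ measurableT [set true]).
  by rewrite (_ : [set _ | _] = setT)//; apply/seteqP; split.
apply/seteqP; split => w /=.
  by move=> /asboolP h n _; case: (unpickle n).
by move=> h; apply/asboolP => p; have := h (pickle p) I; rewrite /= pickleK.
Qed.

Lemma ae_all_positive : {ae P, forall w, all_positive w}.
Proof.
have : {ae P, forall w, forall n, if unpickle n is Some p then 0 < clock_time p w else true}.
  apply: ae_foralln => n; case: (unpickle n) => [p|]; last exact: nearW.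
  have m1 : measurable [set w | 0 < clock_time p w].
    by rewrite -[X in measurable X]setTI; apply: (@measurable_fun_ltr _ _ _ setT (cst 0) (clock_time p) _ _ measurableT [set true]).
  exists (~` [set w | 0 < clock_time p w]); split => //; first exact: measurableC.
  have := probability_setC P m1.
  by rewrite clock_time_tail// mulr0 oppr0 expR0 subee.
apply: filterS => w h; apply/asboolP => p; have := h (pickle p).
by rewrite pickleK.
Qed.

(** A joint tail is a finite intersection of events with pairwise distinct sources, so mutual
    independence gives the product; multiplying by the almost sure indicator does not change the
    integral. *)
Lemma fresh_initial S : fresh P rho q (fun w => (all_positive w)%:R)
  (live_clock S 0) clock_time (batch_size Q) 0 1.
Proof.
have mB k (n : nat) : measurable [set w | batch_size Q k w = n].
  by rewrite -[X in measurable X]setTI; exact: (@measurable_funPT _ _ _ _ (batch_size Q k) measurableT [set n]).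
have mZ p (a : R) : measurable [set w | a < clock_time p w].
  by rewrite -[X in measurable X]setTI; apply: (@measurable_fun_ltr _ _ _ setT (cst a) (clock_time p) _ _ measurableT [set true]).
split => //.
- by apply: measurable_funR_bool; exact: measurable_all_positive.
- move=> w p; case: (boolP (all_positive w)) => [/asboolP h _ _|_]; first exact: h.
  by rewrite eqxx.
move=> F a r m uF _ a0.
pose E (c : clock + nat) : set T := match c with
  | inl p => [set w | a p < clock_time p w] | inr k => [set w | batch_size Q k w = m k] end.
pose L : seq (clock + nat) := [seq inl p | p <- F] ++ [seq inr k | k <- iota 0 r].
have uL : uniq L.
  rewrite cat_uniq !map_inj_uniq ?uF ?iota_uniq ?andbT//=; last 2 first.
  - by move=> ? ? [].
  - by move=> ? ? [].
  by apply/hasPn => _ /mapP[k _ ->]; apply/negP => /mapP[].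
have mE c : measurable (E c) by case: c => [p|k] /=.
have bigE : [set w | all (fun p => a p < clock_time p w) F &&
    all (fun k => batch_size Q (0 + k) w == m k) (iota 0 r)] =
    \bigcap_(k : 'I_(size L)) E (tnth (in_tuple L) k).
  apply/seteqP; split => w /=.
    move=> /andP[/allP aF /allP aB] k _.
    have : tnth (in_tuple L) k \in L by exact: mem_tnth.
    rewrite mem_cat => /orP[/mapP[p pF ->]|/mapP[n nr ->]] /=; first exact: aF.
    by have := aB n nr => /eqP.
  move=> h; have {}h c : c \in L -> E c w.
    move=> cL; have [k ->] : exists k, c = tnth (in_tuple L) k by exact/tnthP.
    exact: h.
  apply/andP; split; apply/allP.
    by move=> p pF; apply: (h (inl p)); rewrite mem_cat map_f.
  by move=> n nr; apply/eqP; apply: (h (inr n)); rewrite mem_cat map_f ?orbT.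
transitivity (P (\bigcap_(k : 'I_(size L)) E (tnth (in_tuple L) k))).
  rewrite -bigE -integral_bool; last first.
    apply: measurable_and.
      apply: (@measurable_all _ _ _ F (fun p w => a p < clock_time p w)) => p.
      exact: measurable_fun_ltr.
    apply: (@measurable_all _ _ _ (iota 0 r) (fun k w => batch_size Q (0 + k) w == m k)) => k.
    exact: measurable_fun_eqn.
  apply: ae_eq_integral => //.
  - apply/measurable_EFinP; apply: measurable_funM; last first.
      apply: measurable_funR_bool.
      apply: (@measurable_all _ _ _ (iota 0 r) (fun k w => batch_size Q (0 + k) w == m k)) => k.
      exact: measurable_fun_eqn.
    apply: measurable_funM; apply: measurable_funR_bool; first exact: measurable_all_positive.
    apply: (@measurable_all _ _ _ F (fun p w => a p < clock_time p w)) => p.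
    exact: measurable_fun_ltr.
  - apply/measurable_EFinP; apply: measurable_funR_bool; apply: measurable_and.
      apply: (@measurable_all _ _ _ F (fun p w => a p < clock_time p w)) => p.
      exact: measurable_fun_ltr.
    apply: (@measurable_all _ _ _ (iota 0 r) (fun k w => batch_size Q (0 + k) w == m k)) => k.
    exact: measurable_fun_eqn.
  - by apply: filterS ae_all_positive => w -> _; rewrite mul1r -natrM mulnb.
have [_ _ _ _ indep] := hQ.
rewrite (indep _ (fun k => clock_source (tnth (in_tuple L) k))); last 2 first.
- move=> i j /clock_source_inj /eqP; rewrite (tnth_nth (inl (inr 0%N))) [X in _ == X](tnth_nth (inl (inr 0%N))).
  by rewrite nth_uniq// => /eqP/val_inj.
- move=> k; case: (tnth _ k) => [p|n] /=.
    move: (a p) => y; case: p => [[[|[|k']] l]|i] /=; (exists `]y, +oo[%classic; first by []);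
    rewrite setTI; apply/seteqP; split => w /=; by rewrite in_itv/= andbT.
  by exists [set m n] => //; rewrite setTI.
have <- : (\prod_(c <- L) P (E c))%E = (\prod_(j < size L) P (E (tnth (in_tuple L) j)))%E.
  exact: big_tnth.
rewrite big_cat !big_map/= (eq_bigr (fun p => (expR (- (rate rho p * a p)))%:E)); last first.
  by move=> p _; rewrite clock_time_tail.
rewrite prodEFin [X in (_ * X)%E](eq_bigr (fun k => (size_law q (m k))%:E)); last first.
  by move=> k _; rewrite batch_size_law.
rewrite prodEFin -EFinM mul1r; congr (_ * _)%:E.
  rewrite -sumrN; elim/big_ind2: _ => [|u v x y -> ->|//]; first by rewrite expR0.
  by rewrite expRD.
by rewrite -[X in iota 0 X]subn0 -/(index_iota 0 r) big_mkord.
Qed.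

Definition other_jobs (n : nat) : seq (nat * nat) := [seq (0%N, i) | i <- iota 0 n].
Definition tagged_jobs (b : nat) : seq (nat * nat) := [seq (1%N, j) | j <- iota 0 b].

Lemma jobs_presentE n b w (A : R -> R) y : A 0 = 0 ->
  jobs_present Q n b w A y =
  load A (fun l => clock_time (inl l) w) (fun i => clock_time (inr i) w)
    (fun k => batch_size Q k w) (other_jobs n ++ tagged_jobs b) 0 0 y.
Proof.
move=> A0; rewrite /jobs_present /load -EFinD; congr (_ + _)%E.
  congr EFin; rewrite /unfinished A0 subr0 big_cat !big_map; congr (_ + _).
    by rewrite -[X in iota 0 X]subn0 -/(index_iota 0 n) big_mkord.
  by rewrite -[X in iota 0 X]subn0 -/(index_iota 0 b) big_mkord.
apply: eq_eseriesr => k _; congr EFin; apply: eq_bigr => l _.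
by rewrite !add0r.
Qed.

Variable s : R.
Hypothesis s0 : 0 < s.

(** Every solution [A] of the processor-sharing equation obeys the pathwise bounds, so the choice of
    the witness is immaterial. *)
Lemma batch_sojourn_sandwich N n b (Om : T -> \bar R) : batch_sojourn Q n b Om ->
  {ae P, forall w, (0 <= Om w)%E /\
    discount s 0 N (other_jobs n) (tagged_jobs b) 0 (fun l => clock_time (inl l) w)
      (fun i => clock_time (inr i) w) (fun k => batch_size Q k w)
    <= exp_sojourn s (Om w) <=
    discount s 1 N (other_jobs n) (tagged_jobs b) 0 (fun l => clock_time (inl l) w)
      (fun i => clock_time (inr i) w) (fun k => batch_size Q k w)}.
Proof.
move=> sj; apply: filterS2 ae_all_positive sj => w /asboolP pos [A ps ->].
have A0 : A 0 = 0 by rewrite ps// set_itv1 Rintegral_set1.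
have -> : completion_time Q b w A =
    end_time A 0 (fun l => clock_time (inl l) w) (tagged_jobs b).
  congr ereal_inf; apply/seteqP; split => _ [y [y0 yt] <-]; exists y => //; split=> //.
    by move=> l /mapP[j]; rewrite mem_iota => /andP[_ jb] ->; rewrite A0 subr0; exact: yt.
  move=> j jb; have := yt (1%N, j); rewrite A0 subr0; apply.
  by rewrite map_f// mem_iota.
split; first exact: end_time_ge.
set X := fun l => clock_time (inl l) w; set G := fun i => clock_time (inr i) w.
set be := fun k => batch_size Q k w.
have NE y : jobs_present Q n b w A y = load A X G be (other_jobs n ++ tagged_jobs b) 0 0 y.
  exact: jobs_presentE.
have r01 y : 0 <= (fine (jobs_present Q n b w A y))^-1 <= 1 by rewrite NE rate01.
have ndA := service_nondecreasing r01 ps.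
have G0 k : 0 <= arrival G 0 k by apply: sumr_ge0 => i _; exact/ltW/pos.
have mr : measurable_fun (`[0, +oo[ : set R) (fun y => (fine (jobs_present Q n b w A y))^-1).
  rewrite (_ : (fun y => _) = fun y => (fine (load A X G be (other_jobs n ++ tagged_jobs b) 0 0 y))^-1).
    exact: measurable_rate.
  by apply/funext => y; rewrite NE.
suff : discount s 0 N (other_jobs n) (tagged_jobs b) 0 X G be <=
    expR (s * 0) * exp_sojourn s (end_time A 0 X (tagged_jobs b)) <=
    discount s 1 N (other_jobs n) (tagged_jobs b) 0 X G be.
  by rewrite mulr0 expR0 mul1r.
apply: (@discount_sandwich R s s0 A (jobs_present Q n b w A)) => //.
- rewrite cat_uniq !map_inj_uniq ?iota_uniq ?andbT/=; last 2 first.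
  + by move=> ? ? [].
  + by move=> ? ? [].
  by apply/hasPn => _ /mapP[k _ ->]; apply/negP => /mapP[].
- by move=> l; rewrite mem_cat => /orP[] /mapP[i _ ->].
- by move=> l _; exact: pos.
- by move=> l _; exact: pos.
- by move=> i; exact: pos.
Qed.

(** An empty tagged batch leaves at once. The value 1 at [b = 0] is the boundary value reached when
    the last tagged job completes, as in [hit]. *)
Definition discounted_sojourn (Om : nat -> nat -> T -> \bar R) (n b : nat) : \bar R :=
  if b == 0%N then 1%E else (\int[P]_w (exp_sojourn s (Om n b w))%:E)%E.

Lemma discounted_sojourn_rec (Om : nat -> nat -> T -> \bar R) :
  (forall n b, measurable_fun setT (Om n b)) ->
  (forall n b, (0 < b)%N -> batch_sojourn Q n b (Om n b)) ->
  forall n b, (0 < b)%N ->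
  discounted_sojourn Om n b = event_step rho q s (discounted_sojourn Om) n b.
Proof.
move=> mOm sj; apply: hit_fixed_point => //.
  move=> n b; rewrite /discounted_sojourn; case: (b == 0%N) => //.
  by apply: integral_ge0 => w _; rewrite lee_fin exp_sojourn_ge0.
move=> N n b; case: b => [|b].
  by case: N => [|N]; rewrite /= /discounted_sojourn /= lexx.
rewrite /discounted_sojourn /=.
have disc cc : 0 <= cc -> (\int[P]_w ((all_positive w)%:R *
    discount s cc N (other_jobs n) (tagged_jobs b.+1) 0 (fun l => clock_time (inl l) w)
      (fun i => clock_time (inr i) w) (fun k => batch_size Q k w))%:E =
    hit rho q s cc N n b.+1)%E.
  move=> cc0; rewrite (integral_discount rho0 q0 q1 cc0 (ltW s0) N (fresh_initial (other_jobs n ++ tagged_jobs b.+1))).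
  - by rewrite mul1e !size_map !size_iota.
  - rewrite cat_uniq !map_inj_uniq ?iota_uniq ?andbT//; last 2 first.
    + by move=> ? ? [].
    + by move=> ? ? [].
    by apply/hasPn => _ /mapP[k _ ->]; apply/negP => /mapP[].
  - by move=> l; rewrite mem_cat => /orP[] /mapP[i _ ->].
have mdisc cc : measurable_fun setT (fun w => ((all_positive w)%:R *
    discount s cc N (other_jobs n) (tagged_jobs b.+1) 0 (fun l => clock_time (inl l) w)
      (fun i => clock_time (inr i) w) (fun k => batch_size Q k w))%:E).
  apply/measurable_EFinP; apply: measurable_funM.
    by apply: measurable_funR_bool; exact: measurable_all_positive.
  exact: (@measurable_discount _ _ _ _ _ _ _ _ _ (fun l => clock_time (inl l)) (fun i => clock_time (inr i))).
have me : measurable_fun setT (fun w => (exp_sojourn s (Om n b.+1 w))%:E).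
  by apply/measurable_EFinP; exact: measurable_exp_sojourn.
have sw := batch_sojourn_sandwich N (sj n b.+1 isT).
rewrite -(disc 0)// -(disc 1)//; apply/andP; split; apply: ae_ge0_le_integral => //.
- by move=> w _; rewrite lee_fin mulr_ge0// discount_ge0.
- by move=> w _; rewrite lee_fin exp_sojourn_ge0.
- apply: filterS2 ae_all_positive sw => w -> [_ /andP[h _]] _.
  by rewrite mul1r lee_fin.
- by move=> w _; rewrite lee_fin exp_sojourn_ge0.
- by move=> w _; rewrite lee_fin mulr_ge0// discount_ge0.
- apply: filterS2 ae_all_positive sw => w -> [_ /andP[_ h]] _.
  by rewrite mul1r lee_fin.
Qed.

End initial_state.

(* The entries with b = 0, which do not correspond to any batch, are set to 0. *)
Definition laplace_coef (R : realType) (Enb : nat -> nat -> R -> R) (s : R)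
    (n b : nat) : R :=
  if b == 0%N then 0 else
  \int[@lebesgue_measure R]_(x in `[0, +oo[) (Enb n b x * expR (- s * x)).

(** * The recurrence for the transforms of the survival functions *)

Section recurrence.
Context d (T : measurableType d) (R : realType) (P : probability T R).
Variables (Q : batch_input P) (rho q s : R).
Hypotheses (rho0 : 0 < rho) (q0 : 0 <= q) (q1 : q < 1) (s0 : 0 < s).
Hypothesis hQ : MXM1_input Q rho q.
Variable Omega : nat -> nat -> {RV P >-> \bar R}.
Hypothesis hOmega : forall n b, (1 <= b)%N -> batch_sojourn Q n b (Omega n b).
Local Notation mu := (@lebesgue_measure R).

Let e := laplace_coef (survival Omega) s.
(* Omega n b is nonnegative only almost surely. *)
Let Om n b w : \bar R := maxe 0%E (Omega n b w).

Let mOm n b : measurable_fun setT (Om n b).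
Proof. by apply: measurable_maxe. Qed.

Let Om0 n b w : (0 <= Om n b w)%E.
Proof. by rewrite le_max lexx. Qed.

Let batch_sojourn_Om n b : (0 < b)%N -> batch_sojourn Q n b (Om n b).
Proof.
move=> b0; apply: filterS (hOmega n b0) => w [A ps OmA]; exists A => //.
rewrite /Om OmA max_r//.
by apply: le_ereal_inf_tmp => _ [y [y0 _] <-]; rewrite lee_fin.
Qed.

Let phi n b := discounted_sojourn P s Om n b.

Let le1 n b w : exp_sojourn s (Om n b w) <= 1.
Proof.
have := Om0 n b w; case: (Om n b w) => [y| |]//=; rewrite lee_fin => y0.
by rewrite -[leRHS]expR0 ler_expR oppr_le0 mulr_ge0// ltW.
Qed.

(** This transfers the fixed point equation to the transforms; the bounds on [e] follow from [phi]
    lying in [0, 1]. At [b = 0] the conventions agree: 1 = 1 - s 0. *)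
Let phiE n b : phi n b = (1 - s * e n b)%:E /\ 0 <= e n b <= s^-1.
Proof.
rewrite /phi /discounted_sojourn /e /laplace_coef; case: eqP => [_|b0].
  by rewrite mulr0 subr0 lexx invr_ge0 ltW.
set p := (\int[P]_w _)%E.
have p0 : (0 <= p)%E by apply: integral_ge0 => w _; rewrite lee_fin exp_sojourn_ge0.
have p1 : (p <= 1)%E.
  rewrite -(probability_setT P) -[leRHS]mul1e -integral_cst//.
  apply: ge0_le_integral => //.
  - by move=> w _; rewrite lee_fin exp_sojourn_ge0.
  - by apply/measurable_EFinP; exact: measurable_exp_sojourn.
  - by move=> w _; rewrite lee_fin.
have := @laplace_survival _ _ _ P s (Om n b) s0 (mOm n b) (Om0 n b).
rewrite -/p.
have -> : (\int[mu]_(x in `[0%R, +oo[)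
    (fine (P [set w | (x%:E < Om n b w)%E]) * expR (- s * x))%:E =
    \int[mu]_(x in `[0%R, +oo[) (survival Omega n b x * expR (- s * x))%:E)%E.
  apply: eq_integral => x; rewrite inE/= in_itv/= andbT => x0.
  congr ((fine (P _) * _)%:E); apply/seteqP; split => w /=.
    by rewrite lt_max => /orP[|//]; rewrite lte_fin ltNge x0.
  by rewrite lt_max => ->; rewrite orbT.
rewrite /Rintegral; set I := (\int[mu]_(x in _) _)%E.
have I0 : (0 <= I)%E.
  apply: integral_ge0 => x _; rewrite lee_fin mulr_ge0 ?expR_ge0//.
  by apply: fine_ge0; exact: measure_ge0.
case: p p0 p1 => [p| |]//; rewrite !lee_fin => p0 p1.
case: I I0 => [I| |]//=; rewrite lee_fin => I0.
rewrite -EFinM -EFinD => -[h].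
have h' : s * I = 1 - p.
  have -> : I = s^-1 - s^-1 * p by rewrite -[X in X - _]h addrK.
  by rewrite mulrBr mulrA divff ?gt_eqF// mul1r.
rewrite h' opprB addrCA subrr addr0; split => //.
by rewrite I0/= -h lerDl mulr_ge0// invr_ge0 ltW.
Qed.

Lemma survival_laplace_itv n b : 0 <= e n b <= s^-1.
Proof. by case: (phiE n b). Qed.

Lemma survival_laplace_series_cvg n b :
  cvgn (series (fun m => q ^+ m * e (n + m.+1)%N b)).
Proof.
apply: (@series_le_cvg R _ (geometric s^-1 q)).
- by move=> m; rewrite mulr_ge0 ?exprn_ge0//; case/andP: (survival_laplace_itv (n + m.+1) b).
- by move=> m; rewrite /= mulr_ge0 ?exprn_ge0// invr_ge0 ltW.
- move=> m; rewrite /= mulrC ler_wpM2r ?exprn_ge0//.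
  by case/andP: (survival_laplace_itv (n + m.+1) b).
- by apply: is_cvg_geometric_series; rewrite ger0_norm.
Qed.

(** Substitution of [phi = 1 - s e] in the fixed point equation. The constants on the two sides
    differ by s (n + b), and after division by s they leave the inhomogeneous term n + b. *)
Lemma survival_laplace_rec n b : (0 < b)%N ->
  (s + 1 + rho) * (n + b)%:R * e n b =
  (n + b)%:R + n%:R * e n.-1 b + b%:R * e n b.-1
  + rho * (1 - q) * (n + b)%:R * limn (series (fun m => q ^+ m * e (n + m.+1)%N b)).
Proof.
move=> b0; set f := limn _.
have := discounted_sojourn_rec rho0 q0 q1 hQ s0 mOm batch_sojourn_Om n b0.
rewrite -/(phi n b) /event_step -/phi.
have -> : (\sum_(m <oo) (size_law q m)%:E * phi (n + m)%N b = (1 - s * (1 - q) * f)%:E)%E.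
  rewrite nneseries_recl//; last first.
    move=> m _; rewrite mule_ge0 ?size_lawE//.
    by rewrite /phi /discounted_sojourn; case: ifP => // _; apply: integral_ge0 => w _; rewrite lee_fin exp_sojourn_ge0.
  rewrite mul0e add0e -(nneseries_addn 1); last first.
    move=> m; rewrite mule_ge0 ?size_lawE//.
    by rewrite /phi /discounted_sojourn; case: ifP => // _; apply: integral_ge0 => w _; rewrite lee_fin exp_sojourn_ge0.
  rewrite (eq_eseriesr (g := fun m => ((1 - q) * q ^+ m - s * (1 - q) * (q ^+ m * e (n + m.+1)%N b))%:E)); last first.
    move=> m _; rewrite addn1 (phiE _ _).1 -EFinM; congr EFin; rewrite /=; ring.
  apply/cvg_lim => //.
  rewrite (_ : (fun k => _) = EFin \o (fun k => series (geometric (1 - q) q) k -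
      s * (1 - q) * series (fun m => q ^+ m * e (n + m.+1)%N b) k)); last first.
    apply/funext => k; rewrite /= sumEFin; congr EFin.
    by rewrite /series /= mulr_sumr -sumrB.
  apply: cvg_EFin; first exact: nearW.
  rewrite /= (_ : 1 - s * (1 - q) * f = (1 - q) / (1 - q) - s * (1 - q) * f); last first.
    by rewrite divff// subr_eq0 gt_eqF.
  apply: cvgB; first by apply: cvg_geometric_series; rewrite ger0_norm.
  by apply: cvgMr; exact: survival_laplace_series_cvg.
have p1 := (phiE n b).1; have p2 := (phiE n.-1 b).1; have p3 := (phiE n b.-1).1.
rewrite p1 [discounted_sojourn P s Om n.-1 b]p2 [discounted_sojourn P s Om n b.-1]p3.
rewrite -!EFinM => -[].
have k0 : (n + b)%:R != 0 :> R by rewrite pnatr_eq0 addn_eq0 negb_and -!lt0n b0 orbT.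
have rs0 : 1 + rho + s != 0 by rewrite gt_eqF// !addr_gt0.
move=> h.
have {h} : s * ((1 + rho + s) * (n + b)%:R * e n b) =
  s * ((n + b)%:R + n%:R * e n.-1 b + b%:R * e n b.-1 + rho * (1 - q) * (n + b)%:R * f).
  have -> : s * ((1 + rho + s) * (n + b)%:R * e n b) =
    (1 + rho + s) * (n + b)%:R - (1 + rho + s) * (n + b)%:R * (1 - s * e n b) by ring.
  by rewrite h natrD; field; rewrite -natrD k0.
move=> /(mulfI (lt0r_neq0 s0)) <-; ring.
Qed.

End recurrence.

Local Open Scope complex_scope.

(** * Absolutely convergent complex series *)

Section complex_series.
Context (R : realType).
Local Notation C := (cplx R).
Implicit Types (z w : C) (a b : nat -> C).

Definition cnorm (z : C) : R := ComplexField.Normc.normc z.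

Lemma cnormE z : `|z| = ((cnorm z)%:C : C). Proof. by []. Qed.

Lemma cnorm_ge0 z : 0 <= cnorm z.
Proof. by rewrite -ler0c -(cnormE z) normr_ge0. Qed.

Lemma cnorm_le z (e : R) : (`|z| <= (e%:C : C)) = (cnorm z <= e).
Proof. by rewrite cnormE lecR. Qed.

Lemma cnormM z w : cnorm (z * w) = cnorm z * cnorm w. Proof. exact: ComplexField.Normc.normcM. Qed.

Lemma cnormD z w : cnorm (z + w) <= cnorm z + cnorm w. Proof. exact: le_normcD. Qed.

Lemma cnormN z : cnorm (- z) = cnorm z. Proof. exact: normcN. Qed.

Lemma cnorm0 : cnorm 0 = 0. Proof. exact: ComplexField.Normc.normc0. Qed.

Lemma cnorm1 : cnorm 1 = 1. Proof. exact: ComplexField.Normc.normc1. Qed.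

Lemma cnormX z n : cnorm (z ^+ n) = cnorm z ^+ n.
Proof. by elim: n => [|n IH]; rewrite ?expr0 ?cnorm1// !exprS cnormM IH. Qed.

Lemma cnorm_real (x : R) : cnorm (x%:C : C) = `|x|.
Proof. by rewrite /cnorm /= expr0n /= addr0 sqrtr_sqr. Qed.

Lemma natr_cplx (n : nat) : (n%:R : C) = (n%:R : R)%:C.
Proof. by rewrite rmorph_nat. Qed.

Lemma cnorm_natr (n : nat) : cnorm (n%:R : C) = n%:R.
Proof. by rewrite natr_cplx cnorm_real ger0_norm. Qed.

Lemma cnorm_sum (I : Type) (r : seq I) (P : pred I) (F : I -> C) :
  cnorm (\sum_(i <- r | P i) F i) <= \sum_(i <- r | P i) cnorm (F i).
Proof.
elim/big_rec2: _ => [|i y x _ h]; first by rewrite cnorm0.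
by rewrite (le_trans (cnormD _ _))// lerD2l.
Qed.

Lemma ReB z w : complex.Re (z - w) = complex.Re z - complex.Re w.
Proof. by case: z => ? ?; case: w. Qed.

Lemma ImB z w : complex.Im (z - w) = complex.Im z - complex.Im w.
Proof. by case: z => ? ?; case: w. Qed.

Lemma Re_sum (I : Type) (r : seq I) (P : pred I) (F : I -> C) :
  complex.Re (\sum_(i <- r | P i) F i) = \sum_(i <- r | P i) complex.Re (F i).
Proof. by elim/big_rec2: _ => [//|i y x _ <-]; case: (F i) => ? ?; case: x. Qed.

Lemma Im_sum (I : Type) (r : seq I) (P : pred I) (F : I -> C) :
  complex.Im (\sum_(i <- r | P i) F i) = \sum_(i <- r | P i) complex.Im (F i).
Proof. by elim/big_rec2: _ => [//|i y x _ <-]; case: (F i) => ? ?; case: x. Qed.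

Lemma normr_Re_le z : `|complex.Re z| <= cnorm z.
Proof.
case: z => x y; rewrite /cnorm/= -sqrtr_sqr ler_wsqrtr// lerDl; exact: sqr_ge0.
Qed.

Lemma normr_Im_le z : `|complex.Im z| <= cnorm z.
Proof.
case: z => x y; rewrite /cnorm/= -sqrtr_sqr ler_wsqrtr// lerDr; exact: sqr_ge0.
Qed.

Lemma cnorm_ReIm_le z : cnorm z <= `|complex.Re z| + `|complex.Im z|.
Proof.
have -> : z = ((complex.Re z)%:C : C) + (0 +i* complex.Im z).
  by case: z => x y /=; apply/eqP; rewrite eq_complex/= addr0 add0r !eqxx.
rewrite (le_trans (cnormD _ _))// cnorm_real /=.
by rewrite lerD// ?addr0 ?add0r// /cnorm /= ?expr0n ?add0r ?sqrtr_sqr.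
Qed.

(** A positive element of the complex field is real, so real tolerances suffice. *)
Lemma cvg_cplxP (u : nat -> C) (l : C) : u @ \oo --> l <->
  (forall e : R, 0 < e -> \forall n \near \oo, cnorm (l - u n) <= e).
Proof.
split => [/cvgrPdist_le h e e0|h].
  have := h (e%:C); rewrite ltcR => /(_ e0); apply: filterS => n.
  by rewrite cnorm_le.
apply/cvgrPdist_le => e e0.
have eE : e = ((complex.Re e)%:C : C).
  by rewrite RRe_real// ger0_real// ltW.
have : 0 < complex.Re e by move: e0; rewrite eE ltcR.
by move=> /h; apply: filterS => n; rewrite eE cnorm_le.
Qed.

Lemma cvg_Re (u : nat -> C) (l : C) : u @ \oo --> l ->
  (fun n => complex.Re (u n)) @ \oo --> complex.Re l.
Proof.
move=> /cvg_cplxP h; apply/cvgrPdist_le => e /h; apply: filterS => n.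
by apply: le_trans; rewrite -ReB normr_Re_le.
Qed.

Lemma cvg_Im (u : nat -> C) (l : C) : u @ \oo --> l ->
  (fun n => complex.Im (u n)) @ \oo --> complex.Im l.
Proof.
move=> /cvg_cplxP h; apply/cvgrPdist_le => e /h; apply: filterS => n.
by apply: le_trans; rewrite -ImB normr_Im_le.
Qed.

Lemma cvg_ReIm (u : nat -> C) (x y : R) :
  (fun n => complex.Re (u n)) @ \oo --> x ->
  (fun n => complex.Im (u n)) @ \oo --> y -> u @ \oo --> (x +i* y : C).
Proof.
move=> /cvgrPdist_le hx /cvgrPdist_le hy; apply/cvg_cplxP => e e0.
have e20 : 0 < e / 2 by rewrite divr_gt0.
apply: filterS2 (hx _ e20) (hy _ e20) => n h1 h2.
rewrite (le_trans (cnorm_ReIm_le _))// ReB ImB /= [leRHS](splitr e).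
exact: lerD.
Qed.

Definition asum a (M : R) := forall n, \sum_(k < n) cnorm (a k) <= M.

Definition csum a : C := limn (series a).

Lemma csumE a l : series a @ \oo --> l -> csum a = l.
Proof. by move=> h; apply: cvg_lim h. Qed.

Lemma asum_cvg a M : asum a M -> series a @ \oo --> csum a.
Proof.
move=> aM.
have cv (p : C -> R) : (forall z, `|p z| <= cnorm z) ->
    cvgn (series (fun k => p (a k))).
  move=> pN; apply: normed_cvg; apply: nondecreasing_is_cvgn.
    by apply: nondecreasing_series => k _ _ /=.
  exists M => _ [n _ <-]; change (\sum_(0 <= k < n) `|p (a k)| <= M); rewrite big_mkord.
  by apply: le_trans (aM n); apply: ler_sum => k _; exact: pN.
have /cvg_ex[x hx] := cv _ normr_Re_le; have /cvg_ex[y hy] := cv _ normr_Im_le.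
have h : series a @ \oo --> (x +i* y : C).
  apply: cvg_ReIm.
    by move: hx; apply: cvg_trans; apply: near_eq_cvg; apply: nearW => n; rewrite /series/= Re_sum.
  by move: hy; apply: cvg_trans; apply: near_eq_cvg; apply: nearW => n; rewrite /series/= Im_sum.
by rewrite (csumE h).
Qed.

Lemma csum_le a M : asum a M -> cnorm (csum a) <= M.
Proof.
move=> aM; have /cvg_cplxP h := asum_cvg aM.
apply/ler_addgt0Pr => e /h[n _ /(_ n (leqnn n))] /= hn.
rewrite -(subrK (series a n) (csum a)) (le_trans (cnormD _ _))// addrC lerD//.
rewrite (le_trans (cnorm_sum _ _ _))//= big_mkord; exact: aM.
Qed.

Lemma csumD a b M M' : asum a M -> asum b M' ->
  csum (fun n => a n + b n) = csum a + csum b.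
Proof.
move=> /asum_cvg ha /asum_cvg hb; apply: csumE.
have -> : series (fun n => a n + b n) = (fun n => series a n + series b n).
  by apply/funext => n; rewrite /series /= big_split.
exact: (cvgD ha hb).
Qed.

Lemma csumZ c a M : asum a M -> csum (fun n => c * a n) = c * csum a.
Proof.
move=> /asum_cvg ha; apply: csumE.
have -> : series (fun n => c * a n) = (fun n => c * series a n).
  by apply/funext => n; rewrite /series /= mulr_sumr.
exact: (cvgMr ha).
Qed.

Lemma csumS a M : asum a M -> csum a = a 0%N + csum (fun n => a n.+1).
Proof.
move=> /asum_cvg ha.
have h : series (fun n => a n.+1) @ \oo --> csum a - a 0%N.
  have -> : series (fun n => a n.+1) = (fun n => series a n.+1 - a 0%N).
    by apply/funext => n; rewrite /series /= big_nat_recl// addrC addKr.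
  apply: cvgB; last exact: cvg_cst.
  by rewrite (cvg_shiftS (series a)).
by rewrite (csumE h) addrC subrK.
Qed.

Lemma eq_csum a b : a =1 b -> csum a = csum b.
Proof. by move=> /funext ->. Qed.

End complex_series.

(** * Double series with geometric decay *)

Section double_series.
Context (R : realType).
Local Notation C := (cplx R).
Implicit Types (z w c : C).

Lemma geometric_sum_le n (r : R) : 0 <= r -> r < 1 ->
  \sum_(i < n) r ^+ i <= (1 - r)^-1.
Proof.
move=> r0 r1; rewrite -[leRHS]mul1r ler_pdivlMr ?subr_gt0// mulrC.
have /eqP := subrX1 r n; rewrite -eqr_opp opprB -mulNr opprB => /eqP <-.
by rewrite gerBl exprn_ge0.
Qed.

(** With t' halfway between t and 1, and r = t / t' < 1, the bound n r^n <= 1 + r + ... + r^(n-1) <=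
    1 / (1 - r) absorbs the factor n. *)
Lemma natr_geometric (t : R) : 0 <= t < 1 -> exists K t' : R,
  [/\ 0 <= K, t <= t', 0 <= t' < 1 & forall n : nat, n%:R * t ^+ n <= K * t' ^+ n].
Proof.
move=> /andP[t0 t1]; pose t' := (1 + t) / 2; pose r := t / t'.
have t'0 : 0 < t' by rewrite /t'; lra.
have r0 : 0 <= r by rewrite divr_ge0// ltW.
have r1 : r < 1 by rewrite ltr_pdivrMr// mul1r /t'; lra.
exists (1 - r)^-1, t'; split.
- by rewrite invr_ge0 subr_ge0 ltW.
- by rewrite /t'; lra.
- by rewrite /t'; apply/andP; split; lra.
move=> n; have -> : t = r * t' by rewrite divfK// gt_eqF.
rewrite exprMn mulrA ler_wpM2r ?exprn_ge0 ?(ltW t'0)//.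
apply: le_trans (geometric_sum_le n r0 r1).
apply: (@le_trans _ _ (\sum_(i < n) r ^+ n)); first by rewrite sumr_const card_ord mulr_natl.
by apply: ler_sum => i _; rewrite ler_wiXn2l ?(ltW r1) ?(ltnW (ltn_ord i)).
Qed.

Definition decays (a : nat -> C) := exists K t : R,
  [/\ 0 <= K, 0 <= t < 1 & forall n, cnorm (a n) <= K * t ^+ n].

(** Geometric decay, unlike mere summability, survives the weights n and b produced by
    differentiation, at the price of a larger ratio [t]. *)
Definition decays2 (a : nat -> nat -> C) := exists K t : R,
  [/\ 0 <= K, 0 <= t < 1 & forall n b, cnorm (a n b) <= K * t ^+ n * t ^+ b].

(** The inner sum is over [n], in the order used by [Egf]. *)
Definition csum2 (a : nat -> nat -> C) : C := csum (fun b => csum (fun n => a n b)).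

Lemma geometric_asum (a : nat -> C) (K t : R) : 0 <= K -> 0 <= t < 1 ->
  (forall n, cnorm (a n) <= K * t ^+ n) -> asum a (K / (1 - t)).
Proof.
move=> K0 /andP[t0 t1] ha n.
apply: (@le_trans _ _ (\sum_(k < n) K * t ^+ k)); first by apply: ler_sum.
by rewrite -mulr_sumr ler_wpM2l// geometric_sum_le.
Qed.

Lemma decays_asum a : decays a -> exists M, asum a M.
Proof. by move=> [K [t [K0 t01 h]]]; exists (K / (1 - t)); exact: geometric_asum. Qed.

Lemma decaysD a b : decays a -> decays b -> decays (fun n => a n + b n).
Proof.
move=> [K [t [K0 /andP[t0 t1] h]]] [K' [t' [K'0 /andP[t'0 t'1] h']]].
exists (K + K'), (Num.max t t'); split.
- exact: addr_ge0.
- by rewrite le_max t0 gt_max t1.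
move=> n; rewrite (le_trans (cnormD _ _))// mulrDl lerD//.
  by rewrite (le_trans (h n))// ler_wpM2l// lerXn2r ?nnegrE ?le_max ?t0 ?lexx.
by rewrite (le_trans (h' n))// ler_wpM2l// lerXn2r ?nnegrE ?le_max ?t0 ?lexx ?orbT.
Qed.

Lemma decaysZ c a : decays a -> decays (fun n => c * a n).
Proof.
move=> [K [t [K0 t01 h]]]; exists (cnorm c * K), t; split => //.
  by rewrite mulr_ge0 ?cnorm_ge0.
by move=> n; rewrite cnormM -mulrA ler_wpM2l ?cnorm_ge0.
Qed.

Lemma csum_D a b : decays a -> decays b -> csum (fun n => a n + b n) = csum a + csum b.
Proof. by move=> /decays_asum[M h] /decays_asum[M' h']; exact: csumD h h'. Qed.

Lemma csum_Z c a : decays a -> csum (fun n => c * a n) = c * csum a.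
Proof. by move=> /decays_asum[M h]; exact: csumZ h. Qed.

Lemma csum_S a : decays a -> csum a = a 0%N + csum (fun n => a n.+1).
Proof. by move=> /decays_asum[M h]; exact: csumS h. Qed.

Lemma decays_geometric (z : C) : cnorm z < 1 -> decays (fun n => z ^+ n).
Proof.
move=> z1; exists 1, (cnorm z); rewrite cnorm_ge0 z1 ler01; split => // n.
by rewrite cnormX mul1r.
Qed.

Lemma decays2_row (a : nat -> nat -> C) b : decays2 a -> decays (fun n => a n b).
Proof.
move=> [K [t [K0 t01 h]]]; exists (K * t ^+ b), t; split => //.
  by rewrite mulr_ge0// exprn_ge0//; case/andP: t01.
by move=> n; rewrite mulrAC.
Qed.

Lemma decays2_col (a : nat -> nat -> C) n : decays2 a -> decays (fun b => a n b).
Proof.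
move=> [K [t [K0 t01 h]]]; exists (K * t ^+ n), t; split => //.
by rewrite mulr_ge0// exprn_ge0//; case/andP: t01.
Qed.

Lemma decays_csum (a : nat -> nat -> C) : decays2 a -> decays (fun b => csum (fun n => a n b)).
Proof.
move=> [K [t [K0 t01 h]]]; have /andP[t0 t1] := t01.
exists (K / (1 - t)), t; split => //; first by rewrite divr_ge0// subr_ge0 ltW.
move=> b; rewrite mulrAC; apply: csum_le; apply: geometric_asum => //.
  by rewrite mulr_ge0// exprn_ge0.
by move=> n; rewrite mulrAC.
Qed.

Lemma decays2D a b : decays2 a -> decays2 b -> decays2 (fun n m => a n m + b n m).
Proof.
move=> [K [t [K0 /andP[t0 t1] h]]] [K' [t' [K'0 /andP[t'0 t'1] h']]].
exists (K + K'), (Num.max t t'); split.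
- exact: addr_ge0.
- by rewrite le_max t0 gt_max t1.
have tm n : t ^+ n <= Num.max t t' ^+ n by rewrite lerXn2r ?nnegrE ?le_max ?t0 ?lexx.
have t'm n : t' ^+ n <= Num.max t t' ^+ n by rewrite lerXn2r ?nnegrE ?le_max ?t0 ?lexx ?orbT.
move=> n m; rewrite (le_trans (cnormD _ _))// !mulrDl lerD//.
  by rewrite (le_trans (h n m))// ler_pM ?mulr_ge0 ?exprn_ge0// ler_wpM2l.
by rewrite (le_trans (h' n m))// ler_pM ?mulr_ge0 ?exprn_ge0// ler_wpM2l.
Qed.

Lemma decays2Z c a : decays2 a -> decays2 (fun n m => c * a n m).
Proof.
move=> [K [t [K0 t01 h]]]; exists (cnorm c * K), t; split => //.
  by rewrite mulr_ge0 ?cnorm_ge0.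
by move=> n m; rewrite cnormM -!mulrA ler_wpM2l ?cnorm_ge0// mulrA.
Qed.

Lemma decays2Sn a : decays2 a -> decays2 (fun n m => a n.+1 m).
Proof.
move=> [K [t [K0 /andP[t0 t1] h]]]; exists K, t; rewrite t0 t1; split => // n m.
rewrite (le_trans (h n.+1 m))// ler_wpM2r ?exprn_ge0// ler_wpM2l//.
by rewrite exprS ler_piMl ?exprn_ge0// ltW.
Qed.

Lemma decays2_natr_n a : decays2 a -> decays2 (fun n m => n%:R * a n m).
Proof.
move=> [K [t [K0 t01 h]]]; have [K' [t' [K'0 tt' t'01 h']]] := natr_geometric t01.
have /andP[t0 _] := t01; have /andP[t'0 _] := t'01.
exists (K * K'), t'; split => //; first exact: mulr_ge0.
move=> n m; rewrite cnormM cnorm_natr.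
rewrite (le_trans (ler_wpM2l _ (h n m)))// mulrA ler_pM ?mulr_ge0 ?exprn_ge0//.
  by rewrite mulrCA -mulrA ler_wpM2l.
by rewrite lerXn2r ?nnegrE.
Qed.

Lemma decays2_natr_b a : decays2 a -> decays2 (fun n m => m%:R * a n m).
Proof.
move=> [K [t [K0 t01 h]]]; have [K' [t' [K'0 tt' t'01 h']]] := natr_geometric t01.
have /andP[t0 _] := t01; have /andP[t'0 _] := t'01.
exists (K * K'), t'; split => //; first exact: mulr_ge0.
move=> n m; rewrite cnormM cnorm_natr.
rewrite (le_trans (ler_wpM2l _ (h n m)))// mulrCA.
rewrite (_ : K * K' * t' ^+ n * t' ^+ m = (K * t' ^+ n) * (K' * t' ^+ m)); last by ring.
by rewrite ler_pM ?mulr_ge0 ?exprn_ge0// ler_wpM2l// lerXn2r ?nnegrE.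
Qed.

Lemma csum2D a b : decays2 a -> decays2 b ->
  csum2 (fun n m => a n m + b n m) = csum2 a + csum2 b.
Proof.
move=> ha hb; rewrite /csum2 -csum_D; [|exact: decays_csum..].
by apply: eq_csum => m; rewrite csum_D//; exact: decays2_row.
Qed.

Lemma csum2Z c a : decays2 a -> csum2 (fun n m => c * a n m) = c * csum2 a.
Proof.
move=> ha; rewrite /csum2 -csum_Z; last exact: decays_csum.
by apply: eq_csum => m; rewrite csum_Z//; exact: decays2_row.
Qed.

Lemma csum2Sn a : decays2 a ->
  csum2 a = csum (fun m => a 0%N m) + csum2 (fun n m => a n.+1 m).
Proof.
move=> ha; rewrite /csum2 -csum_D; last 2 first.
- exact: decays2_col.
- exact/decays_csum/decays2Sn.
by apply: eq_csum => m; rewrite csum_S//; exact: decays2_row.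
Qed.

Lemma csum2Sb a : decays2 a ->
  csum2 a = csum (fun n => a n 0%N) + csum2 (fun n m => a n m.+1).
Proof. by move=> ha; rewrite /csum2 csum_S//; exact: decays_csum. Qed.

Lemma eq_csum2 a b : (forall n m, a n m = b n m) -> csum2 a = csum2 b.
Proof. by move=> ab; congr csum2; apply/funext => n; apply/funext => m. Qed.

End double_series.

(** * Term-by-term differentiation of power series *)

Section differentiation.
Context (R : realType).
Local Notation C := (cplx R).
Implicit Types (z w c : C) (h : C -> C).

(* A first-order expansion with quadratic remainder: unlike differentiability
   itself, it passes to sums of series. *)
Definition qdiff h z d (M dl : R) := forall e : C, cnorm e <= dl ->
  cnorm (h (z + e) - h z - e * d) <= M * cnorm e ^+ 2.

Lemma qdiff_is_derive h z d M dl : 0 < dl -> qdiff h z d M dl -> is_derive z 1 h d.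
Proof.
move=> dl0 hd.
have cv : (k^-1 *: ((h \o shift z) (k *: (1 : C)) - h z)) @[k --> (0 : C)^'] --> d.
  apply/cvgrPdist_le => e e0.
  have eE : e = ((complex.Re e)%:C : C) by rewrite RRe_real// ger0_real// ltW.
  have re0 : 0 < complex.Re e by move: e0; rewrite eE ltcR.
  pose r := Num.min dl (complex.Re e / (`|M| + 1)).
  have r0 : 0 < r by rewrite lt_min dl0 divr_gt0// ltr_wpDl.
  have rC0 : 0 < (r%:C : C) by rewrite ltcR.
  near=> k.
  have k0 : k != 0 by near: k; exact: nbhs_dnbhs_neq.
  have kr : cnorm k <= r by rewrite -cnorm_le; near: k; exact: dnbhs0_le.
  have kd : cnorm k <= dl by rewrite (le_trans kr)// ge_min lexx.
  have nk0 : 0 < cnorm k.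
    rewrite lt_neqAle cnorm_ge0 andbT eq_sym; apply: contra k0 => /eqP.
    by move=> /ComplexField.Normc.eq0_normc ->.
  have ke : cnorm k * (`|M| + 1) <= complex.Re e.
    by rewrite -ler_pdivlMr ?ltr_wpDl// (le_trans kr)// ge_min lexx orbT.
  rewrite eE cnorm_le /= scaler1.
  have -> : d - k^-1 *: (h (k + z) - h z) = - (k^-1 * (h (z + k) - h z - k * d)).
    rewrite [k + z]addrC; change (d - k^-1 * (h (z + k) - h z) = - (k^-1 * (h (z + k) - h z - k * d))).
    by field.
  rewrite cnormN cnormM (le_trans (ler_wpM2l (cnorm_ge0 _) (hd k kd)))//.
  have -> : cnorm k^-1 * (M * cnorm k ^+ 2) = M * cnorm k.
    rewrite /cnorm ComplexField.Normc.normcV -/(cnorm k); field; exact: lt0r_neq0.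
  apply: le_trans ke; rewrite mulrC ler_pM2l// (le_trans (ler_norm M))// lerDl//.
apply: DeriveDef; first by apply/cvg_ex; exists d.
by apply: cvg_lim cv.
Unshelve. all: by end_near.
Qed.

Lemma decaysB (a b : nat -> C) : decays a -> decays b -> decays (fun n => a n - b n).
Proof.
move=> ha /(decaysZ (-1)) hb; have := decaysD ha hb; congr decays.
by apply/funext => n; rewrite mulN1r.
Qed.

Lemma csum_B (a b : nat -> C) : decays a -> decays b ->
  csum (fun n => a n - b n) = csum a - csum b.
Proof.
move=> ha hb; rewrite -[- csum b]mulN1r -csum_Z// -csum_D//; last exact: decaysZ.
by apply: eq_csum => n; rewrite mulN1r.
Qed.

(** All terms share the radius [dl], so the remainders add up and their constants have sum at most
    [Mt]. *)
Lemma qdiff_csum (h : nat -> C -> C) z (d : nat -> C) (M : nat -> R) (Mt dl : R) :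
  0 <= dl -> (forall k, qdiff (h k) z (d k) (M k) dl) ->
  (forall n, \sum_(k < n) M k <= Mt) ->
  (forall e, cnorm e <= dl -> decays (fun k => h k (z + e))) -> decays d ->
  qdiff (fun y => csum (fun k => h k y)) z (csum d) Mt dl.
Proof.
move=> dl0 hd hM hdec ddec e edl.
have hz : decays (fun k => h k z).
  by have := hdec 0; rewrite cnorm0 addr0 => /(_ dl0).
rewrite -csum_Z// -csum_B//; last exact: hdec.
rewrite -csum_B//; last 2 first.
- by apply: decaysB => //; exact: hdec.
- exact: decaysZ.
apply: csum_le => n; apply: (@le_trans _ _ (\sum_(k < n) M k * cnorm e ^+ 2)).
  by apply: ler_sum => k _; exact: hd.
by rewrite -mulr_suml ler_wpM2r// exprn_ge0// cnorm_ge0.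
Qed.

Lemma qdiff_csum2 (h : nat -> nat -> C -> C) z (d A : nat -> nat -> C) (dl : R) :
  0 <= dl -> (forall n b, qdiff (h n b) z (d n b) (cnorm (A n b)) dl) ->
  decays2 A ->
  (forall e, cnorm e <= dl -> decays2 (fun n b => h n b (z + e))) -> decays2 d ->
  exists M, qdiff (fun y => csum2 (fun n b => h n b y)) z (csum2 d) M dl.
Proof.
move=> dl0 hd [K [t [K0 t01 hA]]] hdec ddec; have /andP[t0 t1] := t01.
have s0 : 0 <= (1 - t)^-1 by rewrite invr_ge0 subr_ge0 ltW.
exists (K * (1 - t)^-1 * (1 - t)^-1).
apply: (@qdiff_csum (fun b y => csum (fun n => h n b y)) z
  (fun b => csum (fun n => d n b)) (fun b => K * (1 - t)^-1 * t ^+ b)) => //.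
- move=> b; apply: (@qdiff_csum (fun n y => h n b y) z (fun n => d n b)
    (fun n => cnorm (A n b))) => //.
  + move=> n; apply: (@le_trans _ _ (\sum_(k < n) K * t ^+ b * t ^+ k)).
      by apply: ler_sum => k _; rewrite mulrAC.
    by rewrite -mulr_sumr [leRHS]mulrAC ler_wpM2l ?mulr_ge0 ?exprn_ge0// geometric_sum_le.
  + by move=> e /hdec; exact: decays2_row.
  + exact: decays2_row.
- by move=> n; rewrite -mulr_sumr ler_wpM2l ?mulr_ge0// geometric_sum_le.
- by move=> e /hdec; exact: decays_csum.
- exact: decays_csum.
Qed.

(** The remainder of order m + 1 is (z + e) times that of order m, plus e^2 m z^(m-1); the induction
    closes because m^2 + m <= (m + 1)^2. The factor r^2 stands on the left to avoid the exponent m -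
    2. *)
Lemma power_remainder z (e : C) (r : R) m : cnorm z + cnorm e <= r ->
  cnorm ((z + e) ^+ m - z ^+ m - e * (m%:R * z ^+ m.-1)) * r ^+ 2 <=
  cnorm e ^+ 2 * (m%:R ^+ 2 * r ^+ m).
Proof.
move=> zer; have ze : cnorm (z + e) <= r by exact: le_trans (cnormD _ _) zer.
have zr : cnorm z <= r by rewrite (le_trans _ zer)// lerDl cnorm_ge0.
have r0 : 0 <= r by exact: le_trans (cnorm_ge0 z) zr.
elim: m => [|m IH]; first by rewrite !expr0 subrr mul0r mulr0 subr0 cnorm0 expr0n /= !mul0r mulr0.
have -> : (z + e) ^+ m.+1 - z ^+ m.+1 - e * (m.+1%:R * z ^+ m) =
    (z + e) * ((z + e) ^+ m - z ^+ m - e * (m%:R * z ^+ m.-1)) + e ^+ 2 * (m%:R * z ^+ m.-1).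
  have zm : z * (m%:R * z ^+ m.-1) = m%:R * z ^+ m.
    by case: m {IH} => [|m]; rewrite ?mul0r ?mulr0// mulrCA -exprS.
  transitivity ((z + e) * ((z + e) ^+ m - z ^+ m) - e * (z * (m%:R * z ^+ m.-1))).
    by rewrite zm !exprS -natr1; ring.
  by ring.
rewrite (le_trans (ler_wpM2r _ (cnormD _ _))) ?exprn_ge0// mulrDl.
apply: (@le_trans _ _ (r * (cnorm e ^+ 2 * (m%:R ^+ 2 * r ^+ m)) + cnorm e ^+ 2 * (m%:R * r ^+ m.+1))).
  apply: lerD.
    by rewrite cnormM -mulrA ler_pM ?cnorm_ge0 ?mulr_ge0 ?exprn_ge0 ?cnorm_ge0.
  rewrite cnormM cnormX cnormM cnorm_natr cnormX -mulrA.
  apply: ler_wpM2l; first by rewrite exprn_ge0 ?cnorm_ge0.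
  case: m {IH} => [|m]; first by rewrite !mul0r.
  rewrite -mulrA; apply: ler_wpM2l => //=.
  rewrite (_ : r ^+ m.+2 = r ^+ m * r ^+ 2); last by rewrite -exprD addn2.
  by apply: ler_wpM2r; rewrite ?exprn_ge0// lerXn2r ?nnegrE ?cnorm_ge0.
rewrite [r ^+ m.+1]exprS -natr1.
have -> : r * (cnorm e ^+ 2 * (m%:R ^+ 2 * r ^+ m)) + cnorm e ^+ 2 * (m%:R * (r * r ^+ m)) =
  cnorm e ^+ 2 * r ^+ m * r * (m%:R ^+ 2 + m%:R) by ring.
have -> : cnorm e ^+ 2 * ((m%:R + 1) ^+ 2 * (r * r ^+ m)) =
  cnorm e ^+ 2 * r ^+ m * r * (m%:R + 1) ^+ 2 by ring.
rewrite ler_wpM2l ?mulr_ge0 ?exprn_ge0 ?cnorm_ge0//.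
have : 0 <= m%:R :> R by []. nra.
Qed.

Lemma decays2_le (a b : nat -> nat -> C) : (forall n m, cnorm (a n m) <= cnorm (b n m)) ->
  decays2 b -> decays2 a.
Proof.
move=> ab [K [t [K0 t01 h]]]; exists K, t; split => // n m.
exact: le_trans (ab n m) (h n m).
Qed.

Lemma decays2_exponent (m : nat -> nat -> nat) (a : nat -> nat -> C) :
  (forall n b, m n b <= n + b)%N -> decays2 a -> decays2 (fun n b => (m n b)%:R * a n b).
Proof.
move=> mnb ha; apply: (@decays2_le _ (fun n b => (n + b)%:R * a n b)).
  move=> n b; rewrite !cnormM !cnorm_natr ler_wpM2r ?cnorm_ge0// ler_nat; exact: mnb.
have := decays2D (decays2_natr_n ha) (decays2_natr_b ha); congr decays2.
by apply/funext => n; apply/funext => b; rewrite natrD mulrDl.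
Qed.

Lemma decays2_power_derivative (m : nat -> nat -> nat) (a : nat -> nat -> C) z (dl : R) :
  (forall n b, m n b <= n + b)%N -> 0 < dl ->
  decays2 (fun n b => a n b * ((cnorm z + dl)%:C : C) ^+ m n b) ->
  decays2 (fun n b => a n b * ((m n b)%:R * z ^+ (m n b).-1)).
Proof.
move=> mnb dl0; set r := cnorm z + dl => ha.
have r0 : 0 < r by rewrite ltr_wpDl ?cnorm_ge0.
have nr k : cnorm ((r%:C : C) ^+ k) = r ^+ k by rewrite cnormX cnorm_real ger0_norm// ltW.
have dm := decays2_exponent mnb ha.
apply: decays2_le (decays2Z ((r^-1)%:C : C) dm) => n b.
rewrite !cnormM cnorm_natr cnormX nr cnorm_real ger0_norm ?invr_ge0 ?(ltW r0)//.
rewrite (_ : r^-1 * _ = cnorm (a n b) * ((m n b)%:R * (r ^+ m n b / r))); last by ring.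
rewrite ler_wpM2l ?cnorm_ge0//; case: (m n b) => [|k]; first by rewrite !mul0r.
rewrite ler_wpM2l// exprSr mulfK ?gt_eqF// lerXn2r ?nnegrE ?cnorm_ge0 ?(ltW r0)//.
by rewrite lerDl ltW.
Qed.

(** The terms still decay at radius |z| + dl, so the constants m^2 |a| r^(m-2) of [power_remainder]
    are summable. The exponent function serves three cases: n for the derivative at u = q, n + b
    along (u, u v), and b in the last variable. *)
Lemma qdiff_power_series (m : nat -> nat -> nat) (a : nat -> nat -> C) z (dl : R) :
  (forall n b, m n b <= n + b)%N -> 0 < dl ->
  decays2 (fun n b => a n b * ((cnorm z + dl)%:C : C) ^+ m n b) ->
  exists M, qdiff (fun y => csum2 (fun n b => a n b * y ^+ m n b)) z
    (csum2 (fun n b => a n b * ((m n b)%:R * z ^+ (m n b).-1))) M dl.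
Proof.
move=> mnb dl0; set r := cnorm z + dl => ha.
have r0 : 0 < r by rewrite ltr_wpDl ?cnorm_ge0.
have nr k : cnorm ((r%:C : C) ^+ k) = r ^+ k by rewrite cnormX cnorm_real ger0_norm// ltW.
pose c : C := ((r ^- 2)%:C : C).
have nc : cnorm c = r ^- 2 by rewrite cnorm_real ger0_norm// invr_ge0 exprn_ge0// ltW.
have dm := decays2_exponent mnb ha.
apply: (@qdiff_csum2 (fun n b y => a n b * y ^+ m n b) z _
  (fun n b => c * ((m n b)%:R * ((m n b)%:R * (a n b * (r%:C : C) ^+ m n b))))) => //.
- exact: ltW.
- move=> n b e edl.
  have -> : a n b * (z + e) ^+ m n b - a n b * z ^+ m n b -
      e * (a n b * ((m n b)%:R * z ^+ (m n b).-1)) =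
    a n b * ((z + e) ^+ m n b - z ^+ m n b - e * ((m n b)%:R * z ^+ (m n b).-1)) by ring.
  have zer : cnorm z + cnorm e <= r by rewrite lerD2l.
  have h := power_remainder (m n b) zer.
  rewrite !cnormM nc !cnorm_natr nr.
  rewrite (_ : r ^- 2 * _ * _ = cnorm (a n b) * (cnorm e ^+ 2 * ((m n b)%:R ^+ 2 * r ^+ m n b) / r ^+ 2)); last first.
    by ring.
  by rewrite ler_wpM2l ?cnorm_ge0// ler_pdivlMr// exprn_gt0.
- by apply: decays2Z; exact: decays2_exponent.
- move=> e edl; apply: decays2_le ha => n b.
  rewrite !cnormM nr cnormX ler_wpM2l ?cnorm_ge0// lerXn2r ?nnegrE ?cnorm_ge0 ?(ltW r0)//.
  by rewrite (le_trans (cnormD _ _))// lerD2l.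
- exact: (decays2_power_derivative mnb dl0 ha).
Qed.

End differentiation.

(** * The differential equation for the generating functions *)

Section generating_functions.
Context (R : realType).
Local Notation C := (cplx R).
Local Notation "x %:K" := ((x%:C)%C : C) (at level 1, left associativity, only parsing).

Lemma csum0 : csum (fun=> 0 : C) = 0.
Proof.
apply: csumE; rewrite (_ : series _ = cst 0); first exact: cvg_cst.
by apply/funext => n; rewrite /series /= big1.
Qed.

Lemma decays2_monomial (c : nat -> nat -> C) (K : R) (z w : C) : 0 <= K ->
  (forall n b, cnorm (c n b) <= K) -> cnorm z < 1 -> cnorm w < 1 ->
  decays2 (fun n b => c n b * (z ^+ n * w ^+ b)).
Proof.
move=> K0 cK z1 w1; pose m := Num.max (cnorm z) (cnorm w).
have m0 : 0 <= m by rewrite le_max cnorm_ge0.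
have zm n : cnorm z ^+ n <= m ^+ n by rewrite lerXn2r ?nnegrE ?cnorm_ge0// le_max lexx.
have wm n : cnorm w ^+ n <= m ^+ n by rewrite lerXn2r ?nnegrE ?cnorm_ge0// le_max lexx orbT.
exists K, m; split => //; first by rewrite m0 gt_max z1.
move=> n b; rewrite !cnormM !cnormX mulrA ler_pM ?mulr_ge0 ?exprn_ge0 ?cnorm_ge0//.
by rewrite ler_pM ?exprn_ge0 ?cnorm_ge0.
Qed.

(* If f_n = \sum_m q^m e_{n+m+1}, then the generating functions satisfy
   (z - q) F(z) = E(z) - E(q). *)
Lemma csum2_divided_difference (e f : nat -> nat -> C) (Q z w : C) :
  (forall n b, e n.+1 b = f n b - Q * f n.+1 b) ->
  decays2 (fun n b => e n b * (z ^+ n * w ^+ b)) ->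
  decays2 (fun n b => f n b * (z ^+ n * w ^+ b)) ->
  csum2 (fun n b => e n b * (z ^+ n * w ^+ b)) =
  (z - Q) * csum2 (fun n b => f n b * (z ^+ n * w ^+ b)) +
  csum (fun b => (e 0%N b + Q * f 0%N b) * w ^+ b).
Proof.
move=> ef de df.
have cf : decays (fun b => f 0%N b * w ^+ b).
  by have := decays2_col 0 df; congr decays; apply/funext => b; rewrite expr0 mul1r.
have ce : decays (fun b => e 0%N b * w ^+ b).
  by have := decays2_col 0 de; congr decays; apply/funext => b; rewrite expr0 mul1r.
have Fs := csum2Sn df.
rewrite (@eq_csum _ (fun m => f 0%N m * (z ^+ 0 * w ^+ m)) (fun b => f 0%N b * w ^+ b)) in Fs; last first.
  by move=> b; rewrite expr0 mul1r.
rewrite (csum2Sn de) (@eq_csum _ _ (fun b => e 0%N b * w ^+ b)); last first.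
  by move=> b; rewrite expr0 mul1r.
rewrite (@eq_csum2 _ (fun n m => e n.+1 m * (z ^+ n.+1 * w ^+ m))
  (fun n b => z * (f n b * (z ^+ n * w ^+ b)) + (- Q) * (f n.+1 b * (z ^+ n.+1 * w ^+ b)))); last first.
  by move=> n b; rewrite ef exprS; ring.
rewrite csum2D ?csum2Z//; last 3 first.
- exact: (decays2Sn df).
- exact: decays2Z.
- by apply: decays2Z; exact: (decays2Sn df).
rewrite (@eq_csum _ (fun b => (e 0%N b + Q * f 0%N b) * w ^+ b)
  (fun b => e 0%N b * w ^+ b + Q * (f 0%N b * w ^+ b))); last first.
  by move=> b; rewrite mulrDl mulrA.
rewrite csum_D//; last exact: decaysZ.
rewrite csum_Z// Fs; ring.
Qed.

Section cauchy_data.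
Variables (z w : C).
Hypotheses (z1 : cnorm z < 1) (w1 : cnorm w < 1).

(** This is z d/dz applied to E(z) = (z - Q) F(z) + E(Q), carried out on coefficients. *)
Lemma csum2_weight_n (e f : nat -> nat -> C) (Q : C) :
  (forall n b, e n.+1 b = f n b - Q * f n.+1 b) ->
  decays2 (fun n b => e n b * (z ^+ n * w ^+ b)) ->
  decays2 (fun n b => f n b * (z ^+ n * w ^+ b)) ->
  csum2 (fun n b => n%:R * (e n b * (z ^+ n * w ^+ b))) =
  (z - Q) * csum2 (fun n b => n%:R * (f n b * (z ^+ n * w ^+ b))) +
  z * csum2 (fun n b => f n b * (z ^+ n * w ^+ b)).
Proof.
move=> ef de df.
have dne := decays2_natr_n de; have dnf := decays2_natr_n df.
have zero (a : nat -> C) : csum (fun m => 0%:R * a m) = 0.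
  by rewrite (@eq_csum _ _ (fun=> 0)) ?csum0// => m; rewrite mul0r.
have Fn := csum2Sn dnf; rewrite zero add0r in Fn.
rewrite (csum2Sn dne) zero add0r.
rewrite (@eq_csum2 _ _ (fun n b => z * (n%:R * (f n b * (z ^+ n * w ^+ b)) + f n b * (z ^+ n * w ^+ b))
   + (- Q) * (n.+1%:R * (f n.+1 b * (z ^+ n.+1 * w ^+ b))))); last first.
  by move=> n b; rewrite ef exprS -natr1; ring.
rewrite csum2D ?csum2Z ?csum2D -?Fn//; first by ring.
- exact: (decays2Sn dnf).
- exact: decays2D.
- by apply: decays2Z; exact: decays2D.
- by apply: decays2Z; exact: (decays2Sn dnf).
Qed.

Definition bounded2 (c : nat -> nat -> C) :=
  exists2 K : R, 0 <= K & forall n b, cnorm (c n b) <= K.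

Lemma bounded2_decays2 c : bounded2 c -> decays2 (fun n b => c n b * (z ^+ n * w ^+ b)).
Proof. by move=> [K K0 cK]; exact: decays2_monomial K0 cK z1 w1. Qed.

Lemma csum2_shift_n (e : nat -> nat -> C) : bounded2 e ->
  csum2 (fun n b => n%:R * (e n.-1 b * (z ^+ n * w ^+ b))) =
  z * (csum2 (fun n b => n%:R * (e n b * (z ^+ n * w ^+ b))) +
       csum2 (fun n b => e n b * (z ^+ n * w ^+ b))).
Proof.
move=> be; have de := bounded2_decays2 be; have dne := decays2_natr_n de.
have dne' : decays2 (fun n b => n%:R * (e n.-1 b * (z ^+ n * w ^+ b))).
  apply: decays2_natr_n; apply: bounded2_decays2.
  by case: be => K K0 h; exists K.
rewrite (csum2Sn dne') (@eq_csum _ _ (fun=> 0)) ?csum0 ?add0r; last by move=> m; rewrite mul0r.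
rewrite -csum2D// -csum2Z; last exact: decays2D.
by apply: eq_csum2 => n b /=; rewrite exprS -natr1; ring.
Qed.

Lemma csum2_shift_b (e : nat -> nat -> C) : bounded2 e ->
  csum2 (fun n b => b%:R * (e n b.-1 * (z ^+ n * w ^+ b))) =
  w * (csum2 (fun n b => b%:R * (e n b * (z ^+ n * w ^+ b))) +
       csum2 (fun n b => e n b * (z ^+ n * w ^+ b))).
Proof.
move=> be; have de := bounded2_decays2 be; have dbe := decays2_natr_b de.
have dbe' : decays2 (fun n b => b%:R * (e n b.-1 * (z ^+ n * w ^+ b))).
  apply: decays2_natr_b; apply: bounded2_decays2.
  by case: be => K K0 h; exists K.
rewrite (csum2Sb dbe') (@eq_csum _ _ (fun=> 0)) ?csum0 ?add0r; last by move=> m; rewrite mul0r.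
rewrite -csum2D// -csum2Z; last exact: decays2D.
by apply: eq_csum2 => n b /=; rewrite exprS -natr1; ring.
Qed.

Let neq1 (y : C) : cnorm y < 1 -> 1 - y != 0.
Proof.
by move=> y1; rewrite subr_eq0; apply: contraTneq y1 => <-; rewrite cnorm1 ltxx.
Qed.

Lemma csum_geometric (y : C) : cnorm y < 1 -> csum (fun n => y ^+ n) = (1 - y)^-1.
Proof.
move=> y1; have dy := decays_geometric y1; have := csum_S dy.
rewrite expr0 (@eq_csum _ (fun n => y ^+ n.+1) (fun n => y * y ^+ n)); last first.
  by move=> n; rewrite exprS.
rewrite csum_Z//; set S := csum _ => h.
have h2 : (1 - y) * S = 1 by rewrite mulrBl mul1r {1}h addrK.
by apply: (mulfI (neq1 y1)); rewrite h2 divff// neq1.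
Qed.

Lemma decays2_source :
  decays2 (fun n b => if b == 0%N then 0 else (n + b)%:R * (z ^+ n * w ^+ b)).
Proof.
have b1 : bounded2 (fun _ _ => 1 : C) by exists 1 => // n b; rewrite cnorm1.
have d1 := bounded2_decays2 b1.
apply: decays2_le (decays2D (decays2_natr_n d1) (decays2_natr_b d1)) => n b.
case: eqP => _; first by rewrite cnorm0 cnorm_ge0.
by rewrite -mulrDl -natrD mul1r.
Qed.

(** The first term of L. It starts at b = 1, where the recurrence begins; shifting b extracts the
    factor w. The weighted sums come from the shift identities for the constant sequence 1, solved
    for the unknown sum. *)
Lemma csum2_source :
  csum2 (fun n b => if b == 0%N then 0 else (n + b)%:R * (z ^+ n * w ^+ b)) =
  w * (1 - z * w) / ((1 - z) ^+ 2 * (1 - w) ^+ 2).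
Proof.
have b1 : bounded2 (fun _ _ => 1 : C) by exists 1 => // n b; rewrite cnorm1.
have d1 := bounded2_decays2 b1.
have dn := decays2_natr_n d1; have db := decays2_natr_b d1.
have UE : csum2 (fun n b => 1 * (z ^+ n * w ^+ b)) = ((1 - z) * (1 - w))^-1.
  have := csum2Sn d1; rewrite (@eq_csum _ _ (fun b => w ^+ b)); last first.
    by move=> b; rewrite expr0 !mul1r.
  rewrite csum_geometric// (@eq_csum2 _ (fun n m => 1 * (z ^+ n.+1 * w ^+ m))
    (fun n m => z * (1 * (z ^+ n * w ^+ m)))); last by move=> n b; rewrite exprS; ring.
  rewrite (csum2Z z d1); set U := csum2 (fun n b => 1 * (z ^+ n * w ^+ b)) => h.
  have h2 : (1 - z) * U = (1 - w)^-1 by rewrite mulrBl mul1r {1}h addrK.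
  by rewrite invfM -h2 mulrA mulVf ?mul1r// neq1.
rewrite (csum2Sb decays2_source) (@eq_csum _ _ (fun=> 0)) ?csum0 ?add0r//.
rewrite (@eq_csum2 _ _ (fun n b => w * (n%:R * (1 * (z ^+ n * w ^+ b)) +
    (b%:R * (1 * (z ^+ n * w ^+ b)) + 1 * (z ^+ n * w ^+ b))))); last first.
  by move=> n b /=; rewrite exprS natrD -natr1; ring.
rewrite (csum2Z w); last by apply: decays2D => //; exact: decays2D.
rewrite csum2D//; last exact: decays2D.
rewrite csum2D//.
have := csum2_shift_n b1; have := csum2_shift_b b1.
set U := csum2 (fun n b => 1 * (z ^+ n * w ^+ b)) in UE *.
set Ub := csum2 (fun n b => b%:R * (1 * (z ^+ n * w ^+ b))).
set Un := csum2 (fun n b => n%:R * (1 * (z ^+ n * w ^+ b))) => hb hn.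
have -> : Ub = w * U / (1 - w).
  have <- : (1 - w) * Ub = w * U by rewrite mulrBl mul1r {1}hb; ring.
  by rewrite mulrC mulKf// neq1.
have -> : Un = z * U / (1 - z).
  have <- : (1 - z) * Un = z * U by rewrite mulrBl mul1r {1}hn; ring.
  by rewrite mulrC mulKf// neq1.
by rewrite UE; field; rewrite !neq1.
Qed.

End cauchy_data.

Lemma qdiff_congr (h h' : C -> C) z d M dl :
  (forall e, cnorm e <= dl -> h (z + e) = h' (z + e)) -> 0 <= dl ->
  qdiff h' z d M dl -> qdiff h z d M dl.
Proof.
move=> hh dl0 hd e edl.
have hz : h z = h' z by have := hh 0; rewrite addr0 cnorm0; exact.
by rewrite hh// hz; exact: hd.
Qed.

Lemma ball_subunit z : cnorm z < 1 -> exists2 dl : R, 0 < dl & cnorm z + dl < 1.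
Proof.
by move=> z1; exists ((1 - cnorm z) / 2); lra.
Qed.

(** * From the recurrence to the equation for Phi *)

Section pde.
Variables (Enb : nat -> nat -> R -> R) (rho q s : R).
Variables (e f : nat -> nat -> R).
Hypotheses (q0 : 0 <= q) (q1 : q < 1).
Hypothesis EstarE : forall z w, cnorm z < 1 -> cnorm w < 1 ->
  Estar Enb s z w = csum2 (fun n b => (e n b)%:K * (z ^+ n * w ^+ b)).
Hypotheses (be : bounded2 (fun n b => (e n b)%:K)) (bf : bounded2 (fun n b => (f n b)%:K)).
Hypothesis ef : forall n b, e n.+1 b = f n b - q * f n.+1 b.
Hypotheses (e0 : forall n, e n 0 = 0) (f0 : forall n, f n 0 = 0).
Hypothesis rec : forall n b, (0 < b)%N ->
  (s + 1 + rho) * (n + b)%:R * e n b =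
  (n + b)%:R + n%:R * e n.-1 b + b%:R * e n b.-1 + rho * (1 - q) * (n + b)%:R * f n b.

Let eC n b : C := (e n b)%:K.
Let fC n b : C := (f n b)%:K.
Let Q : C := q%:K.

Let efC n b : eC n.+1 b = fC n b - Q * fC n.+1 b.
Proof. by rewrite /eC ef rmorphB rmorphM. Qed.

Let Q1 : cnorm Q < 1. Proof. by rewrite cnorm_real ger0_norm. Qed.

Definition quotient_gf (z w : C) : C := csum2 (fun n b => fC n b * (z ^+ n * w ^+ b)).

(** What the divided difference leaves, namely E*(s, q, w), as [EstarQ] confirms. *)
Let slice (w : C) : C := csum (fun b => (eC 0%N b + Q * fC 0%N b) * w ^+ b).

Let EstarF z w : cnorm z < 1 -> cnorm w < 1 ->
  Estar Enb s z w = (z - Q) * quotient_gf z w + slice w.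
Proof.
move=> z1 w1; rewrite EstarE// (csum2_divided_difference efC)//.
- exact: bounded2_decays2.
- exact: bounded2_decays2.
Qed.

Let EstarQ w : cnorm w < 1 -> Estar Enb s Q w = slice w.
Proof. by move=> w1; rewrite EstarF// subrr mul0r add0r. Qed.

Let qdiff_derivable (h : C -> C) z d M dl : 0 < dl -> qdiff h z d M dl ->
  derivable h z 1 /\ derive1 h z = d.
Proof.
move=> dl0 /(qdiff_is_derive dl0) hd; split; first exact: ex_derive.
by rewrite derive1E; exact: derive_val.
Qed.

(** Both branches of [Fstar] are one power series: for z different from q by division, and at q
    because (z - Q) F(z) has derivative F(Q) there. *)
Lemma FstarE z w : cnorm z < 1 -> cnorm w < 1 -> Fstar Enb q s z w = quotient_gf z w.
Proof.
move=> z1 w1; rewrite /Fstar; case: eqP => [->|/eqP zq]; last first.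
  by rewrite EstarF// EstarQ// addrK mulrC mulKf// subr_eq0.
have [dl dl0 Qdl] := ball_subunit Q1.
have dF : decays2 (fun n b => fC n b * w ^+ b * ((cnorm Q + dl)%:C : C) ^+ n).
  have rdl : cnorm ((cnorm Q + dl)%:C : C) < 1.
    by rewrite cnorm_real ger0_norm// addr_ge0 ?cnorm_ge0// ltW.
  have := bounded2_decays2 rdl w1 bf; congr decays2.
  by apply/funext => n; apply/funext => b; rewrite -mulrA [w ^+ b * _]mulrC.
have [M hM] := @qdiff_power_series R (fun n _ => n) (fun n b => fC n b * w ^+ b) Q dl
  (fun n b => leq_addr b n) dl0 dF.
set dF' := csum2 _ in hM.
have FE y : csum2 (fun n b => fC n b * w ^+ b * y ^+ n) = quotient_gf y w.
  by apply: eq_csum2 => n b; rewrite -mulrA [w ^+ b * _]mulrC.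
(* The remainder is a (F(Q + a) - F(Q)), and the increment of F is at most |a| |F'(Q)| + |M| |a|^2;
   with |a| <= dl this gives the constant. *)
have hE : qdiff (fun y => Estar Enb s y w) Q (quotient_gf Q w) (cnorm dF' + `|M| * dl) dl.
  move=> a adl.
  have Qa1 : cnorm (Q + a) < 1.
    by rewrite (le_lt_trans (cnormD _ _))// (le_lt_trans _ Qdl)// lerD2l.
  rewrite EstarF// EstarQ//.
  have alg (x y t k : C) : (k + a - k) * x + t - t - a * y = a * (x - y) by ring.
  rewrite alg.
  have := hM a adl; rewrite !FE => h.
  rewrite cnormM expr2 mulrCA ler_wpM2l ?cnorm_ge0//.
  rewrite -[X in cnorm X](subrK (a * dF')) (le_trans (cnormD _ _))// mulrDl addrC lerD//.
    by rewrite cnormM mulrC.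
  apply: (le_trans h); rewrite expr2 mulrA -[leRHS]mulrA.
  apply: (@le_trans _ _ (`|M| * cnorm a * cnorm a)).
    by rewrite ler_wpM2r ?cnorm_ge0// ler_wpM2r ?cnorm_ge0// ler_norm.
  by rewrite -mulrA ler_wpM2l// ler_wpM2r ?cnorm_ge0.
by have [_] := qdiff_derivable dl0 hE.
Qed.

Let qdiff_mul_const (c0 c1 c2 : C) z (dl : R) :
  qdiff (fun y => c2 * y ^+ 2 + c1 * y + c0) z (c2 * (2%:R * z) + c1) (cnorm c2) dl.
Proof.
move=> a _; rewrite (_ : _ - _ - _ = c2 * a ^+ 2); last by ring.
by rewrite cnormM cnormX.
Qed.

(** [N] and [B] are the series of F* weighted by n and b, [En] and [Eb] those of E*, [E0] the
    unweighted one; [l] and [g1] are the parts left at u = q, and [L0] is the rational source.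
    Eliminating [L0], then [N], [B] and [g1], leaves a relation between derivatives. *)
Let pde_algebra (u v A r p D1 D2 D3 N B F En Eb E0 l L0 g1 : C) :
  u != 0 -> p != 0 -> u * D1 = N + B -> v * D2 = B -> u * v * D3 = g1 ->
  p = u ^+ 2 - (A + Q) * u + (A * Q + r * (1 - Q)) ->
  E0 = (u - Q) * F + l -> En = (u - Q) * N + u * F -> Eb = (u - Q) * B + g1 ->
  A * (En + Eb) = L0 + u * (En + E0) + u * v * (Eb + E0) + r * (1 - Q) * (N + B) ->
  p * (1 - v) * D1 + F * ((1 - v) * (2%:R * u) - (A + Q) * (1 - v))
  - (u - Q) / p * v * (1 - v) * (p * (1 - v) * D2 + F * (- p))
  + (1 - v) * ((L0 + (u + u * v) * l + u * v * (u * v - A) * D3) / u) = 0.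
Proof.
clear; move: Q => k un0 p0 uD1 vD2 wD3 pE -> -> -> h.
have h2 : L0 = A * ((u - k) * N + u * F + ((u - k) * B + g1))
   - u * ((u - k) * N + u * F + ((u - k) * F + l))
   - u * v * ((u - k) * B + g1 + ((u - k) * F + l)) - r * (1 - k) * (N + B).
  by rewrite h; ring.
apply: (mulfI un0); rewrite mulr0 h2.
have -> : N = u * D1 - B by rewrite uD1 addrK.
rewrite -vD2 -wD3.
(* After the eliminations the left side is a multiple of p minus the polynomial defining it. *)
transitivity ((1 - v) * (p - (u ^+ 2 - (A + k) * u + (A * k + r * (1 - k)))) * (u * D1)).
  by field; rewrite un0.
by rewrite -pE subrr mulr0 mul0r.
Qed.

(** [derive1] is a total operator, so the conclusion also records that both partial derivatives of
    Phi exist. *)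
Theorem generating_function_pde (u v : C) : 0 < cnorm u -> cnorm u < 1 -> cnorm v < 1 ->
  Ppoly rho q s u != 0 ->
  [/\ derivable (fun z : C => Phi Enb rho q s z v) u 1,
      derivable (fun z : C => Phi Enb rho q s u z) v 1 &
      derive1 (fun z : C => Phi Enb rho q s z v) u
      - (u - q%:K) / Ppoly rho q s u * v * (1 - v)
        * derive1 (fun z : C => Phi Enb rho q s u z) v
      + ell Enb rho q s u v = 0].
Proof.
move=> u0 u1 v1 P0.
pose w := u * v.
have w1 : cnorm w < 1.
  by rewrite cnormM (le_lt_trans _ u1)// ler_piMr ?cnorm_ge0// ltW.
have un0 : u != 0 by apply: contraTneq u0 => ->; rewrite cnorm0 ltxx.
pose F0 := quotient_gf u w.
pose Fn := csum2 (fun n b => n%:R * (fC n b * (u ^+ n * w ^+ b))).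
pose Fb := csum2 (fun n b => b%:R * (fC n b * (u ^+ n * w ^+ b))).
have df : decays2 (fun n b => fC n b * (u ^+ n * w ^+ b)) by exact: bounded2_decays2.
have de : decays2 (fun n b => eC n b * (u ^+ n * w ^+ b)) by exact: bounded2_decays2.
have dnf := decays2_natr_n df; have dbf := decays2_natr_b df.
have dne := decays2_natr_n de; have dbe := decays2_natr_b de.
have mulpred (y : C) n : y * (n%:R * y ^+ n.-1) = n%:R * y ^+ n.
  by case: n => [|n]; rewrite ?mul0r ?mulr0// mulrCA -exprS.
(* Along (z, z v) the monomial is z^(n + b) v^b, so that u times the derivative collects the full
   weight n + b. *)
have [D1 uD1 HU] : exists2 D1, u * D1 = Fn + Fb &
    is_derive u 1 (fun z => Fstar Enb q s z (z * v)) D1.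
  have [dl dl0 udl] := ball_subunit u1.
  have rdl : cnorm ((cnorm u + dl)%:C : C) < 1.
    by rewrite cnorm_real ger0_norm// addr_ge0 ?cnorm_ge0// ltW.
  have rv1 : cnorm (((cnorm u + dl)%:C : C) * v) < 1.
    by rewrite cnormM (le_lt_trans _ rdl)// ler_piMr ?cnorm_ge0// ltW.
  have dF : decays2 (fun n b => fC n b * v ^+ b * ((cnorm u + dl)%:C : C) ^+ (n + b)).
    have := bounded2_decays2 rdl rv1 bf; congr decays2.
    by apply/funext => n; apply/funext => b; rewrite exprMn exprD; ring.
  have [M hM] := @qdiff_power_series R addn (fun n b => fC n b * v ^+ b) u dl
    (fun n b => leqnn _) dl0 dF.
  have dD := @decays2_power_derivative R addn (fun n b => fC n b * v ^+ b) u dl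
    (fun n b => leqnn _) dl0 dF.
  set D1 := csum2 (fun n b => _ * (_ * _)) in hM.
  exists D1.
    rewrite -csum2Z// -csum2D//; apply: eq_csum2 => n b.
    rewrite mulrCA mulpred natrD exprD exprMn; ring.
  apply: (qdiff_is_derive dl0); apply: qdiff_congr hM; last exact: ltW.
  move=> a adl.
  have ua1 : cnorm (u + a) < 1.
    by rewrite (le_lt_trans (cnormD _ _))// (le_lt_trans _ udl)// lerD2l.
  rewrite FstarE//; last first.
    by rewrite cnormM (le_lt_trans _ ua1)// ler_piMr ?cnorm_ge0// ltW.
  by apply: eq_csum2 => n b; rewrite exprMn exprD; ring.
have [D2 vD2 HV] : exists2 D2, v * D2 = Fb &
    is_derive v 1 (fun z => Fstar Enb q s u (u * z)) D2.
  have [dl dl0 vdl] := ball_subunit v1.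
  have rdl : cnorm ((cnorm v + dl)%:C : C) < 1.
    by rewrite cnorm_real ger0_norm// addr_ge0 ?cnorm_ge0// ltW.
  have dF : decays2 (fun n b => fC n b * (u ^+ n * u ^+ b) * ((cnorm v + dl)%:C : C) ^+ b).
    have ru1 : cnorm (u * ((cnorm v + dl)%:C : C)) < 1.
      by rewrite cnormM (le_lt_trans _ u1)// ler_piMr ?cnorm_ge0// ltW.
    have := bounded2_decays2 u1 ru1 bf; congr decays2.
    by apply/funext => n; apply/funext => b; rewrite exprMn; ring.
  have [M hM] := @qdiff_power_series R (fun _ b => b) (fun n b => fC n b * (u ^+ n * u ^+ b)) v dl
    (fun n b => leq_addl _ _) dl0 dF.
  have dD := @decays2_power_derivative R (fun _ b => b) (fun n b => fC n b * (u ^+ n * u ^+ b)) v dl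
    (fun n b => leq_addl _ _) dl0 dF.
  set D2 := csum2 (fun n b => _ * (_ * _)) in hM.
  exists D2.
    rewrite -csum2Z//; apply: eq_csum2 => n b.
    rewrite mulrCA mulpred exprMn; ring.
  apply: (qdiff_is_derive dl0); apply: qdiff_congr hM; last exact: ltW.
  move=> a adl.
  have va1 : cnorm (v + a) < 1.
    by rewrite (le_lt_trans (cnormD _ _))// (le_lt_trans _ vdl)// lerD2l.
  rewrite FstarE//; last first.
    by rewrite cnormM (le_lt_trans _ u1)// ler_piMr ?cnorm_ge0// ltW.
  by apply: eq_csum2 => n b; rewrite exprMn; ring.
pose g1 := csum (fun b => (b%:R * eC 0%N b + Q * (b%:R * fC 0%N b)) * w ^+ b).
(* Multiplying e and f by b preserves the relation between them, so the divided difference applies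
   again; at z = Q it identifies [g1] with w times the derivative of E*(s, q, .) at w. *)
have weighted z : cnorm z < 1 ->
    csum2 (fun n b => b%:R * (eC n b * (z ^+ n * w ^+ b))) =
    (z - Q) * csum2 (fun n b => b%:R * (fC n b * (z ^+ n * w ^+ b))) + g1.
  move=> z1; rewrite (@eq_csum2 _ _ (fun n b => b%:R * eC n b * (z ^+ n * w ^+ b))); last first.
    by move=> n b; rewrite -[RHS]mulrA.
  rewrite (@csum2_divided_difference _ (fun n b => b%:R * fC n b) Q).
  - rewrite (@eq_csum2 _ (fun n b => b%:R * fC n b * (z ^+ n * w ^+ b))
      (fun n b => b%:R * (fC n b * (z ^+ n * w ^+ b))))//.
    by move=> n b; rewrite -mulrA.
  - have alg (x y k c : C) : c * (x - k * y) = c * x - k * (c * y) by ring.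
    by move=> n b; rewrite efC alg.
  - have := decays2_natr_b (bounded2_decays2 z1 w1 be); congr decays2.
    by apply/funext => n; apply/funext => b; rewrite -[RHS]mulrA.
  - have := decays2_natr_b (bounded2_decays2 z1 w1 bf); congr decays2.
    by apply/funext => n; apply/funext => b; rewrite -[RHS]mulrA.
have D3 : w * derive1 (fun z => Estar Enb s Q z) w = g1.
  have [dl dl0 wdl] := ball_subunit w1.
  have rdl : cnorm ((cnorm w + dl)%:C : C) < 1.
    by rewrite cnorm_real ger0_norm// addr_ge0 ?cnorm_ge0// ltW.
  have dF : decays2 (fun n b => eC n b * Q ^+ n * ((cnorm w + dl)%:C : C) ^+ b).
    have := bounded2_decays2 Q1 rdl be; congr decays2.
    by apply/funext => n; apply/funext => b; rewrite mulrA.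
  have [M hM] := @qdiff_power_series R (fun _ b => b) (fun n b => eC n b * Q ^+ n) w dl
    (fun n b => leq_addl _ _) dl0 dF.
  have dD := @decays2_power_derivative R (fun _ b => b) (fun n b => eC n b * Q ^+ n) w dl
    (fun n b => leq_addl _ _) dl0 dF.
  have hE : qdiff (fun y => Estar Enb s Q y) w
      (csum2 (fun n b => eC n b * Q ^+ n * (b%:R * w ^+ b.-1))) M dl.
    apply: qdiff_congr hM; last exact: ltW.
    move=> a adl; rewrite EstarE//; last first.
      by rewrite (le_lt_trans (cnormD _ _))// (le_lt_trans _ wdl)// lerD2l.
    by apply: eq_csum2 => n b; rewrite mulrA.
  have [_ ->] := qdiff_derivable dl0 hE.
  rewrite -csum2Z//; have := weighted Q Q1; rewrite subrr mul0r add0r => <-.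
  apply: eq_csum2 => n b.
  by rewrite mulrCA mulpred mulrCA -[X in _ * X]mulrA.
pose E0 := csum2 (fun n b => eC n b * (u ^+ n * w ^+ b)).
pose En := csum2 (fun n b => n%:R * (eC n b * (u ^+ n * w ^+ b))).
pose Eb := csum2 (fun n b => b%:R * (eC n b * (u ^+ n * w ^+ b))).
have E0E : E0 = (u - Q) * F0 + slice w by exact: csum2_divided_difference.
have EnE : En = (u - Q) * Fn + u * F0 by exact: (csum2_weight_n efC de df).
have EbE : Eb = (u - Q) * Fb + g1 by exact: weighted.
have summed : (s + 1 + rho)%:K * (En + Eb) =
    w * (1 - u * w) / ((1 - u) ^+ 2 * (1 - w) ^+ 2) + u * (En + E0) + w * (Eb + E0)
    + (rho * (1 - q))%:K * (Fn + Fb).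
  have bn : bounded2 (fun n b => eC n.-1 b).
    by case: be => K K0 h; exists K => // n b; exact: h.
  have bb : bounded2 (fun n b => eC n b.-1).
    by case: be => K K0 h; exists K => // n b; exact: h.
  have dsn := decays2_natr_n (bounded2_decays2 u1 w1 bn).
  have dsb := decays2_natr_b (bounded2_decays2 u1 w1 bb).
  have ds := decays2_source u1 w1.
  rewrite -(csum2_source u1 w1) -(csum2_shift_n u1 w1 be) -(csum2_shift_b u1 w1 be).
  rewrite /En /Eb /Fn /Fb -(csum2D dne dbe) -(csum2D dnf dbf).
  rewrite -(csum2Z _ (decays2D dne dbe)) -(csum2Z _ (decays2D dnf dbf)).
  rewrite -(csum2D ds dsn) -(csum2D (decays2D ds dsn) dsb).
  rewrite -(csum2D (decays2D (decays2D ds dsn) dsb) (decays2Z _ (decays2D dnf dbf))).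
  have alg (c a b x m x1 x2 k y : C) :
      c * (a + b) * x = (a + b) + a * x1 + b * x2 + k * (a + b) * y ->
      c * (a * (x * m) + b * (x * m)) =
      (a + b) * m + a * (x1 * m) + b * (x2 * m) + k * (a * (y * m) + b * (y * m)).
    move=> h; transitivity (c * (a + b) * x * m); first by ring.
    by rewrite h; ring.
  (* The recurrence says nothing at b = 0; there both sides vanish by [e0], [f0] and the convention
     in the source term. *)
  apply: eq_csum2 => n [|b].
    by rewrite eqxx /= /eC /fC !e0 f0 !(mul0r, mulr0, addr0).
  rewrite natrD; apply: alg.
  have := rec n (ltn0Sn b) => /(congr1 (fun x : R => (x%:C)%C : C)).
  by rewrite !(rmorphD, rmorphM) /= !rmorph_nat -!natrD.
pose p := Ppoly rho q s u; pose A : C := (s + 1 + rho)%:K; pose r : C := rho%:K.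
have PE z : Ppoly rho q s z = z ^+ 2 - (A + Q) * z + (A * Q + r * (1 - Q)).
  rewrite /Ppoly /A /r /Q !(rmorphD, rmorphM) /=.
  by move: (s%:C) (rho%:C) (q%:C) => S r' k; rewrite rmorph1; ring.
have dPu : is_derive u 1 (fun z : C => Ppoly rho q s z * (1 - v))
    ((1 - v) * (2%:R * u) - (A + Q) * (1 - v)).
  have := @qdiff_mul_const ((A * Q + r * (1 - Q)) * (1 - v)) (- ((A + Q) * (1 - v))) (1 - v) u 1.
  move=> /(qdiff_is_derive ltr01); congr is_derive; apply/funext => z.
  by rewrite PE; move: (A) (Q) (r) => a k r'; ring.
have dPv : is_derive v 1 (fun z : C => p * (1 - z)) (- p).
  have := @qdiff_mul_const p (- p) 0 v 1; rewrite mul0r add0r.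
  move=> /(qdiff_is_derive ltr01); congr is_derive; apply/funext => z.
  by move: (p) => a; ring.
have := is_deriveM dPu HU; rewrite (FstarE u1 w1) => dU.
have := is_deriveM dPv HV; rewrite (FstarE u1 w1) => dV.
split.
- exact: (@ex_derive _ _ _ _ _ _ _ dU).
- exact: (@ex_derive _ _ _ _ _ _ _ dV).
rewrite !derive1E (@derive_val _ _ _ _ _ _ _ dU) (@derive_val _ _ _ _ _ _ _ dV).
rewrite /ell /Lterm EstarQ//.
have rQ : (rho * (1 - q))%:K = r * (1 - Q) :> C by rewrite rmorphM rmorphB rmorph1.
rewrite rQ in summed.
exact: (pde_algebra un0 P0 uD1 vD2 D3 (PE u) E0E EnE EbE summed).
Qed.

End pde.

End generating_functions.

(** * Exchange of the series with the Laplace transform *)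

(** Dominated convergence for the partial sums, all bounded by K / (1 - t) times [g]. *)
Lemma Rintegral_dominated_series (R : realType) d (T : measurableType d)
    (mu : {measure set T -> \bar R}) (D : set T) (a : nat -> T -> R) (f g : T -> R) (K t : R) :
  measurable D -> mu.-integrable D (EFin \o g) -> 0 <= K -> 0 <= t < 1 ->
  (forall n, measurable_fun D (a n)) ->
  (forall n x, D x -> `|a n x| <= K * t ^+ n * g x) ->
  (forall x, D x -> series (a ^~ x) @ \oo --> f x) ->
  measurable_fun D f /\
  series (fun n => \int[mu]_(x in D) a n x) @ \oo --> \int[mu]_(x in D) f x.
Proof.
move=> mD ig K0 t01 ma ag af; have /andP[t0 t1] := t01.
pose S n x := series (a ^~ x) n.
have mS n : measurable_fun D (S n) by apply: measurable_sum.
have mf : measurable_fun D f by exact: (measurable_fun_cvg mS).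
split => //.
pose h := fun x => K / (1 - t) * g x.
have ih : mu.-integrable D (EFin \o h).
  exact: (integrableZl mD _ ig).
have ia n : mu.-integrable D (EFin \o a n).
  apply: (@le_integrable _ _ _ _ _ mD _ (fun x => (K * t ^+ n)%:E * (EFin \o g) x)%E).
  - exact/measurable_EFinP.
  - by move=> x Dx; rewrite /= lee_fin (le_trans (ag n x Dx))// ler_norm.
  - exact: (integrableZl mD _ ig).
have Sh n x : D x -> `|S n x| <= h x.
  move=> Dx; have g0 : 0 <= K * g x.
    by have := ag 0%N x Dx; rewrite expr0 mulr1; apply: le_trans.
  rewrite (le_trans (ler_norm_sum _ _ _))// big_mkord.
  apply: (@le_trans _ _ (\sum_(k < n) K * g x * t ^+ k)).
    by apply: ler_sum => k _; rewrite mulrAC ag.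
  rewrite -mulr_sumr /h [leRHS]mulrAC ler_wpM2l//; exact: geometric_sum_le.
have SE n : (\int[mu]_(x in D) (S n x)%:E)%E =
    (series (fun n => \int[mu]_(x in D) a n x) n)%:E.
  rewrite /S /series /=; under eq_integral do rewrite -sumEFin.
  rewrite integral_sum// -sumEFin; apply: eq_bigr => i _.
  by rewrite /Rintegral fineK//; exact: (integrable_fin_num mD (ia i)).
have ifin : (\int[mu]_(x in D) (f x)%:E)%E \is a fin_num.
  apply: (integrable_fin_num mD).
  apply: (le_integrable mD _ _ ih); first exact/measurable_EFinP.
  move=> x Dx /=; rewrite lee_fin (le_trans _ (ler_norm _))//.
  have cN : `|S n x| @[n --> \oo] --> `|f x| by apply: cvg_norm; exact: af.
  rewrite -(cvg_lim _ cN)//.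
  apply: limr_le; first by apply/cvg_ex; exists `|f x|.
  by apply: nearW => n; exact: Sh.
have := @dominated_cvg _ _ _ mu D mD (fun n x => (S n x)%:E) (EFin \o f) (EFin \o h).
have mSe n : measurable_fun D (fun x => (S n x)%:E) by exact/measurable_EFinP.
move=> /(_ mSe) dc; have {dc} := dc _ _ ih _.
rewrite -(fineK ifin) => /(_ _ _ _)/fine_cvgP[| | |_].
- by move=> x Dx; apply: cvg_EFin; [exact: nearW|exact: af].
- by [].
- by move=> n x Dx; rewrite /= lee_fin; exact: Sh.
by rewrite (_ : fine \o _ = series (fun n => \int[mu]_(x in D) a n x))//;
  apply/funext => n /=; rewrite SE.
Qed.

Section transform_series.
Context (R : realType).
Local Notation C := (cplx R).
Local Notation "x %:K" := ((x%:C)%C : C) (at level 1, left associativity, only parsing).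
Local Notation mu := (@lebesgue_measure R).

(** Used twice, for the sum over n and then over b: the measurability and the bound obtained from
    the first use are the hypotheses of the second. *)
Lemma Cintegral_csum (D : set R) (g : R -> R) (a : nat -> R -> C) (K t : R) :
  measurable D -> mu.-integrable D (EFin \o g) -> 0 <= K -> 0 <= t < 1 ->
  (forall n, measurable_fun D (fun x => complex.Re (a n x)) /\
     measurable_fun D (fun x => complex.Im (a n x))) ->
  (forall n x, D x -> cnorm (a n x) <= K * t ^+ n * g x) ->
  [/\ measurable_fun D (fun x => complex.Re (csum (fun n => a n x))),
      measurable_fun D (fun x => complex.Im (csum (fun n => a n x))),
      (forall x, D x -> cnorm (csum (fun n => a n x)) <= K / (1 - t) * g x) &
      Cintegral D (fun x => csum (fun n => a n x)) = csum (fun n => Cintegral D (a n))].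
Proof.
move=> mD ig K0 t01 ma ag.
have asx x : D x -> asum (fun n => a n x) (K * g x / (1 - t)).
  move=> Dx; apply: geometric_asum => //.
    by have := ag 0%N x Dx; rewrite expr0 mulr1; apply: le_trans; exact: cnorm_ge0.
  by move=> n; rewrite mulrAC ag.
have SRe (b : nat -> C) : series (fun n => complex.Re (b n)) = (fun n => complex.Re (series b n)).
  by apply/funext => n; rewrite Re_sum.
have SIm (b : nat -> C) : series (fun n => complex.Im (b n)) = (fun n => complex.Im (series b n)).
  by apply/funext => n; rewrite Im_sum.
have hRe : forall x, D x -> series (fun n => complex.Re (a n x)) @ \oo --> complex.Re (csum (fun n => a n x)).
  by move=> x /asx/asum_cvg/cvg_Re; rewrite -SRe.
have hIm : forall x, D x -> series (fun n => complex.Im (a n x)) @ \oo --> complex.Im (csum (fun n => a n x)).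
  by move=> x /asx/asum_cvg/cvg_Im; rewrite -SIm.
have [mRe cRe] := @Rintegral_dominated_series R _ _ mu D (fun n x => complex.Re (a n x))
  (fun x => complex.Re (csum (fun n => a n x))) g K t mD ig K0 t01 (fun n => (ma n).1)
  (fun n x Dx => le_trans (normr_Re_le _) (ag n x Dx)) hRe.
have [mIm cIm] := @Rintegral_dominated_series R _ _ mu D (fun n x => complex.Im (a n x))
  (fun x => complex.Im (csum (fun n => a n x))) g K t mD ig K0 t01 (fun n => (ma n).2)
  (fun n x Dx => le_trans (normr_Im_le _) (ag n x Dx)) hIm.
split => //; first by move=> x Dx; rewrite mulrAC; exact/csum_le/asx.
apply/esym/csumE; apply: cvg_ReIm.
  by rewrite -SRe.
by rewrite -SIm.
Qed.

Lemma integrable_exp_decay (s : R) : 0 < s ->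
  mu.-integrable `[0, +oo[ (EFin \o (fun x => expR (- s * x))).
Proof.
move=> s0.
have : mu.-integrable `[0, +oo[ (fun x => s^-1%:E * (EFin \o exponential_pdf s) x)%E.
  apply: integrableZl => //.
  by apply: integrableS (integrable_exponential_pdf s0).
apply: eq_integrable => // x; rewrite inE/= in_itv/= andbT => x0.
by rewrite exponential_pdfE// -EFinM mulKf// gt_eqF.
Qed.

Section laplace_of_gf.
Variables (Enb : nat -> nat -> R -> R) (s : R).
Hypothesis s0 : 0 < s.
Hypothesis Enb01 : forall n b x, (0 < b)%N -> 0 <= Enb n b x <= 1.
Hypothesis mEnb : forall n b, (0 < b)%N -> measurable_fun setT (Enb n b).

(** The sum in [Egf] starts at b = 1; filling the slot b = 0 with zeros turns it into a [csum2]. *)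
Let E n b x : R := if b == 0%N then 0 else Enb n b x.

Let E01 n b x : 0 <= E n b x <= 1.
Proof. by rewrite /E; case: b => [|b]; rewrite ?lexx ?ler01//= Enb01. Qed.

Let mE n b : measurable_fun setT (E n b).
Proof. by rewrite /E; case: b => [|b]; [exact: measurable_cst|exact: mEnb]. Qed.

Lemma EgfE x (z w : C) :
  Egf Enb x z w = csum2 (fun n b => (E n b x)%:K * (z ^+ n * w ^+ b)).
Proof.
rewrite /Egf /csum2 {1}/csum; congr (limn _); apply/funext => n.
rewrite /series /=; case: n => [|n]; first by rewrite !big_geq.
rewrite [RHS]big_ltn// (@eq_csum _ _ (fun=> 0)) ?csum0 ?add0r; last first.
  by move=> k; rewrite /E /= rmorph0 mul0r.
apply: eq_big_nat => b /andP[b0 _]; rewrite /csum.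
rewrite (_ : series _ = (fun m => \big[+%R/0]_(0 <= k < m) ((Enb k b x)%:K * z ^+ k * w ^+ b)))//.
apply/funext => m; apply: eq_bigr => k _.
by rewrite /E gtn_eqF// mulrA.
Qed.

Lemma Estar_csum2 (z w : C) : cnorm z < 1 -> cnorm w < 1 ->
  Estar Enb s z w = csum2 (fun n b => (laplace_coef Enb s n b)%:K * (z ^+ n * w ^+ b)).
Proof.
move=> z1 w1; pose D : set R := `[0, +oo[%classic.
have mD : measurable D by exact: measurable_itv.
have ig : mu.-integrable D (EFin \o (fun x => expR (- s * x))) := integrable_exp_decay s0.
pose A n b x : C := (E n b x * expR (- s * x))%:K * (z ^+ n * w ^+ b).
have mEe n b : measurable_fun D (fun x => E n b x * expR (- s * x)).
  apply: measurable_funM; first exact: (measurable_funS measurableT (@subsetT _ _)).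
  by apply: measurableT_comp => //; exact: measurable_funM.
have Ee n b x : `|E n b x * expR (- s * x)| <= expR (- s * x).
  have /andP[h0 h1] := E01 n b x.
  by rewrite ger0_norm ?mulr_ge0 ?expR_ge0// ler_piMl ?expR_ge0.
have ReA n b x : complex.Re (A n b x) = E n b x * expR (- s * x) * complex.Re (z ^+ n * w ^+ b).
  by rewrite /A; case: (z ^+ n * w ^+ b) => p r /=; rewrite mul0r subr0.
have ImA n b x : complex.Im (A n b x) = E n b x * expR (- s * x) * complex.Im (z ^+ n * w ^+ b).
  by rewrite /A; case: (z ^+ n * w ^+ b) => p r /=; rewrite mul0r addr0.
have mA n b : measurable_fun D (fun x => complex.Re (A n b x)) /\
    measurable_fun D (fun x => complex.Im (A n b x)).
  split.
    by under eq_fun do rewrite ReA; exact: measurable_funM.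
  by under eq_fun do rewrite ImA; exact: measurable_funM.
have bA n b x : D x -> cnorm (A n b x) <= cnorm w ^+ b * cnorm z ^+ n * expR (- s * x).
  move=> _; rewrite /A cnormM cnorm_real cnormM !cnormX [cnorm z ^+ n * _]mulrC [leLHS]mulrC.
  by rewrite ler_wpM2l// mulr_ge0 ?exprn_ge0 ?cnorm_ge0.
have z01 : 0 <= cnorm z < 1 by rewrite cnorm_ge0.
have w01 : 0 <= cnorm w < 1 by rewrite cnorm_ge0.
have wb0 b : 0 <= cnorm w ^+ b by rewrite exprn_ge0 ?cnorm_ge0.
have inner b := @Cintegral_csum D _ (fun n => A n b) (cnorm w ^+ b) (cnorm z) mD ig (wb0 b) z01
  (fun n => mA n b) (fun n => bA n b).
have c0 : 0 <= (1 - cnorm z)^-1 by rewrite invr_ge0 subr_ge0 ltW.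
have [||_ _ _ outer] := @Cintegral_csum D _ (fun b x => csum (fun n => A n b x))
  (1 - cnorm z)^-1 (cnorm w) mD ig c0 w01.
- by move=> b; have [] := inner b.
- by move=> b x Dx; have [_ _ h _] := inner b; rewrite [X in X * _]mulrC; exact: h.
transitivity (Cintegral D (fun x => csum (fun b => csum (fun n => A n b x)))).
  rewrite /Estar; congr Cintegral; apply/funext => x; rewrite EgfE mulrC -csum2Z.
    by apply: eq_csum2 => n b; rewrite /A rmorphM mulrCA mulrA.
  apply: (@decays2_monomial _ _ 1) => // n b; rewrite cnorm_real.
  by have /andP[h0 h1] := E01 n b x; rewrite ger0_norm.
rewrite outer /csum2; apply: eq_csum => b; have [_ _ _ ->] := inner b.
apply: eq_csum => n; rewrite /Cintegral.
under eq_Rintegral do rewrite ReA.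
under [X in _ +i* X]eq_Rintegral do rewrite ImA.
have iE : mu.-integrable D (EFin \o (fun x => E n b x * expR (- s * x))).
  apply: (@le_integrable _ _ _ mu _ _ _ (EFin \o (fun x => expR (- s * x)))) => //.
    by apply/measurable_EFinP; exact: (mEe n b).
  by move=> x _; rewrite /= lee_fin (le_trans (Ee _ _ _))// ler_norm.
rewrite !RintegralZr//.
have -> : \int[mu]_(x in D) (E n b x * expR (- s * x)) = laplace_coef Enb s n b.
  rewrite /laplace_coef /E; case: b {inner outer mA bA ReA ImA mEe Ee iE wb0 A} => [|b]//=.
  under eq_Rintegral do rewrite mul0r.
  by rewrite Rintegral_cst// mul0r.
by case: (z ^+ n * w ^+ b) => p r; apply/eqP; rewrite eq_complex /= !mul0r subr0 addr0 !eqxx.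
Qed.

End laplace_of_gf.
End transform_series.

(** * Bounds and relations for the coefficients of F* *)

Section survival_series.
Context d (T : measurableType d) (R : realType) (P : probability T R).
Variables (q s : R).
Hypotheses (q0 : 0 <= q) (q1 : q < 1) (s0 : 0 < s).
Variable Omega : nat -> nat -> {RV P >-> \bar R}.
Local Notation e := (laplace_coef (survival Omega) s).

Definition tail_laplace (n b : nat) : R := limn (series (fun m => q ^+ m * e (n + m.+1)%N b)).

Let e_itv n b : 0 <= e n b <= s^-1 := survival_laplace_itv s0 Omega n b.

Let tail_cvg n b : series (fun m => q ^+ m * e (n + m.+1)%N b) @ \oo --> tail_laplace n b.
Proof. exact: survival_laplace_series_cvg. Qed.

(** Splitting off the term m = 0 of the series for n leaves q times the series for n + 1. *)
Lemma survival_laplaceS n b : e n.+1 b = tail_laplace n b - q * tail_laplace n.+1 b.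
Proof.
apply/eqP; rewrite eq_sym subr_eq eq_sym; apply/eqP.
have h : (fun N => series (fun m => q ^+ m * e (n + m.+1)%N b) N.+1) @ \oo -->
    e n.+1 b + q * tail_laplace n.+1 b.
  rewrite (_ : (fun N => _) = (fun N => e n.+1 b +
      q * series (fun m => q ^+ m * e (n.+1 + m.+1)%N b) N)).
    by apply: cvgD; [exact: cvg_cst|apply: cvgMr; exact: tail_cvg].
  apply/funext => N; rewrite /series /= big_nat_recl// expr0 mul1r addn1 mulr_sumr.
  by congr (_ + _); apply: eq_bigr => m _; rewrite exprS mulrA addSnnS.
have h2 : (fun N => series (fun m => q ^+ m * e (n + m.+1)%N b) N.+1) @ \oo --> tail_laplace n b.
  by rewrite (cvg_shiftS (series _)); exact: tail_cvg.
by rewrite -(cvg_lim _ h)// (cvg_lim _ h2).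
Qed.

Lemma tail_laplace_itv n b : 0 <= tail_laplace n b <= s^-1 / (1 - q).
Proof.
have is_cv : cvgn (series (fun m => q ^+ m * e (n + m.+1)%N b)).
  exact: survival_laplace_series_cvg.
apply/andP; split.
  apply: limr_ge => //; apply: nearW => N; apply: sumr_ge0 => m _.
  by rewrite mulr_ge0 ?exprn_ge0//; case/andP: (e_itv (n + m.+1) b).
apply: limr_le => //; apply: nearW => N; rewrite /series /= big_mkord.
apply: (@le_trans _ _ (\sum_(m < N) s^-1 * q ^+ m)).
  apply: ler_sum => m _; rewrite mulrC ler_wpM2r ?exprn_ge0//.
  by case/andP: (e_itv (n + m.+1) b).
rewrite -mulr_sumr ler_wpM2l ?invr_ge0 ?(ltW s0)//; exact: geometric_sum_le.
Qed.

Lemma tail_laplace0 n : tail_laplace n 0 = 0.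
Proof.
rewrite /tail_laplace (_ : series _ = cst 0) ?lim_cst//.
by apply/funext => N; rewrite /series /= big1// => m _; rewrite mulr0.
Qed.

Lemma measurable_survival n b : measurable_fun setT (survival Omega n b).
Proof.
apply: nonincreasing_measurable => // x y xy.
have mO z : measurable [set w | (z%:E < Omega n b w)%E].
  by rewrite -[X in measurable X]setTI; exact: emeasurable_fun_o_infty.
apply: fine_le; rewrite ?fin_num_measure//.
apply: le_measure; rewrite ?inE//.
by move=> w /=; apply: le_lt_trans; rewrite lee_fin.
Qed.

Lemma survival01 n b x : 0 <= survival Omega n b x <= 1.
Proof.
have mO z : measurable [set w | (z%:E < Omega n b w)%E].
  by rewrite -[X in measurable X]setTI; exact: emeasurable_fun_o_infty.
rewrite fine_ge0 ?measure_ge0//= -lee_fin fineK ?fin_num_measure//.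
exact: probability_le1.
Qed.

End survival_series.

Theorem corollary3p2 (R : realType) (q rho : R)
    (hq0 : 0 <= q) (hq1 : q < 1) (hrho0 : 0 < rho) (hrho1 : rho < 1 - q)
    (d : measure_display) (T : measurableType d) (P : probability T R)
    (Q : batch_input P) (hQ : MXM1_input Q rho q)
    (Omega : nat -> nat -> {RV P >-> \bar R})
    (hOmega : forall n b, (1 <= b)%N -> batch_sojourn Q n b (Omega n b))
    (s : R) (hs : 0 < s) (u v : cplx R)
    (hu0 : 0 < `|u|) (hu1 : `|u| < 1) (hv : `|v| < 1)
    (hP : Ppoly rho q s u != 0) :
  [/\ derivable (fun z : cplx R => Phi (survival Omega) rho q s z v) u 1,
      derivable (fun z : cplx R => Phi (survival Omega) rho q s u z) v 1 &
      derive1 (fun z : cplx R => Phi (survival Omega) rho q s z v) u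
      - (u - (q%:C : cplx R)) / Ppoly rho q s u * v * (1 - v)
        * derive1 (fun z : cplx R => Phi (survival Omega) rho q s u z) v
      + ell (survival Omega) rho q s u v = 0].
Proof.
move: hu0 hu1 hv; rewrite !cnormE !ltcR => hu0 hu1 hv.
apply: (@generating_function_pde R (survival Omega) rho q s
  (laplace_coef (survival Omega) s) (tail_laplace q s Omega)) => //.
- by move=> z w z1 w1; apply: Estar_csum2 => // n b; [move=> x _; exact: survival01|
    move=> _; exact: measurable_survival].
- exists s^-1; first by rewrite invr_ge0 ltW.
  move=> n b; rewrite cnorm_real.
  by have /andP[h0 h1] := survival_laplace_itv hs Omega n b; rewrite ger0_norm.
- exists (s^-1 / (1 - q)); first by rewrite divr_ge0 ?invr_ge0 ?subr_ge0 1?ltW.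
  move=> n b; rewrite cnorm_real.
  by have /andP[h0 h1] := tail_laplace_itv hq0 hq1 hs Omega n b; rewrite ger0_norm.
- exact: survival_laplaceS.
- exact: tail_laplace0.
- by move=> n b b0; exact: (survival_laplace_rec hrho0 hq0 hq1 hs hQ hOmega).
Qed.
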